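(* Let $A$ be a real isotropic $d\times d$ dilation matrix, let $m\ge1$, and let $\phi^m$ be the corresponding elliptic scaling function of order $m$. Then $\phi^m$ satisfies the Strang--Fix conditions of order $2m-1$: $$D^{n}\hat\phi^m(2\pi k)=0\qquad\text{for all }k\in\mathbb{Z}^d\setminus\{0\}\text{ and all } n\in\mathbb{Z}^d_{\ge0}\text{ with }0\le|n|\le 2m-1.$$ Consequently, the span of the integer shifts of $\phi^m$ (i.e. the set of sums $\sum_{k\in\mathbb{Z}^d}c(k)\phi^m(\cdot-k)$) contains all polynomials on $\mathbb{R}^d$ of total degree $\le 2m-1$.
   Context: A real isotropic dilation matrix is a $d\times d$ matrix $A$ with integer entries, all of whose eigenvalues are greater than $1$ in absolute value, which is diagonalizable over $\mathbb{C}$ and all of whose eigenvalues have equal absolute value. Put $q:=|\det A|$ and $A^{-T}:=(A^T)^{-1}$. One can factor $A^{-T}=q^{-1/d}Q^{-1}UQ$ with $U$ real orthogonal and $Q$ real symmetric positive definite; fix such a $Q$ and write $Q^2=(q_{ij})_{1\le i,j\le d}$. Define $$P(\xi):=\xi^TQ^2\xi=\sum_{i} q_{ii}\xi_i^2+2\sum_{i<j}q_{ij}\xi_i\xi_j,\qquad G(\xi):=4\sum_{i} q_{ii}\sin^2\frac{\xi_i}{2}+2\sum_{i<j}q_{ij}\sin\xi_i\sin\xi_j .$$ Let $S(A^T):=\{s\in[0,1)^d: A^Ts\in\mathbb{Z}^d\}$ (this set has $q$ elements and contains $0$), and define the mask $$m_0(\xi):=\prod_{s\in S(A^T)\setminus\{0\}}\frac{G(\xi+2\pi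 s)}{G(2\pi s)}.$$ Define $$\mu(\xi):=\frac{q^{2/d}\,m_0(A^{-T}\xi)\,G(A^{-T}\xi)}{G(\xi)},$$ where at the points of $2\pi\mathbb{Z}^d$ (zeros of $G$) the value is understood as the limit, and $M(\xi):=\prod_{j=0}^\infty\mu\bigl((A^{-T})^j\xi\bigr)$. The elliptic scaling function $\phi$ is the tempered distribution with $\hat\phi(\xi)=\prod_{j=1}^\infty m_0((A^{-T})^j\xi)=\frac{G(\xi)}{P(\xi)}M(\xi)$ (with $G/P:=1$ at $\xi=0$); it is compactly supported. The elliptic scaling function of order $m$ is $\phi^1:=\phi$, $\phi^m:=\phi*\phi^{m-1}$, i.e. $\hat\phi^m(\xi)=(\hat\phi(\xi))^m$. The Fourier transform is $\hat f(\xi)=\int_{\mathbb{R}^d} f(x)e^{-i\xi\cdot x}\,dx$. For a multi-index $n$, $D^n=\partial_1^{n_1}\cdots\partial_d^{n_d}$ and $|n|=n_1+\dots+n_d$. *)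

(* Defs.v *)
From HB Require Import structures.
From mathcomp Require Import all_boot all_order all_algebra finmap.
From mathcomp Require Import complex.
From mathcomp Require Import all_classical all_reals all_analysis.

Set Implicit Arguments.
Unset Strict Implicit.
Unset Printing Implicit Defensive.

Import Order.TTheory GRing.Theory Num.Theory.
Import numFieldNormedType.Exports.

Local Open Scope classical_set_scope.
Local Open Scope complex_scope.
Local Open Scope ring_scope.

Section IsotropicDilation.
Variables (R : realType) (d : nat).

Definition intC : int -> R[i] := fun z => z%:~R.
Definition intR (m n : nat) (B : 'M[int]_(m, n)) : 'M[R]_(m, n) :=
  map_mx (fun z : int => z%:~R) B.

Definition isotropic_dilation (A : 'M[int]_d) : Prop :=
  let AC := map_mx intC A in
  [/\ forall a, eigenvalue AC a -> 1 < `|a|,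
      diagonalizable AC &
      forall a b, eigenvalue AC a -> eigenvalue AC b -> `|a| = `|b|].

Definition invtr (A : 'M[int]_d) : 'M[R]_d := invmx (intR A)^T.

Definition orthogonal_mx (U : 'M[R]_d) : Prop := U^T *m U = 1%:M.

Definition is_sym_posdef (Q : 'M[R]_d) : Prop :=
  Q^T = Q /\ forall x : 'cV[R]_d, x != 0 -> 0 < (x^T *m Q *m x) 0 0.

Definition isotropic_factor (A : 'M[int]_d) (Q : 'M[R]_d) : Prop :=
  is_sym_posdef Q /\
  exists2 U : 'M[R]_d, orthogonal_mx U &
    invtr A = (`|\det A|%N%:R `^ (- d%:R^-1)) *: (invmx Q *m U *m Q).

End IsotropicDilation.

Section EllipticMask.
Variables (R : realType) (d : nat).
Variables (A : 'M[int]_d) (Q : 'M[R]_d).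

Definition ellG (xi : 'cV[R]_d) : R :=
  let q := Q *m Q in
  4 * (\sum_(i < d) q i i * sin (xi i 0 / 2) ^+ 2) +
  2 * (\sum_(i < d) \sum_(j < d | (i < j)%N) q i j * sin (xi i 0) * sin (xi j 0)).

(* S(A^T) *)
Definition digit_set : set 'cV[R]_d :=
  [set s : 'cV[R]_d | (forall i, 0 <= s i 0 < 1) /\
           exists k : 'cV[int]_d, (intR R A)^T *m s = intR R k].

(* The digit set is finite, so this is the product over all s in S(A^T) \ {0}. *)
Definition elliptic_mask (xi : 'cV[R]_d) : R :=
  \big[*%R/1]_(s \in digit_set `\ 0)
    (ellG (xi + (2 * pi) *: s) / ellG ((2 * pi) *: s)).

Definition scaling_hat (xi : 'cV[R]_d) : R :=
  limn (fun n => \prod_(1 <= j < n.+1) elliptic_mask (invtr R A ^+ j *m xi)).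

End EllipticMask.

Section Distributions.
Variables (R : realType) (d : nat).
Implicit Types (f g F : 'cV[R]_d -> R[i]) (x y xi : 'cV[R]_d).

Definition re f : 'cV[R]_d -> R := fun x => complex.Re (f x).
Definition im f : 'cV[R]_d -> R := fun x => complex.Im (f x).

Definition basis_vec (i : 'I_d) : 'cV[R]_d := delta_mx i 0.

Definition pderiv (i : 'I_d) f : 'cV[R]_d -> R[i] := fun x =>
  'D_(basis_vec i) (re f) x +i* 'D_(basis_vec i) (im f) x.

Definition pderivs (s : seq 'I_d) f : 'cV[R]_d -> R[i] := foldr pderiv f s.

(* D^n for a multi-index n. *)
Definition mderiv (n : 'I_d -> nat) f : 'cV[R]_d -> R[i] :=
  pderivs (flatten [seq nseq (n i) i | i <- enum 'I_d]) f.

(* 'D_v is a total operator, so existence of the partial derivatives has to be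
   required explicitly. *)
Definition smooth f : Prop := forall s : seq 'I_d,
  let g := pderivs s f in
  [/\ continuous (re g), continuous (im g) &
      forall i x, derivable (re g) x (basis_vec i) /\
                  derivable (im g) x (basis_vec i)].

Definition schwartz f : Prop := smooth f /\
  forall (N : nat) (s : seq 'I_d), exists C : R,
    forall x, (1 + `|x|) ^+ N * Normc.normc (pderivs s f x) <= C.

Definition test_function f : Prop := smooth f /\
  exists r : R, forall x, r < `|x| -> f x = 0.

End Distributions.

(* Integral over R^d as an iterated one-dimensional Lebesgue integral; it is
   only applied to continuous functions that decay rapidly or have compact
   support, for which it is the Lebesgue integral over R^d by Fubini. *)
Fixpoint int_Rd (R : realType) (d : nat) : ('cV[R]_d -> R) -> R :=
  match d with
  | 0%N => fun f => f 0
  | e.+1 => fun f => Rintegral (@lebesgue_measure R) setT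
      (fun t : R => int_Rd (fun y : 'cV[R]_e => f (col_mx (t%:M : 'cV[R]_1) y)))
  end.

Section TemperedDistributions.
Variables (R : realType) (d : nat).
Implicit Types (f g F : 'cV[R]_d -> R[i]) (x y xi : 'cV[R]_d).

Definition cint f : R[i] := int_Rd (re f) +i* int_Rd (im f).

Definition dotp x y : R := \sum_i x i 0 * y i 0.

Definition expi (t : R) : R[i] := cos t +i* sin t.

Definition fourier f : 'cV[R]_d -> R[i] := fun xi =>
  cint (fun x => f x * expi (- dotp xi x)).

(* A functional on arbitrary functions; only its values on Schwartz functions
   are meaningful. *)
Definition functional : Type := ('cV[R]_d -> R[i]) -> R[i].
Implicit Types T S : functional.

(* Continuity on the Schwartz space: boundedness by finitely many of the
   seminorms defining its topology. *)
Definition tempered T : Prop :=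
  (forall (a : R[i]) f g, schwartz f -> schwartz g ->
     T (fun x => a * f x + g x) = a * T f + T g) /\
  exists (N : nat) (C : R), forall f (B : R), schwartz f ->
    (forall (s : seq 'I_d) x, (size s <= N)%N ->
       (1 + `|x|) ^+ N * Normc.normc (pderivs s f x) <= B) ->
    Normc.normc (T f) <= C * B.

(* The Fourier transform of T is the slowly growing function F. *)
Definition has_fourier T F : Prop :=
  (exists (N : nat) (C : R), forall x,
     Normc.normc (F x) <= C * (1 + `|x|) ^+ N) /\
  forall f, schwartz f -> T (fourier f) = cint (fun xi => F xi * f xi).

Definition convolution T S : functional :=
  fun f => T (fun x => S (fun y => f (x + y))).

Definition convolution_pow T (m : nat) : functional := iter m.-1 (convolution T) T.

(* T(. - k) acts on f as T acts on f(. + k). *)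
Definition translate (k : 'cV[int]_d) T : functional :=
  fun f => T (fun x => f (x + intR R k)).

Definition polynomial_deg_le (N : nat) (p : 'cV[R]_d -> R[i]) : Prop :=
  exists a : {ffun 'I_d -> 'I_N.+1} -> R[i], forall x,
    p x = \sum_(al : {ffun 'I_d -> 'I_N.+1} | (\sum_i al i <= N)%N)
            a al * \prod_i (x i 0)%:C ^+ al i.

(* A smooth F is determined by T, so F is the function D^n is applied to. *)
Definition strang_fix T (N : nat) : Prop :=
  exists F, [/\ smooth F, has_fourier T F &
    forall (k : 'cV[int]_d) (n : 'I_d -> nat), k != 0 ->
      (\sum_i n i <= N)%N -> mderiv n F ((2 * pi) *: intR R k) = 0].

(* The family u over Z^d is unconditionally summable with sum l. *)
Definition unconditional_sum (u : 'cV[int]_d -> R[i]) (l : R[i]) : Prop :=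
  forall e : R, 0 < e -> exists K0 : {fset 'cV[int]_d},
    forall K : {fset 'cV[int]_d}, (K0 `<=` K)%fset ->
      Normc.normc (\sum_(k <- K) u k - l) < e.

(* F is the sum over k of c k * T(. - k), in the sense of distributions. *)
Definition in_shift_span T F : Prop :=
  exists c : 'cV[int]_d -> R[i], forall f, test_function f ->
    unconditional_sum (fun k => c k * translate k T f)
      (cint (fun x => F x * f x)).

Definition elliptic_scaling (A : 'M[int]_d) (Q : 'M[R]_d) T : Prop :=
  tempered T /\ has_fourier T (fun xi => (scaling_hat A Q xi)%:C).

End TemperedDistributions.

(* Main.v *)
Require Import Defs.
From mathcomp Require Import all_boot all_order all_algebra finmap.
From mathcomp Require Import complex.
From mathcomp Require Import all_classical all_reals all_analysis measurable_realfun.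
From mathcomp Require Import ring lra zify.

(** The symbol G is a nonnegative trigonometric polynomial that vanishes only on
    2 pi Z^d, because it exceeds 4 sum_i q_ii sin^4(xi_i/2) by a value of the
    quadratic form of Q^2 (ellG_lower). Let k be a nonzero integer vector. The
    orbit of k under A^-T tends to 0, hence it leaves Z^d at some point z for which
    A^T z is still integral. The fractional part s of - z is then a nonzero digit,
    and the factor G(2 pi (z + s)) of the mask at 2 pi z vanishes (mask_eq0,
    invtr_orbit). So the transform of phi vanishes at 2 pi k; being smooth and
    nonnegative, it has a double zero there (scaling_hat_props), and its power
    P of exponent m vanishes to order 2m, which is the Strang-Fix property.
    Smoothness and polynomial growth of the infinite product hold because its
    partial products, with their derivatives, are bounded by a telescoping product,
    and because the factor at the scale A^-jT is close to 1 at a geometric rate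
    (infinite_product).

    For the reproduction of polynomials, a test function is written as the Fourier
    transform of a Schwartz function g. Convolution powers are products on the
    Fourier side, so the translate of phi^m by k pairs with it to the value at k of
    the transform of P g (convolution_powE, translate_fourier). By Poisson summation
    the sum over k of k^s times this value is, up to a constant, the derivative D^s
    of P g at the origin, when |s| < 2m: the derivatives of P g vanish at the other
    points of 2 pi Z^d (monomial_sum). Since P(0) = 1, these values form a
    triangular system in the derivatives of g at the origin; it is solved for
    D^s g(0) (derivative_sum), which by Fourier inversion is, up to a constant, the
    integral of x^s against the test function (cint_monomial).

    The analysis is carried out for real functions. An integral over R^d is
    iterated, and everything is estimated by the product of the weights
    1/(1 + x_i^2). Poisson summation is proved one variable at a time, starting
    from the Fejer kernel on the line (poisson1, poisson), and Fourier inversion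
    follows by comparing Riemann sums on finer and finer lattices with sums over
    coarser and coarser dual lattices (inversion_cos). *)

Set Implicit Arguments.
Unset Strict Implicit.
Unset Printing Implicit Defensive.

Import Order.TTheory GRing.Theory Num.Theory.
Import numFieldNormedType.Exports.

Local Open Scope classical_set_scope.
Local Open Scope ring_scope.

(** * One-variable calculus *)

Section OneVariable.
Variable R : realType.
Implicit Types (u v w : R -> R) (a b h t : R).

(** Derivatives below come from quadratic remainder estimates, because such an
    estimate survives integration and summation over a parameter. *)
Lemma is_derive_quad (V : normedModType R) (f : V -> R) (x v : V) (l C : R) :
  (forall h : R, `|h| <= 1 -> `|f (x + h *: v) - f x - h * l| <= C * h ^+ 2) ->
  is_derive x v f l.
Proof.
move=> H.
have C0 : 0 <= C.
  by have := H 1; rewrite normr1 lexx expr1n mulr1 => /(_ isT); exact: le_trans.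
have cv : h^-1 *: (f (h *: v + x) - f x) @[h --> (0:R)^'] --> l.
  apply/cvgrPdist_le => e e0.
  near=> h.
  have h0 : h != 0 by near: h; exact: nbhs_dnbhs_neq.
  have h1 : `|h| <= 1.
    near: h; apply: dnbhs0_le; exact: ltr01.
  have h2 : `|h| <= e / (C + 1).
    near: h; apply: dnbhs0_le; rewrite divr_gt0//; lra.
  have -> : l - h^-1 *: (f (h *: v + x) - f x) = - (h^-1 * (f (x + h *: v) - f x - h * l)).
    rewrite addrC [x + _]addrC /GRing.scale /=; field.
    by [].
  rewrite normrN normrM normfV ler_pdivrMl ?normr_gt0//.
  apply: (le_trans (H h h1)); rewrite -real_normK ?num_real// expr2.
  rewrite mulrCA ler_wpM2l//.
  rewrite ler_pdivlMr in h2; last lra.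
  by apply: le_trans h2; rewrite mulrC ler_wpM2l// lerDl.
split; first by apply/cvg_ex; exists l.
exact: cvg_lim cv.
Unshelve. all: by end_near. Qed.

(** Reduces a partial derivative to a function of one real variable, where the
    mean value theorem applies. *)
Lemma is_derive_line (V : normedModType R) (f : V -> R) (x v : V) (t l : R) :
  is_derive (x + t *: v) v f l <-> is_derive t 1 (fun s => f (x + s *: v)) l.
Proof.
have E : (fun h => h^-1 *: (f (h *: v + (x + t *: v)) - f (x + t *: v))) =
  (fun h : R => h^-1 *: (f (x + (h *: 1 + t) *: v) - f (x + t *: v))).
  apply/funext => h; congr (_ *: (f _ - _)).
  by rewrite scalerDl [_%:A]mulr1 addrCA.
split=> -[/= D1 D2]; split.
- by rewrite /derivable -E.
- by rewrite -D2 /derive -E.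
- by rewrite /derivable E.
- by rewrite -D2 /derive E.
Qed.

Lemma mvt u u' a h : (forall t, is_derive t 1 u (u' t)) ->
  exists2 c, 0 <= c <= 1 & u (a + h) - u a = h * u' (a + c * h).
Proof.
move=> du.
have cu x : {for x, continuous u}.
  apply: differentiable_continuous; apply/derivable1_diffP; exact: ex_derive.
have ch (a0 b0 : R) : {within `[a0, b0], continuous u}.
  by apply: continuous_subspaceT => x; exact: cu.
have [h0|h0|<-] := ltgtP 0 h; last by exists 0; rewrite ?lexx ?ler01// addr0 subrr mul0r.
- have [||c] := @MVT R u u' a (a + h); rewrite ?ltrDl//.
  rewrite in_itv/= => /andP[c1 c2] ->.
  exists ((c - a) / h).
    2: by rewrite divfK ?gt_eqF// [a + (c - a)]addrC subrK addrAC subrr add0r mulrC.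
  by rewrite ler_pdivlMr// ler_pdivrMr//; apply/andP; split; lra.
- have [||c] := @MVT R u u' (a + h) a; rewrite ?gtrDl//.
  rewrite in_itv/= => /andP[c1 c2] E.
  exists ((c - a) / h).
    2: by rewrite divfK ?lt_eqF// [a + (c - a)]addrC subrK -opprB E; ring.
  by rewrite ler_ndivlMr// ler_ndivrMr//; apply/andP; split; lra.
Qed.

Lemma taylor2 u u' u'' a h M : (forall t, is_derive t 1 u (u' t)) ->
  (forall t, is_derive t 1 u' (u'' t)) ->
  (forall c, 0 <= c <= 1 -> `|u'' (a + c * h)| <= M) ->
  `|u (a + h) - u a - h * u' a| <= M * h ^+ 2.
Proof.
move=> du ddu HM.
have [c /andP[c0 c1] ->] := mvt a h du.
have [c' /andP[c0' c1'] E] := mvt a (c * h) ddu.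
rewrite -mulrBr E.
have HH : `|u'' (a + c' * (c * h))| <= M.
  by rewrite mulrA; apply: HM; rewrite mulr_ge0//= mulr_ile1.
have -> : h * (c * h * u'' (a + c' * (c * h))) =
  u'' (a + c' * (c * h)) * (c * h ^+ 2) by ring.
rewrite normrM; apply: ler_pM => //.
rewrite ger0_norm; last by rewrite mulr_ge0// sqr_ge0.
by rewrite ler_piMl// sqr_ge0.
Qed.

(** Both w - u and w + u have a nonnegative derivative between a and b. *)
Lemma derive_comparison u u' w w' a b : a <= b ->
  (forall t, is_derive t 1 u (u' t)) -> (forall t, is_derive t 1 w (w' t)) ->
  (forall t, a <= t <= b -> `|u' t| <= w' t) ->
  `|u b - u a| <= w b - w a.
Proof.
move=> ab du dw H.
have key (e : R) : `|e| = 1 -> e * (u b - u a) <= w b - w a.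
  move=> e1.
  have dd t : is_derive t 1 (fun t => w t - e * u t) (w' t - e * u' t).
    exact: is_deriveB.
  have [c /andP[c0 c1]] := mvt a (b - a) dd.
  rewrite [a + (b - a)]addrC subrK => E.
  have ba : 0 <= b - a by rewrite subr_ge0.
  have : 0 <= (b - a) * (w' (a + c * (b - a)) - e * u' (a + c * (b - a))).
    rewrite mulr_ge0// subr_ge0 (le_trans (ler_norm _))// normrM e1 mul1r H//.
    apply/andP; split; first by rewrite lerDl mulr_ge0.
    by rewrite -lerBrDl ler_piMl.
  rewrite -E; lra.
by rewrite ler_norml; apply/andP; split;
  [have := key (-1); rewrite normrN1 => /(_ erefl)|have := key 1; rewrite normr1 => /(_ erefl)]; lra.
Qed.

End OneVariable.

(** * Integrals over the line *)

Section OneDimensionalIntegral.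
Variable R : realType.
Implicit Types (g : R -> R) (a b t C : R).
Notation mu := (@lebesgue_measure R).

(** The weight that measures decay on the line; the arc tangent is a primitive. *)
Definition cauchyw t : R := (1 + t ^+ 2)^-1.

Lemma cauchyw_gt0 t : 0 < cauchyw t.
Proof. by rewrite invr_gt0 ltr_pwDl// sqr_ge0. Qed.

Lemma cauchyw_ge0 t : 0 <= cauchyw t. Proof. exact/ltW/cauchyw_gt0. Qed.

Lemma cauchyw_le1 t : cauchyw t <= 1.
Proof. by rewrite invf_le1 ?lerDl ?sqr_ge0// ltr_pwDl// sqr_ge0. Qed.

Lemma is_derive_continuous g (g' : R -> R) :
  (forall t, is_derive t 1 g (g' t)) -> continuous g.
Proof.
move=> dg x; apply: differentiable_continuous; apply/derivable1_diffP.
exact: ex_derive.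
Qed.

Lemma continuous_cauchyw : continuous cauchyw.
Proof.
move=> x; rewrite /cauchyw; apply: cvgV.
  by rewrite gt_eqF// ltr_pwDl// sqr_ge0.
by apply: cvgD; [exact: cvg_cst|apply: exprn_continuous].
Qed.

(** The limit of the arc tangent at infinity, hence half the integral of the
    weight. *)
Definition atan_sup : R := sup (range (@atan R)).

Lemma atan_nd : nondecreasing_fun (@atan R).
Proof.
move=> a b ab; rewrite -subr_ge0.
have [c _] := @mvt R atan cauchyw a (b - a) (@is_derive1_atan R).
rewrite [a + _]addrC subrK => ->.
by rewrite mulr_ge0 ?cauchyw_ge0// subr_ge0.
Qed.

Lemma atan_cvgy : atan x @[x --> +oo] --> atan_sup.
Proof.
apply: nondecreasing_cvgr; first exact: atan_nd.
by exists (pi / 2) => _ [x _ <-]; rewrite ltW// atan_ltpi2.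
Qed.

Lemma atan_le_sup t : atan t <= atan_sup.
Proof.
apply: ub_le_sup; last by exists t.
by exists (pi / 2) => _ [x _ <-]; rewrite ltW// atan_ltpi2.
Qed.

Lemma atan_tail e : 0 < e -> exists T : R, forall b, T <= b -> atan_sup - atan b <= e.
Proof.
move=> e0; have /cvgrPdist_le/(_ e e0)[T [_ H]] := atan_cvgy.
exists (T + 1) => b Tb.
have /H : T < b by lra.
by apply: le_trans; exact: ler_norm.
Qed.

Lemma cauchyw_tail b : (\int[mu]_(x in `[b, +oo[) (cauchyw x)%:E =
  (atan_sup - atan b)%:E)%E.
Proof.
rewrite (@ge0_continuous_FTC2y R _ atan _ atan_sup) ?EFinB//.
- by move=> x _; exact: cauchyw_ge0.
- by apply: continuous_subspaceT => x; exact: continuous_cauchyw.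
- exact: atan_cvgy.
- by apply: cvg_at_right_filter; exact: continuous_atan.
- by move=> x _ /=; rewrite derive1E derive_val.
Qed.

Lemma integrable_cauchyw : mu.-integrable setT (EFin \o cauchyw).
Proof.
apply/integrableP; split.
  by apply/measurable_EFinP; apply: continuous_measurable_fun; exact: continuous_cauchyw.
under eq_integral do rewrite /= ger0_norm ?cauchyw_ge0//.
rewrite ge0_symfun_integralT.
- by rewrite -set_itvcy cauchyw_tail -EFinM ltry.
- exact: cauchyw_ge0.
- exact: continuous_cauchyw.
- by move=> t /=; rewrite /cauchyw sqrrN.
Qed.

Lemma cauchyw_integralT : \int[mu]_x cauchyw x = 2 * atan_sup.
Proof.
rewrite /Rintegral ge0_symfun_integralT.
- by rewrite -set_itvcy cauchyw_tail atan0 subr0.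
- exact: cauchyw_ge0.
- exact: continuous_cauchyw.
- by move=> t /=; rewrite /cauchyw sqrrN.
Qed.

Lemma integrable_dominated g C : continuous g ->
  (forall t, `|g t| <= C * cauchyw t) -> mu.-integrable setT (EFin \o g).
Proof.
move=> cg H.
have : mu.-integrable setT (EFin \o (fun t => C * cauchyw t)).
  rewrite (_ : _ \o _ = (fun t => C%:E * (EFin \o cauchyw) t)%E).
    by apply: integrableZl => //; exact: integrable_cauchyw.
  by apply/funext => t; rewrite /= EFinM.
apply: le_integrable => //.
  by apply/measurable_EFinP; exact: continuous_measurable_fun.
move=> t _ /=; rewrite lee_fin (le_trans (H t))//; exact: ler_norm.
Qed.

(** The fundamental theorem of calculus on the whole line; the tails of the
    integral are controlled by those of the weight. *)
Lemma primitive_exists g C : continuous g ->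
    (forall t, `|g t| <= C * cauchyw t) ->
  exists2 V : R -> R, forall t, is_derive t 1 V (g t) &
   forall a b, `|V b - V a - \int[mu]_x g x| <=
     C * ((atan_sup - atan b) + (atan_sup + atan a)).
Proof.
move=> cg H; have ig := integrable_dominated cg H.
have iC : mu.-integrable setT (EFin \o (fun t => C * cauchyw t)).
  rewrite (_ : _ \o _ = (fun t => C%:E * (EFin \o cauchyw) t)%E).
    by apply: integrableZl => //; exact: integrable_cauchyw.
  by apply/funext => t; rewrite /= EFinM.
have tail f b : mu.-integrable setT (EFin \o f) ->
    \int[mu]_x f x - \int[mu]_(x in [set` `]-oo, b]]) f x =
    \int[mu]_(x in `]b, +oo[) f x.
  move=> iif; rewrite -set_itvNyy Rintegral_itvB//.
  by rewrite set_itvNyy.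
have Ctail b : \int[mu]_(x in `]b, +oo[) (C * cauchyw x) = C * (atan_sup - atan b).
  rewrite RintegralZl//; last by apply: integrableS integrable_cauchyw.
  rewrite Rintegral_itv_obnd_cbnd; last by apply: integrableS integrable_cauchyw.
  by rewrite /Rintegral cauchyw_tail.
have absint D : measurable D ->
    `|\int[mu]_(x in D) g x| <= \int[mu]_(x in D) (C * cauchyw x).
  move=> mD; apply: le_trans (le_normr_Rintegral _ _) _ => //.
    exact: integrableS ig.
  apply: le_Rintegral => //.
    by apply: integrable_norm; exact: integrableS ig.
  by apply: integrableS iC.
exists (fun x => \int[mu]_(t in [set` `]-oo, x]]) g t).
  move=> t; have tt : t < t + 1 by rewrite ltrDl.
  have it : mu.-integrable [set` `]-oo, (t + 1)]] (EFin \o g) by exact: integrableS ig.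
  have [/= D1 D2] := @continuous_FTC1 R g -oo%O t (t + 1) tt it (ltNyr _) (cg t).
  by apply: DeriveDef; [exact: D1 | rewrite -D2 derive1E].
move=> a b.
have -> : \int[mu]_(t in [set` `]-oo, b]]) g t - \int[mu]_(t in [set` `]-oo, a]]) g t
   - \int[mu]_x g x = - (\int[mu]_(x in `]b, +oo[) g x) - \int[mu]_(t in [set` `]-oo, a]]) g t.
  by rewrite -(tail g b ig) opprB addrAC.
rewrite mulrDr (le_trans (ler_normB _ _))//; apply: lerD.
  by rewrite normrN (le_trans (absint _ _))// Ctail.
rewrite (le_trans (absint _ _))// le_eqVlt; apply/orP; left; apply/eqP.
have := tail _ a iC; rewrite Ctail RintegralZl//; last exact: integrable_cauchyw.
rewrite cauchyw_integralT; lra.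
Qed.

Lemma Rintegral_linear g h C a : continuous g -> continuous h ->
  (forall t, `|g t| <= C * cauchyw t) -> (forall t, `|h t| <= C * cauchyw t) ->
  \int[mu]_x (a * g x + h x) = a * \int[mu]_x g x + \int[mu]_x h x.
Proof.
move=> cg ch Hg Hh.
have ig := integrable_dominated cg Hg; have ih := integrable_dominated ch Hh.
rewrite RintegralD//; first by rewrite RintegralZl.
rewrite (_ : _ \o _ = (fun t => a%:E * (EFin \o g) t)%E).
  exact: integrableZl.
by apply/funext => t; rewrite /= EFinM.
Qed.

Lemma Rintegral_bound g C : continuous g ->
  (forall t, `|g t| <= C * cauchyw t) -> `|\int[mu]_x g x| <= C * (2 * atan_sup).
Proof.
move=> cg H; have ig := integrable_dominated cg H.
rewrite -cauchyw_integralT -RintegralZl//; last exact: integrable_cauchyw.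
apply: le_trans (le_normr_Rintegral _ _) _ => //.
apply: le_Rintegral => //; first exact: integrable_norm.
  rewrite (_ : _ \o _ = (fun t => C%:E * (EFin \o cauchyw) t)%E).
    by apply: integrableZl => //; exact: integrable_cauchyw.
  by apply/funext => t; rewrite /= EFinM.
Qed.

(** Two primitives differ by a constant, so the increments of any of them
    converge to the integral. *)
Lemma primitive_cvg (V g : R -> R) C : continuous g ->
    (forall t, `|g t| <= C * cauchyw t) -> (forall t, is_derive t 1 V (g t)) ->
  forall e, 0 < e -> exists T : R, forall a b, a <= - T -> T <= b ->
    `|V b - V a - \int[mu]_x g x| <= e.
Proof.
move=> cg H dV e e0.
have [W dW HW] := primitive_exists cg H.
have VW a b : V b - V a = W b - W a.
  have dd t : is_derive t 1 (fun t => V t - W t) 0.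
    by rewrite -(subrr (g t)); exact: is_deriveB.
  have [c _] := mvt a (b - a) dd.
  rewrite [a + _]addrC subrK mulr0; lra.
have C0 : 0 <= C.
  by have := H 0; rewrite /cauchyw expr0n addr0 invr1 mulr1; exact: le_trans.
have e2 : 0 < e / (2 * (C + 1)) by rewrite divr_gt0//; lra.
have [T HT] := atan_tail e2.
exists T => a b aT Tb; rewrite VW (le_trans (HW a b))//.
have := HT b Tb; have := HT (- a); rewrite atanN lerNr => /(_ aT) h1 h2.
have e3 : e = (C + 1) * (e / (2 * (C + 1)) + e / (2 * (C + 1))).
  by field; rewrite gt_eqF//; lra.
rewrite {}e3; apply: ler_pM => //; last lra.
  by have := atan_le_sup b; have := atan_le_sup (- a); rewrite atanN; lra.
by rewrite lerDl.
Qed.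

End OneDimensionalIntegral.

(** * Slowly growing and rapidly decreasing smooth functions *)

Section SmoothClasses.
Variables (R : realType) (d : nat).
Local Notation V := 'cV[R]_d.
Implicit Types (f g : V -> R) (x y v : V) (i j : 'I_d) (s : seq 'I_d).

(** Locked, since unification would otherwise unfold partial derivatives. *)
Definition pd i f : V -> R := locked (fun x => 'D_(basis_vec R i) f x).
Definition pds s f : V -> R := foldr pd f s.

Lemma pds_rcons s i f : pds (rcons s i) f = pds s (pd i f).
Proof. by rewrite /pds foldr_rcons. Qed.

Definition pdable f := forall i x, derivable f x (basis_vec R i).

Lemma pdE i f : pd i f = fun x => 'D_(basis_vec R i) f x.
Proof. by rewrite /pd -lock. Qed.

Lemma pdP f i x : pdable f -> is_derive x (basis_vec R i) f (pd i f x).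
Proof. by rewrite pdE => h; apply: derivableP. Qed.

Lemma pd_val f i x l : is_derive x (basis_vec R i) f l -> pd i f x = l.
Proof. by rewrite pdE; case. Qed.

Definition slow f := exists N C, forall x, `|f x| <= C * (1 + `|x|) ^+ N.
Definition rapid f := forall N : nat, exists C, forall x, (1 + `|x|) ^+ N * `|f x| <= C.

Lemma onenorm_gt0 x : 0 < 1 + `|x|. Proof. by rewrite ltr_pwDl. Qed.
Lemma onenorm_ge1 x : 1 <= 1 + `|x|. Proof. by rewrite lerDl. Qed.
Lemma onenormX_gt0 x N : 0 < (1 + `|x|) ^+ N. Proof. by rewrite exprn_gt0// onenorm_gt0. Qed.
Lemma onenormX_ge0 x N : 0 <= (1 + `|x|) ^+ N. Proof. exact/ltW/onenormX_gt0. Qed.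
Hint Resolve onenormX_gt0 onenormX_ge0 : core.

Lemma slow_nneg f : slow f -> exists N C, 0 <= C /\ forall x, `|f x| <= C * (1 + `|x|) ^+ N.
Proof.
move=> [N [C H]]; exists N, `|C|; split=> // x.
by apply: (le_trans (H x)); rewrite ler_wpM2r// ler_norm.
Qed.

Lemma slow_bounded f C : (forall x, `|f x| <= C) -> slow f.
Proof. by move=> H; exists 0%N, C => x; rewrite expr0 mulr1. Qed.

Lemma slowD f g : slow f -> slow g -> slow (fun x => f x + g x).
Proof.
move=> /slow_nneg[N [C [C0 H]]] /slow_nneg[M [D [D0 K]]].
exists (N + M)%N, (C + D) => x; rewrite mulrDl (le_trans (ler_normD _ _))// lerD//.
  by apply: (le_trans (H x)); rewrite ler_wpM2l// ler_weXn2l ?onenorm_ge1 ?leq_addr.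
by apply: (le_trans (K x)); rewrite ler_wpM2l// ler_weXn2l ?onenorm_ge1 ?leq_addl.
Qed.

Lemma slowM f g : slow f -> slow g -> slow (fun x => f x * g x).
Proof.
move=> /slow_nneg[N [C [C0 H]]] /slow_nneg[M [D [D0 K]]].
exists (N + M)%N, (C * D) => x; rewrite normrM exprD mulrACA.
exact: ler_pM.
Qed.

Lemma rapid_slow f : rapid f -> slow f.
Proof. by move=> /(_ 0%N)[C H]; apply: (@slow_bounded _ C) => x; have := H x; rewrite mul1r. Qed.

Lemma rapidD f g : rapid f -> rapid g -> rapid (fun x => f x + g x).
Proof.
move=> Hf Hg N; have [C H] := Hf N; have [D K] := Hg N.
exists (C + D) => x; apply: le_trans (lerD (H x) (K x)).
by rewrite -mulrDr ler_wpM2l// ler_normD.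
Qed.

Lemma rapidM f g : slow f -> rapid g -> rapid (fun x => f x * g x).
Proof.
move=> /slow_nneg[N [C [C0 H]]] Hg M; have [D K] := Hg (M + N)%N.
exists (C * D) => x; rewrite normrM.
apply: le_trans (ler_wpM2l C0 (K x)).
rewrite exprD [leRHS](_ : _ = (1 + `|x|) ^+ M * (C * (1 + `|x|) ^+ N * `|g x|)); last by ring.
by rewrite ler_wpM2l// ler_wpM2r.
Qed.

(** Smooth functions all of whose partial derivatives are of at most polynomial
    growth (SG), or rapidly decreasing (Sch). The constructors keep tactics from
    unfolding the quantifier over derivatives. *)
Variant SG f : Prop := SGI of (forall s, slow (pds s f) /\ pdable (pds s f)).
Variant Sch f : Prop := SchI of (forall s, rapid (pds s f) /\ pdable (pds s f)).

(** A growth condition on a class of functions that is stable under partial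
    derivatives holds for the derivatives of all orders. *)
Lemma SG_coind (P : (V -> R) -> Prop) :
  (forall f, P f -> slow f /\ forall i, (forall x, derivable f x (basis_vec R i)) /\ P (pd i f)) ->
  forall f, P f -> SG f.
Proof.
move=> H f Pf; split=> s; have {Pf} : P (pds s f) by elim: s => // i s /H[_ /(_ i)[]].
by move=> /H[? K]; split=> // i x; case: (K i).
Qed.

Lemma Sch_coind (P : (V -> R) -> Prop) :
  (forall f, P f -> rapid f /\ forall i, (forall x, derivable f x (basis_vec R i)) /\ P (pd i f)) ->
  forall f, P f -> Sch f.
Proof.
move=> H f Pf; split=> s; have {Pf} : P (pds s f) by elim: s => // i s /H[_ /(_ i)[]].
by move=> /H[? K]; split=> // i x; case: (K i).
Qed.

Lemma SG_pd f i : SG f -> SG (pd i f).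
Proof. by move=> [H]; split=> s; rewrite -pds_rcons; exact: H. Qed.
Lemma Sch_pd f i : Sch f -> Sch (pd i f).
Proof. by move=> [H]; split=> s; rewrite -pds_rcons; exact: H. Qed.
Lemma SG_pds f s : SG f -> SG (pds s f).
Proof. by move=> H; elim: s => [|i s]; [exact: H|exact: SG_pd]. Qed.
Lemma Sch_pds f s : Sch f -> Sch (pds s f).
Proof. by move=> H; elim: s => [|i s]; [exact: H|exact: Sch_pd]. Qed.
Lemma SG_slow f : SG f -> slow f. Proof. by move=> [/(_ [::])[]]. Qed.
Lemma Sch_rapid f : Sch f -> rapid f. Proof. by move=> [/(_ [::])[]]. Qed.
Lemma SG_pdable f : SG f -> pdable f. Proof. by move=> [/(_ [::])[]]. Qed.
Lemma Sch_pdable f : Sch f -> pdable f. Proof. by move=> [/(_ [::])[]]. Qed.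
Lemma Sch_SG f : Sch f -> SG f.
Proof. by move=> [H]; split=> s; case: (H s) => /rapid_slow. Qed.

Lemma pdD f g i : pdable f -> pdable g ->
  pd i (fun x => f x + g x) = (fun x => pd i f x + pd i g x).
Proof.
move=> df dg; apply/funext => x; apply: pd_val.
by apply: is_deriveD; exact: pdP.
Qed.

Lemma pdM f g i : pdable f -> pdable g ->
  pd i (fun x => f x * g x) = (fun x => f x * pd i g x + pd i f x * g x).
Proof.
move=> df dg; apply/funext => x; apply: pd_val.
have := is_deriveM (pdP i x df) (pdP i x dg).
by rewrite /GRing.scale /= [g x * _]mulrC.
Qed.

Lemma pdableD f g : pdable f -> pdable g -> pdable (fun x => f x + g x).
Proof. by move=> df dg i x; apply: derivableD. Qed.
Lemma pdableM f g : pdable f -> pdable g -> pdable (fun x => f x * g x).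
Proof. by move=> df dg i x; apply: derivableM. Qed.

(** By the Leibniz rule, sums of products form a class that is stable under
    partial derivatives. *)
Inductive SGclosure : (V -> R) -> Prop :=
| SGbase f of SG f : SGclosure f
| SGadd f g of SGclosure f & SGclosure g : SGclosure (fun x => f x + g x)
| SGmul f g of SGclosure f & SGclosure g : SGclosure (fun x => f x * g x).

Lemma SGclosure_SG f : SGclosure f -> SG f.
Proof.
apply: SG_coind => {}f.
have main h : SGclosure h -> [/\ slow h, pdable h & forall i, SGclosure (pd i h)].
  elim=> {h}.
  - move=> h sh; split; [exact: SG_slow|exact: SG_pdable|].
    by move=> i; apply: SGbase; exact: SG_pd.
  - move=> h k ch [s1 p1 d1] ck [s2 p2 d2]; split; [exact: slowD|exact: pdableD|].
    by move=> i; rewrite pdD//; exact: SGadd.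
  - move=> h k ch [s1 p1 d1] ck [s2 p2 d2]; split; [exact: slowM|exact: pdableM|].
    by move=> i; rewrite pdM//; apply: SGadd; exact: SGmul.
by move=> /main[s p c]; split=> // i; split.
Qed.

Lemma SGD f g : SG f -> SG g -> SG (fun x => f x + g x).
Proof. by move=> ? ?; apply/SGclosure_SG/SGadd; exact: SGbase. Qed.
Lemma SGM f g : SG f -> SG g -> SG (fun x => f x * g x).
Proof. by move=> ? ?; apply/SGclosure_SG/SGmul; exact: SGbase. Qed.

Inductive Schclosure : (V -> R) -> Prop :=
| Schadd f g of Schclosure f & Schclosure g : Schclosure (fun x => f x + g x)
| Schmul f g of SG f & Sch g : Schclosure (fun x => f x * g x).

Lemma Schclosure_Sch f : Schclosure f -> Sch f.
Proof.
apply: Sch_coind => {}f.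
have main h : Schclosure h -> [/\ rapid h, pdable h & forall i, Schclosure (pd i h)].
  elim=> {h}.
  - move=> h k ch [s1 p1 d1] ck [s2 p2 d2]; split; [exact: rapidD|exact: pdableD|].
    by move=> i; rewrite pdD//; exact: Schadd.
  - move=> h k sh sk; have p1 := SG_pdable sh; have p2 := Sch_pdable sk.
    split; [by apply: rapidM; [exact: SG_slow|exact: Sch_rapid]|exact: pdableM|].
    move=> i; rewrite pdM//; apply: Schadd; apply: Schmul.
    + exact: sh.
    + exact: Sch_pd.
    + exact: SG_pd.
    + exact: sk.
by move=> /main[s p c]; split=> // i; split.
Qed.

Lemma SG_cst (c : R) : SG (fun=> c).
Proof.
apply: (@SG_coind (fun f => exists c, f = fun=> c)); last by exists c.
move=> _ [b ->]; split; first exact: (@slow_bounded _ `|b|).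
move=> i; split; first by move=> x; exact: derivable_cst.
by exists 0; apply/funext => x; apply: pd_val; exact: is_derive_cst.
Qed.

Lemma SchM f g : SG f -> Sch g -> Sch (fun x => f x * g x).
Proof. by move=> ? ?; apply/Schclosure_Sch/Schmul. Qed.

Lemma SchD f g : Sch f -> Sch g -> Sch (fun x => f x + g x).
Proof.
move=> sf sg; rewrite (_ : (fun _ => _) = (fun x => (fun x => 1 * f x) x + (fun x => 1 * g x) x)).
  by apply/Schclosure_Sch/Schadd; (apply: Schmul; [exact: SG_cst|]).
by apply/funext => x; rewrite !mul1r.
Qed.

Lemma SchZ a f : Sch f -> Sch (fun x => a * f x).
Proof. by apply: SchM; exact: SG_cst. Qed.
Lemma SGZ a f : SG f -> SG (fun x => a * f x).
Proof. by apply: SGM; exact: SG_cst. Qed.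

Lemma pd_cst i (c : R) : pd i (fun=> c) = fun=> 0.
Proof. by apply/funext => x; apply: pd_val; exact: is_derive_cst. Qed.

Lemma pdZ f i a : pdable f -> pd i (fun x => a * f x) = (fun x => a * pd i f x).
Proof.
move=> df; rewrite pdM; [|by move=> j x; exact: derivable_cst|exact: df].
by rewrite pd_cst; apply/funext => x; rewrite mul0r addr0.
Qed.

Lemma pdsD f g s : SG f -> SG g ->
  pds s (fun x => f x + g x) = (fun x => pds s f x + pds s g x).
Proof.
move=> sf sg; elim: s => //= i s ->; rewrite pdD//; apply: SG_pdable; exact: SG_pds.
Qed.

Lemma pdsZ f s a : SG f -> pds s (fun x => a * f x) = (fun x => a * pds s f x).
Proof. move=> sf; elim: s => //= i s ->; rewrite pdZ//; apply: SG_pdable; exact: SG_pds. Qed.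

Lemma coordD x i j (h : R) : (x + h *: basis_vec R j) i 0 = x i 0 + h * (i == j)%:R.
Proof. by rewrite !mxE eqxx andbT. Qed.

Lemma coord_le x i : `|x i 0| <= `|x|.
Proof.
rewrite [leRHS]/Num.Def.normr/= mx_normrE; apply/bigmax_geP; right.
by exists (i, 0).
Qed.

Lemma normv_le x (c : R) : 0 <= c -> (forall i, `|x i 0| <= c) -> `|x| <= c.
Proof.
move=> c0 H; rewrite [leLHS]/Num.Def.normr/= mx_normrE; apply: bigmax_le => // -[i j] _ /=.
by rewrite ord1.
Qed.

Lemma SG_coord i : SG (fun x => x i 0).
Proof.
apply: (@SG_coind (fun f => f = (fun x => x i 0) \/ exists c, f = fun=> c)); last by left.
have D j x : is_derive x (basis_vec R j) (fun x : V => x i 0) (i == j)%:R.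
  apply: (@is_derive_quad _ _ _ _ _ _ 0) => h _.
  rewrite coordD mul0r (_ : _ - _ - _ = 0) ?normr0//; ring.
move=> _ [->|[b ->]]; split.
- exists 1%N, 1 => x; rewrite mul1r expr1 (le_trans (coord_le _ _))//.
  by rewrite lerDr.
- move=> j; split; first by move=> x; case: (D j x).
  by right; exists (i == j)%:R; apply/funext => x; apply: pd_val; exact: D.
- exact: (@slow_bounded _ `|b|).
- move=> j; split; first by move=> x; exact: derivable_cst.
  by right; exists 0; rewrite pd_cst.
Qed.

Lemma dotpD x y (z : V) : dotp (x + y) z = dotp x z + dotp y z.
Proof. by rewrite /dotp -big_split; apply: eq_bigr => i _; rewrite mxE mulrDl. Qed.

Lemma dotpZ (c : R) x y : dotp (c *: x) y = c * dotp x y.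
Proof. by rewrite /dotp mulr_sumr; apply: eq_bigr => i _; rewrite mxE mulrA. Qed.

Lemma dotpC x y : dotp x y = dotp y x.
Proof. by rewrite /dotp; apply: eq_bigr => i _; rewrite mulrC. Qed.

Lemma dotp_basis j y : dotp (basis_vec R j) y = y j 0.
Proof.
rewrite /dotp (bigD1 j)//= big1 => [|i /negPf ij]; rewrite mxE ?eqxx ?ij /= ?mul0r//.
by rewrite mul1r addr0.
Qed.

Lemma sincos_affine_derive (a c t : R) :
  is_derive t 1 (fun t => sin (c + t * a)) (a * cos (c + t * a)) /\
  is_derive t 1 (fun t => cos (c + t * a)) (a * - sin (c + t * a)).
Proof.
have D : is_derive t 1 (fun t : R => c + t * a) a.
  apply: (@is_derive_quad _ _ _ _ _ _ 0) => h _.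
  by rewrite scaler1 mul0r (_ : _ - h * a = 0) ?normr0//; ring.
split.
  have := @is_derive1_comp R sin (fun t => c + t * a) t _ _ (is_derive_sin _) D.
  by rewrite /GRing.scale/= [cos _ * _]mulrC.
have := @is_derive1_comp R cos (fun t => c + t * a) t _ _ (is_derive_cos _) D.
by rewrite /GRing.scale/= [- sin _ * _]mulrC.
Qed.

Lemma sincos_taylor (a c h : R) :
  `|sin (c + h * a) - sin c - h * (a * cos c)| <= a ^+ 2 * h ^+ 2 /\
  `|cos (c + h * a) - cos c - h * (a * - sin c)| <= a ^+ 2 * h ^+ 2.
Proof.
have D1 (t : R) := proj1 (sincos_affine_derive a c t).
have D2 (t : R) := proj2 (sincos_affine_derive a c t).
have D1' (t : R) : is_derive t 1 (fun t => a * cos (c + t * a)) (a * (a * - sin (c + t * a))).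
  exact: is_deriveZ.
have D2' (t : R) : is_derive t 1 (fun t => a * - sin (c + t * a)) (a * - (a * cos (c + t * a))).
  by apply: is_deriveZ; exact: is_deriveN.
split.
- have := @taylor2 _ _ _ _ 0 h (a ^+ 2) D1 D1'; rewrite !add0r !mul0r !addr0; apply.
  move=> b _; rewrite mulrA mulrN normrN normrM -expr2 (ger0_norm (sqr_ge0 _)).
  by rewrite ler_piMr ?sqr_ge0// ler_norml sin_geN1 sin_le1.
- have := @taylor2 _ _ _ _ 0 h (a ^+ 2) D2 D2'; rewrite !add0r !mul0r !addr0; apply.
  move=> b _; rewrite mulrN normrN mulrA normrM -expr2 (ger0_norm (sqr_ge0 _)).
  by rewrite ler_piMr ?sqr_ge0// ler_norml cos_geN1 cos_le1.
Qed.

Definition sind (a : V) (c : R) : V -> R := fun x => sin (dotp x a + c).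
Definition cosd (a : V) (c : R) : V -> R := fun x => cos (dotp x a + c).

Lemma sind_derive (a : V) c x j :
  is_derive x (basis_vec R j) (sind a c) (a j 0 * cosd a c x).
Proof.
apply: (@is_derive_quad _ _ _ _ _ _ (a j 0 ^+ 2)) => h _.
rewrite /sind dotpD dotpZ dotp_basis (addrAC (dotp x a)).
have := proj1 (sincos_taylor (a j 0) (dotp x a + c) h); apply.
Qed.

Lemma cosd_derive (a : V) c x j :
  is_derive x (basis_vec R j) (cosd a c) (- a j 0 * sind a c x).
Proof.
apply: (@is_derive_quad _ _ _ _ _ _ (a j 0 ^+ 2)) => h _.
rewrite /cosd dotpD dotpZ dotp_basis (addrAC (dotp x a)) mulNr -mulrN.
by have := proj2 (sincos_taylor (a j 0) (dotp x a + c) h).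
Qed.

Lemma pd_sind (a : V) c j : pd j (sind a c) = fun x => a j 0 * cosd a c x.
Proof. by apply/funext => x; apply: pd_val; exact: sind_derive. Qed.

Lemma pd_cosd (a : V) c j : pd j (cosd a c) = fun x => - a j 0 * sind a c x.
Proof. by apply/funext => x; apply: pd_val; exact: cosd_derive. Qed.

Lemma SG_sincosd (a : V) c : SG (sind a c) /\ SG (cosd a c).
Proof.
have H f : (exists k, f = (fun x => k * sind a c x) \/ f = (fun x => k * cosd a c x)) -> SG f.
  apply: (@SG_coind (fun f => exists k, f = (fun x => k * sind a c x) \/ f = (fun x => k * cosd a c x))).
  move=> {}f [k [->|->]]; split.
  - apply: (@slow_bounded _ `|k|) => x; rewrite normrM ler_piMr//.
    by rewrite ler_norml sin_geN1 sin_le1.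
  - have P : pdable (sind a c) by move=> i x; exact: (@ex_derive _ _ _ _ _ _ _ (sind_derive a c x i)).
    move=> i; split; first by move=> x; apply: derivableZ; exact: P.
    by exists (k * a i 0); right; rewrite pdZ// pd_sind; apply/funext => x; rewrite mulrA.
  - apply: (@slow_bounded _ `|k|) => x; rewrite normrM ler_piMr//.
    by rewrite ler_norml cos_geN1 cos_le1.
  - have P : pdable (cosd a c) by move=> i x; exact: (@ex_derive _ _ _ _ _ _ _ (cosd_derive a c x i)).
    move=> i; split; first by move=> x; apply: derivableZ; exact: P.
    by exists (k * - a i 0); left; rewrite pdZ// pd_cosd; apply/funext => x; rewrite mulrA.
by split; apply: H; exists 1; [left|right]; apply/funext => x; rewrite mul1r.
Qed.

(** Moving one coordinate at a time along the mean value theorem, locally bounded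
    partial derivatives force continuity. *)
Lemma pdable_continuous f : pdable f -> (forall i, slow (pd i f)) -> continuous f.
Proof.
move=> df sf x.
have {sf}[B B0 HB] : exists2 B, 0 <= B & forall i y, `|y - x| <= 1 -> `|pd i f y| <= B.
  have /choice[b Hb] : forall i : 'I_d, exists b, 0 <= b /\ forall y, `|y - x| <= 1 -> `|pd i f y| <= b.
    move=> i; have [N [C [C0 H]]] := slow_nneg (sf i).
    exists (C * (1 + (`|x| + 1)) ^+ N); split.
      by rewrite mulr_ge0// exprn_ge0// addr_ge0// addr_ge0.
    move=> y yx; apply: (le_trans (H y)); rewrite ler_wpM2l//.
    apply: lerXn2r; rewrite ?nnegrE ?addr_ge0// lerD2l.
    by rewrite -(subrK x y) (le_trans (ler_normD _ _))// addrC lerD2l.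
  exists (\sum_i b i); first by apply: sumr_ge0 => i _; case: (Hb i).
  move=> i y yx; case: (Hb i) => b0 /(_ y yx)/le_trans; apply.
  by rewrite (bigD1 i)//= lerDl sumr_ge0// => j _; case: (Hb j).
(* the path from x to y through the points agreeing with y on the first coordinates *)
pose z (y : V) (n : nat) : V := \col_i (if (i < n)%N then y i 0 else x i 0).
have step y n : `|y - x| <= 1 -> (n < d)%N -> `|f (z y n.+1) - f (z y n)| <= `|y - x| * B.
  move=> yx nd; pose i := Ordinal nd.
  have zE : z y n.+1 = z y n + (y i 0 - x i 0) *: basis_vec R i.
    apply/colP => j; rewrite coordD !mxE ltnS leq_eqVlt.
    have [/eqP ji|ji] := boolP (j == i).
      by rewrite ji /= eqxx ltnn mulr1 addrC subrK.
    by rewrite mulr0 addr0 (_ : (j == n :> nat) = false)//; apply/negbTE.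
  have D (t : R) : is_derive t 1 (fun s : R => f (z y n + s *: basis_vec R i)) (pd i f (z y n + t *: basis_vec R i)).
    exact: (proj1 (is_derive_line f (z y n) (basis_vec R i) t _) (pdP i _ df)).
  have [c /andP[c0 c1]] := mvt 0 (y i 0 - x i 0) D.
  rewrite add0r scale0r addr0 -zE => ->; rewrite add0r normrM.
  have yxi : `|y i 0 - x i 0| <= `|y - x|.
    by have := coord_le (y - x) i; rewrite !mxE.
  apply: ler_pM => //; apply: HB; apply: le_trans yx; apply: normv_le => // j.
  rewrite !mxE eqxx andbT; have [/eqP ji|ji] := boolP (j == i).
    rewrite ji /= ltnn mulr1 addrAC subrr add0r normrM ger0_norm//.
    by apply: le_trans yxi; rewrite ler_piMl.
  rewrite mulr0 addr0; case: ifP => _; last by rewrite subrr normr0.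
  by have := coord_le (y - x) j; rewrite !mxE.
have tele y n : `|y - x| <= 1 -> (n <= d)%N -> `|f (z y n) - f x| <= n%:R * (`|y - x| * B).
  move=> yx; elim: n => [_|n IH nd].
    rewrite (_ : z y 0 = x) ?subrr ?normr0 ?mul0r//.
    by apply/colP => i; rewrite mxE.
  rewrite -(subrK (f (z y n)) (f (z y n.+1))) -addrA (le_trans (ler_normD _ _))//.
  by rewrite -natr1 mulrDl mul1r [leRHS]addrC; apply: lerD; [exact: step|exact: IH (ltnW nd)].
have nearx (e : R) : 0 < e -> \forall y \near x, `|y - x| <= e.
  move=> e0; apply: filterS (nbhsx_ballx x e e0) => y.
  by rewrite -ball_normE /ball_ /= distrC; exact: ltW.
apply/(@cvgrPdist_le R R V (nbhs x) (nbhs_filter x)) => e e0; near=> y.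
have yx : `|y - x| <= 1 by near: y; exact: nearx.
have yx2 : `|y - x| <= e / (d%:R * B + 1).
  by near: y; apply: nearx; rewrite divr_gt0// ltr_wpDl// mulr_ge0.
rewrite distrC; have := tele y d yx (leqnn d).
rewrite (_ : z y d = y); last by apply/colP => i; rewrite mxE ltn_ord.
move=> /le_trans; apply; rewrite mulrCA.
apply: le_trans (ler_wpM2r _ yx2) _; first by rewrite mulr_ge0.
by rewrite mulrAC ler_pdivrMr ?ltr_wpDl ?mulr_ge0// ler_wpM2l ?(ltW e0)// lerDl.
Unshelve. all: by end_near. Qed.

Lemma SG_continuous f : SG f -> continuous f.
Proof.
by move=> sf; apply: pdable_continuous; [exact: SG_pdable|move=> i; apply/SG_slow/SG_pd].
Qed.

End SmoothClasses.
#[global] Hint Resolve onenormX_gt0 onenormX_ge0 : core.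

(** * Integration over R^d *)

Section Slices.
Variables (R : realType) (e : nat).
Implicit Types (f g : 'cV[R]_e.+1 -> R) (t : R) (y : 'cV[R]_e).

Definition consv t y : 'cV[R]_e.+1 := col_mx (t%:M : 'cV_1) y.
Definition slice f t : 'cV[R]_e -> R := fun y => f (consv t y).

Definition o0 : 'I_e.+1 := lshift e (ord0 : 'I_1).
Definition oS (i : 'I_e) : 'I_e.+1 := rshift 1 i.

Lemma ordS_split (i : 'I_e.+1) : i = o0 \/ exists k, i = oS k.
Proof.
case: (@split_ordP 1 e i) => k ->; [left|by right; exists k].
by rewrite /o0 ord1.
Qed.

Lemma consv0 t y : consv t y o0 0 = t.
Proof. by rewrite /consv /o0 (@col_mxEu R 1 e 1) mxE eqxx. Qed.

Lemma consvS t y i : consv t y (oS i) 0 = y i 0.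
Proof. by rewrite /consv /oS (@col_mxEd R 1 e 1). Qed.

Lemma colS_eqP (x z : 'cV[R]_e.+1) : x o0 0 = z o0 0 ->
  (forall i, x (oS i) 0 = z (oS i) 0) -> x = z.
Proof.
by move=> h0 hS; apply/colP => i; case: (ordS_split i) => [->|[k ->]].
Qed.

Lemma o0_neqS i : (o0 == oS i) = false.
Proof. by apply/negbTE/eqP => /(congr1 val). Qed.

Lemma oS_eq i j : (oS i == oS j) = (i == j).
Proof. by rewrite /oS; exact: (inj_eq (@rshift_inj 1 e)). Qed.

Lemma consv_basisS t y i (h : R) :
  consv t (y + h *: basis_vec R i) = consv t y + h *: basis_vec R (oS i).
Proof.
apply: colS_eqP => [|j]; rewrite coordD ?consv0 ?consvS ?coordD ?oS_eq//.
by rewrite o0_neqS mulr0 addr0.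
Qed.

Lemma consv_basis0 t y (h : R) : consv (t + h) y = consv t y + h *: basis_vec R o0.
Proof.
apply: colS_eqP => [|j]; rewrite coordD ?consv0 ?consvS ?eqxx ?mulr1//.
by rewrite eq_sym o0_neqS mulr0 addr0.
Qed.

Lemma consvK (x : 'cV[R]_e.+1) : consv (x o0 0) (\col_i x (oS i) 0) = x.
Proof. by apply: colS_eqP => [|i]; rewrite ?consv0 ?consvS ?mxE. Qed.

Lemma norm_consv_ge t y : `|y| <= `|consv t y|.
Proof. by apply: normv_le => // i; rewrite -(consvS t); exact: coord_le. Qed.

Lemma derive_slice f t y i l : is_derive (consv t y) (basis_vec R (oS i)) f l ->
  is_derive y (basis_vec R i) (slice f t) l.
Proof.
move=> D.
have := proj1 (is_derive_line f (consv t y) (basis_vec R (oS i)) 0 l).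
rewrite scale0r addr0 => /(_ D) {}D.
have := proj2 (is_derive_line (slice f t) y (basis_vec R i) 0 l).
rewrite scale0r addr0; apply.
rewrite (_ : (fun s => _) = fun s : R => f (consv t y + s *: basis_vec R (oS i))) //.
by apply/funext => s; rewrite /slice consv_basisS.
Qed.

Lemma derive_consv f t y : pdable f ->
  is_derive t 1 (fun s => f (consv s y)) (pd o0 f (consv t y)).
Proof.
move=> df.
have E (s : R) : consv s y = consv 0 y + s *: basis_vec R o0.
  by rewrite -consv_basis0 add0r.
rewrite (_ : (fun s => _) = fun s : R => f (consv 0 y + s *: basis_vec R o0)).
  apply: (proj1 (is_derive_line f (consv 0 y) (basis_vec R o0) t _)).
  by rewrite -E; exact: pdP.
by apply/funext => s; rewrite -E.
Qed.

Lemma pd_slice f t i : pdable f -> pd i (slice f t) = slice (pd (oS i) f) t.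
Proof.
by move=> df; apply/funext => y; apply: pd_val; apply: derive_slice; exact: pdP.
Qed.

Lemma pdable_slice f t : pdable f -> pdable (slice f t).
Proof.
by move=> df i y; apply: (@ex_derive _ _ _ _ _ _ _ (derive_slice (pdP (oS i) (consv t y) df))).
Qed.

Lemma Sch_slice f t : Sch f -> Sch (slice f t).
Proof.
move=> sf; apply: (@Sch_coind _ _ (fun h => exists2 g, Sch g & h = slice g t)); last by exists f.
move=> _ [g sg ->]; have dg := Sch_pdable sg; split.
  move=> N; have [C H] := Sch_rapid sg N; exists C => y; apply: le_trans (H (consv t y)).
  rewrite ler_wpM2r//; apply: lerXn2r; rewrite ?nnegrE ?addr_ge0//.
  by rewrite lerD2l norm_consv_ge.
move=> i; split; first exact: pdable_slice.
by exists (pd (oS i) g); [exact: Sch_pd|rewrite pd_slice].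
Qed.

End Slices.

Section Weight.
Variable R : realType.

(** Dominates the rapidly decreasing functions, while its integral and its sums
    over lattices factor along the coordinates. *)
Definition wt d (x : 'cV[R]_d) : R := \prod_i cauchyw (x i 0).

Lemma wt_gt0 d (x : 'cV[R]_d) : 0 < wt x.
Proof. by apply: prodr_gt0 => i _; exact: cauchyw_gt0. Qed.

Lemma wt_ge0 d (x : 'cV[R]_d) : 0 <= wt x. Proof. exact/ltW/wt_gt0. Qed.

Lemma wt_consv e t (y : 'cV[R]_e) : wt (consv t y) = cauchyw t * wt y.
Proof.
rewrite /wt (@big_split_ord _ _ _ 1 e) big_ord1 /=; congr (_ * _).
  by rewrite -/(o0 e) consv0.
by apply: eq_bigr => i _; rewrite -/(oS i) consvS.
Qed.

Lemma wt_consv_le e t (y : 'cV[R]_e) : wt (consv t y) <= wt y.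
Proof. by rewrite wt_consv ler_piMl ?wt_ge0 ?cauchyw_le1. Qed.

Lemma wt0 (x : 'cV[R]_0) : wt x = 1.
Proof. by rewrite /wt big_ord0. Qed.

Lemma rapid_wt d (f : 'cV[R]_d -> R) : rapid f ->
  exists2 C, 0 <= C & forall x, `|f x| <= C * wt x.
Proof.
move=> /(_ (2 * d)%N)[C H].
have C0 : 0 <= C by apply: le_trans (H 0); rewrite mulr_ge0.
exists C => // x; apply: le_trans (ler_wpM2r (wt_ge0 x) (H x)).
rewrite mulrAC -[leLHS]mul1r ler_wpM2r//.
rewrite /wt /cauchyw prodfV ler_pdivlMr; last first.
  by apply: prodr_gt0 => i _; rewrite ltr_pwDl// sqr_ge0.
rewrite mul1r exprM.
rewrite [leRHS](_ : _ = \prod_(i < d) (1 + `|x|) ^+ 2); last by rewrite prodr_const card_ord.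
apply: ler_prod => i _.
rewrite addr_ge0 ?sqr_ge0//= (_ : (1 + `|x|) ^+ 2 = 1 + 2 * `|x| + `|x| ^+ 2); last by ring.
have := coord_le x i; rewrite -(real_normK (num_real (x i 0))) => xi.
have : `|x i 0| ^+ 2 <= `|x| ^+ 2 by rewrite lerXn2r ?nnegrE.
have := normr_ge0 x; lra.
Qed.

End Weight.

Section IntegralOverRd.
Variable R : realType.
Notation kap := (2 * @atan_sup R).

Lemma kap_ge0 : 0 <= kap.
Proof. by have := atan_le_sup (0 : R); rewrite atan0 => h; rewrite mulr_ge0. Qed.

(** Linearity and the weighted bound in dimension d are both needed to see that
    the inner integral in dimension d + 1 is differentiable with Cauchy decay. *)
Definition int_spec d := forall f g : 'cV[R]_d -> R, Sch f -> Sch g ->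
  (forall a, int_Rd (fun x => a * f x + g x) = a * int_Rd f + int_Rd g) /\
  forall C, (forall x, `|f x| <= C * wt x) -> `|int_Rd f| <= C * kap ^+ d.

Section Step.
Variable e : nat.
Hypothesis IH : int_spec e.

(** Differentiation under the integral sign: the remainder estimate is integrated. *)
Lemma derive_int_step (V : normedModType R) (h : V -> 'cV[R]_e -> R)
    (h' : 'cV[R]_e -> R) (x v : V) C :
  (forall z, Sch (h z)) -> Sch h' ->
  (forall s y, `|s| <= 1 -> `|h (x + s *: v) y - h x y - s * h' y| <= C * s ^+ 2 * wt y) ->
  is_derive x v (fun z => int_Rd (h z)) (int_Rd h').
Proof.
move=> sh sh' H; apply: (@is_derive_quad _ _ _ _ _ _ (C * kap ^+ e)) => s s1.
pose k y := - s * h' y + ((-1) * h x y + h (x + s *: v) y).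
have s1' : Sch (fun y => (-1) * h x y + h (x + s *: v) y).
  by apply: SchD => //; exact: SchZ.
have sk : Sch k by apply: SchD => //; exact: SchZ.
have -> : int_Rd (h (x + s *: v)) - int_Rd (h x) - s * int_Rd h' = int_Rd k.
  rewrite (proj1 (IH sh' s1')) (proj1 (IH (sh x) (sh (x + s *: v)))); ring.
rewrite mulrAC; apply: (proj2 (IH sk sk)) => y.
apply: le_trans (H s y s1); rewrite le_eqVlt; apply/orP; left; apply/eqP.
congr `|_|; rewrite /k; ring.
Qed.

Definition partial_int (f : 'cV[R]_e.+1 -> R) : R -> R := fun t => int_Rd (slice f t).

Lemma partial_int_derive_step (f : 'cV[R]_e.+1 -> R) (t : R) : Sch f ->
  is_derive t 1 (partial_int f) (partial_int (pd (o0 e) f) t).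
Proof.
move=> sf; have s1 := Sch_pd (o0 e) sf; have s2 := Sch_pd (o0 e) s1.
have [C C0 HC] := rapid_wt (Sch_rapid s2).
apply: (@derive_int_step _ (slice f) _ _ _ C) => [z||s y _]; [exact: Sch_slice..|].
have D1 (z : R) := derive_consv z y (Sch_pdable sf).
have D2 (z : R) := derive_consv z y (Sch_pdable s1).
rewrite scaler1 mulrAC.
apply: (taylor2 D1 D2) => c _; apply: le_trans (HC _) _.
by rewrite ler_wpM2l// wt_consv_le.
Qed.

Lemma partial_int_bound_step f C t : Sch f -> (forall x, `|f x| <= C * wt x) ->
  `|partial_int f t| <= C * kap ^+ e * cauchyw t.
Proof.
move=> sf H; have sft := Sch_slice t sf; rewrite mulrAC.
by apply: (proj2 (IH sft sft)) => y; apply: le_trans (H _) _; rewrite wt_consv mulrA.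
Qed.

Lemma partial_int_lin_step f g a t : Sch f -> Sch g ->
  partial_int (fun x => a * f x + g x) t = a * partial_int f t + partial_int g t.
Proof. by move=> sf sg; apply: (proj1 (IH (Sch_slice t sf) (Sch_slice t sg))). Qed.

Lemma int_spec_step : int_spec e.+1.
Proof.
move=> f g sf sg.
have cf h : Sch h -> continuous (partial_int h).
  by move=> sh; apply: is_derive_continuous => t; exact: partial_int_derive_step.
split=> [a|C H].
  have [C C0 HC] := rapid_wt (Sch_rapid sf); have [D D0 HD] := rapid_wt (Sch_rapid sg).
  have HC' t := partial_int_bound_step t sf HC.
  have HD' t := partial_int_bound_step t sg HD.
  have kp : 0 <= kap ^+ e by rewrite exprn_ge0// kap_ge0.
  rewrite -[RHS](@Rintegral_linear _ _ _ ((C + D) * kap ^+ e)); [|exact: cf|exact: cf|..].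
  - apply: eq_Rintegral => t _; exact: partial_int_lin_step.
  - move=> t; apply: (le_trans (HC' t)); rewrite ler_wpM2r ?cauchyw_ge0//.
    by rewrite ler_wpM2r// lerDl.
  - move=> t; apply: (le_trans (HD' t)); rewrite ler_wpM2r ?cauchyw_ge0//.
    by rewrite ler_wpM2r// lerDr.
rewrite exprS mulrCA mulrC; apply: Rintegral_bound; first exact: cf.
by move=> t; exact: partial_int_bound_step.
Qed.

End Step.

Lemma int_specP d : int_spec d.
Proof.
elim: d => [|e IH]; last exact: int_spec_step.
move=> f g _ _; split=> // C /(_ 0); rewrite /= wt0.
by rewrite expr0.
Qed.

Lemma int_lin d (f g : 'cV[R]_d -> R) a : Sch f -> Sch g ->
  int_Rd (fun x => a * f x + g x) = a * int_Rd f + int_Rd g.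
Proof. by move=> sf sg; apply: (proj1 (int_specP sf sg)). Qed.

Lemma int_bound d (f : 'cV[R]_d -> R) C : Sch f -> (forall x, `|f x| <= C * wt x) ->
  `|int_Rd f| <= C * kap ^+ d.
Proof. by move=> sf; apply: (proj2 (int_specP sf sf)). Qed.

Lemma Sch0 d : Sch ((fun=> 0) : 'cV[R]_d -> R).
Proof.
apply: (@Sch_coind _ _ (fun f => f = fun=> 0)) => // _ ->; split.
  by move=> N; exists 0 => x; rewrite normr0 mulr0.
by move=> i; split; [move=> x; exact: derivable_cst|exact: pd_cst].
Qed.

Lemma int0 d : int_Rd ((fun=> 0) : 'cV[R]_d -> R) = 0.
Proof.
apply/eqP; rewrite -normr_le0 -[leRHS](mul0r (kap ^+ d)).
by apply: int_bound; [exact: Sch0|move=> x; rewrite normr0 mul0r].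
Qed.

Lemma intD d (f g : 'cV[R]_d -> R) : Sch f -> Sch g ->
  int_Rd (fun x => f x + g x) = int_Rd f + int_Rd g.
Proof.
move=> sf sg; rewrite -[in RHS](mul1r (int_Rd f)) -int_lin//.
by congr int_Rd; apply/funext => x; rewrite mul1r.
Qed.

Lemma intZ d (f : 'cV[R]_d -> R) a : Sch f -> int_Rd (fun x => a * f x) = a * int_Rd f.
Proof.
move=> sf; have := int_lin a sf (@Sch0 d); rewrite int0 addr0 => <-.
by congr int_Rd; apply/funext => x; rewrite addr0.
Qed.

Lemma derive_int d (V : normedModType R) (h : V -> 'cV[R]_d -> R)
    (h' : 'cV[R]_d -> R) (x v : V) C :
  (forall z, Sch (h z)) -> Sch h' ->
  (forall s y, `|s| <= 1 -> `|h (x + s *: v) y - h x y - s * h' y| <= C * s ^+ 2 * wt y) ->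
  is_derive x v (fun z => int_Rd (h z)) (int_Rd h').
Proof. exact: (derive_int_step (@int_specP d)). Qed.

Lemma partial_int_derive e (f : 'cV[R]_e.+1 -> R) (t : R) : Sch f ->
  is_derive t 1 (partial_int f) (partial_int (pd (o0 e) f) t).
Proof. exact: (partial_int_derive_step (@int_specP e)). Qed.

Lemma partial_int_bound e (f : 'cV[R]_e.+1 -> R) C t : Sch f ->
  (forall x, `|f x| <= C * wt x) -> `|partial_int f t| <= C * kap ^+ e * cauchyw t.
Proof. exact: (partial_int_bound_step (@int_specP e)). Qed.

Lemma partial_int_continuous e (f : 'cV[R]_e.+1 -> R) : Sch f -> continuous (partial_int f).
Proof. by move=> sf; apply: is_derive_continuous => t; exact: partial_int_derive. Qed.

Lemma cauchyw_small (eps C : R) : 0 < eps -> exists T : R, forall t, T <= `|t| -> C * cauchyw t <= eps.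
Proof.
move=> e0; exists (`|C| / eps + 1) => t Tt.
apply: (@le_trans _ _ (`|C| * cauchyw t)).
  by rewrite ler_wpM2r ?cauchyw_ge0// ler_norm.
rewrite /cauchyw ler_pdivrMr; last by rewrite ltr_pwDl// sqr_ge0.
rewrite -ler_pdivrMl// mulrC -(real_normK (num_real t)).
have C0 : 0 <= `|C| / eps by rewrite divr_ge0// ltW.
have t1 : 1 <= `|t| by apply: le_trans Tt; rewrite lerDr.
have : `|t| <= `|t| ^+ 2 by rewrite expr2 ler_peMl.
lra.
Qed.

Lemma Rintegral_derive0 (u u' : R -> R) (C : R) : (forall t : R, is_derive t 1 u (u' t)) ->
  continuous u' -> (forall t, `|u t| <= C * cauchyw t) ->
  (forall t, `|u' t| <= C * cauchyw t) -> Rintegral (@lebesgue_measure R) setT u' = 0.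
Proof.
move=> du cu Hu Hu'; apply/eqP; rewrite -normr_le0; apply/ler_addgt0Pl => eps e0.
have e3 : 0 < eps / 3 by rewrite divr_gt0.
have [T1 H1] := primitive_cvg cu Hu' du e3.
have [T2 H2] := cauchyw_small C e3.
pose T := Num.max 0 (Num.max T1 T2).
have [T0 TT1 TT2] : [/\ 0 <= T, T1 <= T & T2 <= T].
  by rewrite /T !le_max !lexx !orbT.
have {}H1 := H1 (- T) T; rewrite lerN2 in H1.
have {}H1 := H1 TT1 TT1.
have h1 := Hu T; have h2 := Hu (- T).
have := H2 T; have := H2 (- T); rewrite normrN ger0_norm// => /(_ TT2) h3 /(_ TT2) h4.
set I := Rintegral _ _ _ in H1 *.
rewrite addr0; have -> : I = u T - u (- T) - (u T - u (- T) - I) by ring.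
apply: le_trans (ler_normB _ _) _; have := ler_normB (u T) (u (- T)); lra.
Qed.

(** Integration by parts: the first coordinate is the one-dimensional
    statement for the partial integral, the other ones are integrated inside. *)
Lemma int_pd0 d (f : 'cV[R]_d -> R) i : Sch f -> int_Rd (pd i f) = 0.
Proof.
elim: d f i => [f []//|e IH f i sf].
case: (ordS_split i) => [->|[k ->]] /=.
  have s1 := Sch_pd (o0 e) sf.
  have [C C0 HC] := rapid_wt (Sch_rapid sf); have [D D0 HD] := rapid_wt (Sch_rapid s1).
  have kp : 0 <= kap ^+ e by rewrite exprn_ge0// kap_ge0.
  apply: (@Rintegral_derive0 (partial_int f) (partial_int (pd (o0 e) f)) ((C + D) * kap ^+ e)).
  - by move=> t; exact: partial_int_derive.
  - exact: partial_int_continuous.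
  - move=> t; apply: (le_trans (partial_int_bound t sf HC)).
    by rewrite ler_wpM2r ?cauchyw_ge0// ler_wpM2r// lerDl.
  - move=> t; apply: (le_trans (partial_int_bound t s1 HD)).
    by rewrite ler_wpM2r ?cauchyw_ge0// ler_wpM2r// lerDr.
rewrite (_ : (fun t => _) = fun=> 0); first by rewrite Rintegral_cst// mul0r.
apply/funext => t; rewrite -(IH (slice f t) k (Sch_slice t sf)).
by rewrite pd_slice//; exact: Sch_pdable.
Qed.

End IntegralOverRd.

(** * The Fourier transform of Schwartz functions *)

Section RealFourier.
Variables (R : realType) (d : nat).
Local Notation V := 'cV[R]_d.
Implicit Types (w : V -> R) (x y : V) (i : 'I_d).

(** The cosine and sine transforms carry the real and imaginary parts of the
    Fourier transform. *)
Definition Fc w x : R := int_Rd (fun y => w y * cosd x 0 y).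
Definition Fs w x : R := int_Rd (fun y => w y * sind x 0 y).

Lemma Sch_cosd w x c : Sch w -> Sch (fun y => w y * cosd x c y).
Proof.
move=> sw; rewrite (_ : (fun _ => _) = fun y => cosd x c y * w y).
  by apply: SchM => //; exact: (proj2 (SG_sincosd _ _)).
by apply/funext => y; rewrite mulrC.
Qed.

Lemma Sch_sind w x c : Sch w -> Sch (fun y => w y * sind x c y).
Proof.
move=> sw; rewrite (_ : (fun _ => _) = fun y => sind x c y * w y).
  by apply: SchM => //; exact: (proj1 (SG_sincosd _ _)).
by apply/funext => y; rewrite mulrC.
Qed.

Lemma Sch_coordM w i : Sch w -> Sch (fun y => y i 0 * w y).
Proof. by apply: SchM; exact: SG_coord. Qed.

Lemma Fc_lin w1 w2 a x : Sch w1 -> Sch w2 ->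
  Fc (fun y => a * w1 y + w2 y) x = a * Fc w1 x + Fc w2 x.
Proof.
move=> s1 s2; rewrite /Fc -int_lin; [|exact: Sch_cosd..].
by congr int_Rd; apply/funext => y; rewrite mulrDl mulrA.
Qed.

Lemma Fs_lin w1 w2 a x : Sch w1 -> Sch w2 ->
  Fs (fun y => a * w1 y + w2 y) x = a * Fs w1 x + Fs w2 x.
Proof.
move=> s1 s2; rewrite /Fs -int_lin; [|exact: Sch_sind..].
by congr int_Rd; apply/funext => y; rewrite mulrDl mulrA.
Qed.

Lemma FcN w x : Sch w -> Fc (fun y => - w y) x = - Fc w x.
Proof.
move=> sw; rewrite -mulN1r /Fc -intZ; last exact: Sch_cosd.
by congr int_Rd; apply/funext => y; rewrite mulrA mulN1r.
Qed.

Lemma FsN w x : Sch w -> Fs (fun y => - w y) x = - Fs w x.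
Proof.
move=> sw; rewrite -mulN1r /Fs -intZ; last exact: Sch_sind.
by congr int_Rd; apply/funext => y; rewrite mulrA mulN1r.
Qed.

Lemma dotpDr x y (z : V) : dotp z (x + y) = dotp z x + dotp z y.
Proof. by rewrite ![dotp z _]dotpC dotpD. Qed.
Lemma dotpZr (c : R) x y : dotp x (c *: y) = c * dotp x y.
Proof. by rewrite ![dotp x _]dotpC dotpZ. Qed.

(** Differentiation under the integral sign turns into multiplication by a
    coordinate. *)
Lemma derive_Fc w x i : Sch w ->
  is_derive x (basis_vec R i) (Fc w) (- Fs (fun y => y i 0 * w y) x).
Proof.
move=> sw; have s1 := Sch_coordM i sw; have s2 := Sch_coordM i s1.
have [C C0 HC] := rapid_wt (Sch_rapid s2).
rewrite -FsN//; apply: (@derive_int _ _ _ (fun z y => w y * cosd z 0 y) _ _ _ C).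
- by move=> z; exact: Sch_cosd.
- rewrite (_ : (fun _ => _) = fun y => -1 * (y i 0 * w y * sind x 0 y)).
    by apply: SchZ; exact: Sch_sind.
  by apply/funext => y; rewrite mulN1r mulNr.
- move=> s y _; rewrite /cosd /sind dotpDr dotpZr [dotp y (basis_vec _ _)]dotpC dotp_basis !addr0.
  have /(ler_wpM2l (normr_ge0 (w y))) := proj2 (sincos_taylor (y i 0) (dotp y x) s).
  rewrite -normrM => H.
  have -> : w y * cos (dotp y x + s * y i 0) - w y * cos (dotp y x) -
     s * (- (y i 0 * w y) * sin (dotp y x)) =
     w y * (cos (dotp y x + s * y i 0) - cos (dotp y x) - s * (y i 0 * - sin (dotp y x))) by ring.
  apply: (le_trans H); rewrite [leLHS](_ : _ = `|y i 0 * (y i 0 * w y)| * s ^+ 2).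
    by rewrite mulrAC ler_wpM2r ?sqr_ge0.
  by rewrite !normrM mulrA -expr2 real_normK ?num_real//; ring.
Qed.

Lemma derive_Fs w x i : Sch w ->
  is_derive x (basis_vec R i) (Fs w) (Fc (fun y => y i 0 * w y) x).
Proof.
move=> sw; have s1 := Sch_coordM i sw; have s2 := Sch_coordM i s1.
have [C C0 HC] := rapid_wt (Sch_rapid s2).
apply: (@derive_int _ _ _ (fun z y => w y * sind z 0 y) _ _ _ C).
- by move=> z; exact: Sch_sind.
- exact: Sch_cosd.
- move=> s y _; rewrite /cosd /sind dotpDr dotpZr [dotp y (basis_vec _ _)]dotpC dotp_basis !addr0.
  have /(ler_wpM2l (normr_ge0 (w y))) := proj1 (sincos_taylor (y i 0) (dotp y x) s).
  rewrite -normrM => H.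
  have -> : w y * sin (dotp y x + s * y i 0) - w y * sin (dotp y x) -
     s * ((y i 0 * w y) * cos (dotp y x)) =
     w y * (sin (dotp y x + s * y i 0) - sin (dotp y x) - s * (y i 0 * cos (dotp y x))) by ring.
  apply: (le_trans H); rewrite [leLHS](_ : _ = `|y i 0 * (y i 0 * w y)| * s ^+ 2).
    by rewrite mulrAC ler_wpM2r ?sqr_ge0.
  by rewrite !normrM mulrA -expr2 real_normK ?num_real//; ring.
Qed.

(** Integration by parts against the kernel. *)
Lemma coord_Fc w x i : Sch w -> x i 0 * Fc w x = - Fs (pd i w) x.
Proof.
move=> sw; apply/eqP; rewrite -addr_eq0; apply/eqP.
have sG := proj1 (SG_sincosd x 0).
rewrite -[RHS](int_pd0 i (Sch_sind x 0 sw)) pdM; [|exact: Sch_pdable|exact: SG_pdable].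
rewrite /Fc /Fs pd_sind -int_lin; [|exact: Sch_cosd|by apply: Sch_sind; exact: Sch_pd].
by congr int_Rd; apply/funext => y; rewrite mulrCA.
Qed.

Lemma coord_Fs w x i : Sch w -> x i 0 * Fs w x = Fc (pd i w) x.
Proof.
move=> sw; apply/eqP; rewrite -subr_eq0 -oppr_eq0 opprB addrC -mulNr; apply/eqP.
have sG := proj2 (SG_sincosd x 0).
rewrite -[RHS](int_pd0 i (Sch_cosd x 0 sw)) pdM; [|exact: Sch_pdable|exact: SG_pdable].
rewrite /Fc /Fs pd_cosd -int_lin; [|exact: Sch_sind|by apply: Sch_cosd; exact: Sch_pd].
by congr int_Rd; apply/funext => y; rewrite mulrCA.
Qed.

(** The real parts of Fourier transforms. This class is stable under
    multiplication by coordinates and under partial derivatives, which is why it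
    consists of rapidly decreasing functions. *)
Definition fourier_part (h : V -> R) := exists w1 w2, [/\ Sch w1, Sch w2 & h = fun x => Fc w1 x + Fs w2 x].

Lemma fourier_part_coord h i : fourier_part h -> fourier_part (fun x => x i 0 * h x).
Proof.
move=> [w1 [w2 [s1 s2 ->]]]; exists (pd i w2), (fun y => - pd i w1 y).
have p1 := Sch_pd i s1; have p2 := Sch_pd i s2; split => //.
  rewrite (_ : (fun _ => _) = fun y => -1 * pd i w1 y); first exact: SchZ.
  by apply/funext => y; rewrite mulN1r.
by apply/funext => x; rewrite mulrDr coord_Fc// coord_Fs// FsN// addrC.
Qed.

(** The members of the class are bounded, and so are their products with all
    monomials. *)
Lemma fourier_part_rapid h : fourier_part h -> rapid h.
Proof.
move=> + N; elim: N h => [|N IH] h Hh.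
  have [w1 [w2 [s1 s2 ->]]] := Hh.
  have [C1 C10 H1] := rapid_wt (Sch_rapid s1); have [C2 C20 H2] := rapid_wt (Sch_rapid s2).
  exists (C1 * (2 * atan_sup R) ^+ d + C2 * (2 * atan_sup R) ^+ d) => x.
  rewrite expr0 mul1r (le_trans (ler_normD _ _))// lerD//.
    apply: int_bound; first exact: Sch_cosd.
    move=> y; apply: le_trans (H1 y); rewrite normrM ler_piMr//.
    by rewrite ler_norml cos_geN1 cos_le1.
  apply: int_bound; first exact: Sch_sind.
  move=> y; apply: le_trans (H2 y); rewrite normrM ler_piMr//.
  by rewrite ler_norml sin_geN1 sin_le1.
have [C HC] := IH h Hh.
have /choice[D HD] : forall i, exists D, forall x, (1 + `|x|) ^+ N * `|x i 0 * h x| <= D.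
  by move=> i; apply: IH; exact: fourier_part_coord.
exists (C + \sum_i D i) => x.
apply: (@le_trans _ _ ((1 + `|x|) ^+ N * `|h x| + \sum_i (1 + `|x|) ^+ N * `|x i 0 * h x|)).
  rewrite exprSr -mulrA mulrDl mul1r mulrDr lerD2l -mulr_sumr ler_wpM2l//.
  under eq_bigr do rewrite normrM.
  rewrite -mulr_suml ler_wpM2r//; apply: normv_le; first exact: sumr_ge0.
  by move=> i; rewrite (bigD1 i)//= lerDl sumr_ge0.
by rewrite lerD// ler_sum.
Qed.

Lemma fourier_part_Sch h : fourier_part h -> Sch h.
Proof.
apply: Sch_coind => {}h Hh; split; first exact: fourier_part_rapid.
have [w1 [w2 [s1 s2 ->]]] := Hh => i.
have D x : is_derive x (basis_vec R i) (fun x => Fc w1 x + Fs w2 x)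
    (- Fs (fun y => y i 0 * w1 y) x + Fc (fun y => y i 0 * w2 y) x).
  by apply: is_deriveD; [exact: derive_Fc|exact: derive_Fs].
split; first by move=> x; exact: (@ex_derive _ _ _ _ _ _ _ (D x)).
have t1 := Sch_coordM i s1; have t2 := Sch_coordM i s2.
exists (fun y => y i 0 * w2 y), (fun y => - (y i 0 * w1 y)); split => //.
  rewrite (_ : (fun _ => _) = fun y => -1 * (y i 0 * w1 y)); first exact: SchZ.
  by apply/funext => y; rewrite mulN1r.
by apply/funext => x; rewrite (pd_val (D x)) FsN// addrC.
Qed.

End RealFourier.

Section ComplexSchwartz.
Variables (R : realType) (d : nat).
Local Notation V := 'cV[R]_d.
Local Open Scope complex_scope.
Implicit Types (f g : V -> R[i]) (x y : V) (i : 'I_d) (s : seq 'I_d).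

Lemma c_eq (a b : R[i]) : complex.Re a = complex.Re b -> complex.Im a = complex.Im b -> a = b.
Proof. by case: a => ? ?; case: b => ? ? /= -> ->. Qed.

Lemma Re_le_normc (a : R[i]) : `|complex.Re a| <= Normc.normc a.
Proof.
case: a => a b /=; rewrite -sqrtr_sqr ler_sqrt ?addr_ge0 ?sqr_ge0//.
by rewrite lerDl sqr_ge0.
Qed.

Lemma Im_le_normc (a : R[i]) : `|complex.Im a| <= Normc.normc a.
Proof.
case: a => a b /=; rewrite -sqrtr_sqr ler_sqrt ?addr_ge0 ?sqr_ge0//.
by rewrite lerDr sqr_ge0.
Qed.

Lemma normc_le_ReIm (a : R[i]) : Normc.normc a <= `|complex.Re a| + `|complex.Im a|.
Proof.
case: a => a b /=; rewrite -[leRHS]ger0_norm ?addr_ge0// -sqrtr_sqr ler_sqrt ?sqr_ge0//.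
rewrite sqrrD !real_normK ?num_real//.
by have : 0 <= `|a| * `|b| by [rewrite mulr_ge0]; lra.
Qed.

Definition CSch f := Sch (re f) /\ Sch (im f).
Definition CSG f := SG (re f) /\ SG (im f).

Lemma re_pderivs s f : re (pderivs s f) = pds s (re f).
Proof. by elim: s => //= i s IH; rewrite -IH pdE. Qed.

Lemma im_pderivs s f : im (pderivs s f) = pds s (im f).
Proof. by elim: s => //= i s IH; rewrite -IH pdE. Qed.

Lemma pderivs_eq s f x : pderivs s f x = pds s (re f) x +i* pds s (im f) x.
Proof. by rewrite -re_pderivs -im_pderivs /re /im; case: (pderivs s f x). Qed.

Lemma schwartz_CSch f : schwartz f <-> CSch f.
Proof.
split=> [[sm H]|[s1 s2]].
  split; split=> s; (split; [move=> N|move=> i x]).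
  - have [C HC] := H N s; exists C => x; apply: le_trans (HC x).
    by rewrite ler_wpM2l// -re_pderivs; exact: Re_le_normc.
  - by have [_ _ /(_ i x)[]] := sm s; rewrite re_pderivs.
  - have [C HC] := H N s; exists C => x; apply: le_trans (HC x).
    by rewrite ler_wpM2l// -im_pderivs; exact: Im_le_normc.
  - by have [_ _ /(_ i x)[]] := sm s; rewrite im_pderivs.
split.
  move=> s /=; rewrite re_pderivs im_pderivs.
  have t1 := Sch_pds s s1; have t2 := Sch_pds s s2.
  split; [exact/SG_continuous/Sch_SG|exact/SG_continuous/Sch_SG|].
  by move=> i x; split; exact: Sch_pdable.
move=> N s.
have [C HC] := Sch_rapid (Sch_pds s s1) N; have [D HD] := Sch_rapid (Sch_pds s s2) N.
exists (C + D) => x; apply: le_trans (lerD (HC x) (HD x)).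
rewrite -mulrDr ler_wpM2l// (le_trans (normc_le_ReIm _))//.
by rewrite pderivs_eq.
Qed.

Lemma CSG_smooth f : CSG f -> smooth f.
Proof.
move=> [s1 s2] s /=; rewrite re_pderivs im_pderivs.
have t1 := SG_pds s s1; have t2 := SG_pds s s2.
split; [exact/SG_continuous|exact/SG_continuous|].
by move=> i x; split; exact: SG_pdable.
Qed.

Lemma reM f g : re (fun x => f x * g x) = fun x => re f x * re g x + (-1) * (im f x * im g x).
Proof. by apply/funext => x; rewrite /re /im; case: (f x) => a b; case: (g x) => a' b' /=; rewrite mulN1r. Qed.
Lemma imM f g : im (fun x => f x * g x) = fun x => re f x * im g x + im f x * re g x.
Proof. by apply/funext => x; rewrite /re /im; case: (f x) => a b; case: (g x) => a' b' /=. Qed.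
Lemma reD f g : re (fun x => f x + g x) = fun x => re f x + re g x.
Proof. by apply/funext => x; rewrite /re /im; case: (f x) => a b; case: (g x) => a' b'. Qed.
Lemma imD f g : im (fun x => f x + g x) = fun x => im f x + im g x.
Proof. by apply/funext => x; rewrite /re /im; case: (f x) => a b; case: (g x) => a' b'. Qed.

Lemma CSchM f g : CSG f -> CSch g -> CSch (fun x => f x * g x).
Proof.
move=> [a b] [a' b']; split; rewrite ?reM ?imM; apply: SchD; do ?apply: SchZ; exact: SchM.
Qed.

Lemma CSGM f g : CSG f -> CSG g -> CSG (fun x => f x * g x).
Proof.
move=> [a b] [a' b']; split; rewrite ?reM ?imM; apply: SGD; do ?apply: SGZ; exact: SGM.
Qed.

Lemma CSchD f g : CSch f -> CSch g -> CSch (fun x => f x + g x).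
Proof. by move=> [a b] [a' b']; split; rewrite ?reD ?imD; exact: SchD. Qed.

Lemma CSG_cst c : CSG (fun=> c).
Proof. by split; rewrite /re /im; exact: SG_cst. Qed.

Lemma CSchZ c f : CSch f -> CSch (fun x => c * f x).
Proof. by apply: CSchM; exact: CSG_cst. Qed.

Lemma CSch_CSG f : CSch f -> CSG f.
Proof. by move=> [a b]; split; exact: Sch_SG. Qed.

Lemma CSG_coord i : CSG (fun x => (x i 0)%:C).
Proof. by split; [exact: SG_coord|exact: SG_cst]. Qed.

Lemma CSG_expi (a : V) c : CSG (fun x => expi (dotp x a + c)).
Proof. by split; [exact: (proj2 (SG_sincosd a c))|exact: (proj1 (SG_sincosd a c))]. Qed.

Lemma CSch_pderivs s f : CSch f -> CSch (pderivs s f).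
Proof. by move=> [a b]; split; rewrite ?re_pderivs ?im_pderivs; exact: Sch_pds. Qed.

Lemma cintD f g : CSch f -> CSch g -> cint (fun x => f x + g x) = cint f + cint g.
Proof.
by move=> [a b] [a' b']; apply: c_eq; rewrite /cint ?reD ?imD /= intD.
Qed.

Lemma cintZ c f : CSch f -> cint (fun x => c * f x) = c * cint f.
Proof.
move=> [a b]; case: c => c c'; apply: c_eq; rewrite /cint ?reM ?imM /=.
  rewrite /re /im /=; rewrite intD; [|exact: SchZ|by apply: SchZ; exact: SchZ].
  by rewrite intZ// intZ; [rewrite intZ// mulN1r|exact: SchZ].
by rewrite /re /im /=; rewrite intD; [rewrite !intZ|exact: SchZ..].
Qed.

Lemma expiD (s t : R) : expi (s + t) = expi s * expi t.
Proof. by rewrite /expi sinD cosD; apply: c_eq => //=; rewrite addrC mulrC [sin t * _]mulrC. Qed.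

Lemma expi0 : expi (0 : R) = 1.
Proof. by rewrite /expi sin0 cos0. Qed.

Lemma fourierE f x : CSch f ->
  fourier f x = (Fc (re f) x + Fs (im f) x) +i* (Fc (im f) x - Fs (re f) x).
Proof.
move=> [a b]; rewrite /fourier /cint; apply: c_eq => /=.
  rewrite reM -intD; [|exact: Sch_cosd|exact: Sch_sind].
  congr int_Rd; apply/funext => y; rewrite /re /im /= cosN sinN /cosd /sind !addr0 [dotp x y]dotpC; ring.
rewrite imM -FsN// -intD; [|exact: Sch_cosd|].
  by congr int_Rd; apply/funext => y; rewrite /re /im /= cosN sinN /cosd /sind !addr0 [dotp x y]dotpC; ring.
rewrite (_ : (fun _ => _) = fun y => -1 * (re f y * sind x 0 y)).
  by apply: SchZ; exact: Sch_sind.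
by apply/funext => y; rewrite mulN1r mulNr.
Qed.

Lemma SchN (w : V -> R) : Sch w -> Sch (fun x => - w x).
Proof.
move=> sw; rewrite (_ : (fun _ => _) = fun y => -1 * w y); first exact: SchZ.
by apply/funext => y; rewrite mulN1r.
Qed.

Lemma CSch_fourier f : CSch f -> CSch (fourier f).
Proof.
move=> Hf; have [a b] := Hf; split.
  by apply: fourier_part_Sch; exists (re f), (im f); split=> //; apply/funext => x; rewrite /re fourierE.
apply: fourier_part_Sch; exists (im f), (fun x => - re f x); split=> //; first exact: SchN.
by apply/funext => x; rewrite {1}/im fourierE//= FsN.
Qed.

Definition minus_i : R[i] := 0 -i* 1.

Lemma coord_fourier f x i : CSch f ->
  (x i 0)%:C * fourier f x = fourier (fun y => minus_i * pderiv i f y) x.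
Proof.
move=> Hf; have [a b] := Hf; have [a' b'] := CSch_pderivs [:: i] Hf.
have E1 : re (fun y => minus_i * pderiv i f y) = pd i (im f).
  by rewrite reM /re /im /=; apply/funext => y; rewrite /= pdE /im; ring.
have E2 : im (fun y => minus_i * pderiv i f y) = fun y => - pd i (re f) y.
  by rewrite imM /re /im /=; apply/funext => y; rewrite /= pdE /re; ring.
rewrite !fourierE//; last by apply: CSchZ; exact: (CSch_pderivs [:: i]).
have p1 := Sch_pd i a; have p2 := Sch_pd i b.
rewrite E1 E2 FsN// FcN//.
have e1 := coord_Fc x i a; have e2 := coord_Fc x i b.
have e3 := coord_Fs x i a; have e4 := coord_Fs x i b.
apply: c_eq => /=; rewrite mul0r ?subr0 ?addr0 ?mulrDr.
  by rewrite e1 e4 addrC.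
by rewrite mulrN e2 e3 addrC.
Qed.

Lemma pderivsZ c s f : CSG f -> pderivs s (fun y => c * f y) = fun y => c * pderivs s f y.
Proof.
move=> [a b]; apply/funext => y; rewrite !pderivs_eq reM imM; case: c => c c'.
rewrite pdsD; [|exact: SGZ|by apply: SGZ; exact: SGZ].
rewrite pdsZ// pdsZ; last exact: SGZ.
rewrite pdsZ// pdsD; [|exact: SGZ..].
by rewrite !pdsZ//; apply: c_eq => //=; rewrite mulN1r.
Qed.

Definition xmon s x : R[i] := \prod_(i <- s) (x i 0)%:C.

Lemma CSG_xmon s : CSG (xmon s).
Proof.
elim: s => [|i s IH].
  rewrite (_ : xmon [::] = fun=> 1); first exact: CSG_cst.
  by apply/funext => x; rewrite /xmon big_nil.
rewrite (_ : xmon (i :: s) = fun x => (x i 0)%:C * xmon s x).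
  by apply: CSGM => //; exact: CSG_coord.
by apply/funext => x; rewrite /xmon big_cons.
Qed.

Lemma xmon_fourier s f x : CSch f ->
  xmon s x * fourier f x = fourier (fun y => minus_i ^+ size s * pderivs s f y) x.
Proof.
elim/last_ind: s f => [|s i IH] f Hf.
  rewrite /xmon big_nil mul1r expr0 /=; congr (fourier _ x).
  by apply/funext => y; rewrite mul1r.
rewrite /xmon -cats1 big_cat big_seq1 -mulrA coord_fourier// -/(xmon s x).
have Hi := CSch_pderivs [:: i] Hf; have HZ := CSchZ minus_i Hi.
rewrite IH//; congr (fourier _ x); apply/funext => y.
rewrite pderivsZ; last exact: CSch_CSG.
by rewrite mulrA -exprSr cats1 size_rcons /pderivs foldr_rcons.
Qed.

End ComplexSchwartz.

(** * Unconditional sums over the integer lattice *)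

Section UnconditionalSums.
Variable R : realType.

(** Unconditional convergence, which allows reindexing and iterated summation. *)
Definition has_sum (I : choiceType) (u : I -> R) (S : R) : Prop :=
  forall e : R, 0 < e -> exists K0 : {fset I}, forall K : {fset I}, (K0 `<=` K)%fset ->
    `|\sum_(k <- K) u k - S| <= e.

Lemma le_eps (a b : R) : (forall e, 0 < e -> a <= b + e) -> a <= b.
Proof. by move=> H; apply/ler_addgt0Pl => e /H; rewrite addrC. Qed.

Lemma has_sum_unique (I : choiceType) (u : I -> R) S T : has_sum u S -> has_sum u T -> S = T.
Proof.
move=> H1 H2; apply/eqP; rewrite -subr_eq0 -normr_le0; apply: le_eps => e e0.
have e2 : 0 < e / 2 by rewrite divr_gt0.
have [K1 h1] := H1 _ e2; have [K2 h2] := H2 _ e2.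
have := h1 _ (fsubsetUl K1 K2); have := h2 _ (fsubsetUr K1 K2).
set X := \sum_(k <- _) _ => a b; rewrite add0r.
have -> : S - T = (X - T) - (X - S) by ring.
apply: le_trans (ler_normB _ _) _; lra.
Qed.

Lemma has_sum_lin (I : choiceType) (u v : I -> R) S T a : has_sum u S -> has_sum v T ->
  has_sum (fun k => a * u k + v k) (a * S + T).
Proof.
move=> H1 H2 e e0.
have e1 : 0 < e / (2 * (`|a| + 1)) by rewrite divr_gt0// mulr_gt0// ltr_wpDl.
have e2 : 0 < e / 2 by rewrite divr_gt0.
have [K1 h1] := H1 _ e1; have [K2 h2] := H2 _ e2.
exists (K1 `|` K2)%fset => K KK.
have {}h1 := h1 K (fsubset_trans (fsubsetUl _ _) KK).
have {}h2 := h2 K (fsubset_trans (fsubsetUr _ _) KK).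
rewrite big_split /= -mulr_sumr.
have -> : a * (\sum_(i <- K) u i) + \sum_(i <- K) v i - (a * S + T) =
  a * (\sum_(i <- K) u i - S) + (\sum_(i <- K) v i - T) by ring.
apply: le_trans (ler_normD _ _) _; rewrite normrM.
have a0 : 0 < `|a| + 1 by rewrite ltr_wpDl.
have : `|a| * `|\sum_(i <- K) u i - S| <= e / 2.
  apply: (@le_trans _ _ ((`|a| + 1) * (e / (2 * (`|a| + 1))))).
    by apply: ler_pM => //; rewrite lerDl.
  by rewrite le_eqVlt; apply/orP; left; apply/eqP; field; rewrite gt_eqF.
lra.
Qed.

Lemma has_sum0 (I : choiceType) : has_sum (fun _ : I => 0) 0.
Proof. by move=> e e0; exists fset0 => K _; rewrite big1// subrr normr0 ltW. Qed.

Lemma has_sumZ (I : choiceType) (u : I -> R) S a : has_sum u S -> has_sum (fun k => a * u k) (a * S).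
Proof.
move=> H; have := has_sum_lin a H (has_sum0 I); rewrite addr0.
by congr has_sum; apply/funext => k; rewrite addr0.
Qed.

Lemma has_sumD (I : choiceType) (u v : I -> R) S T : has_sum u S -> has_sum v T ->
  has_sum (fun k => u k + v k) (S + T).
Proof.
move=> H1 H2; have := has_sum_lin 1 H1 H2; rewrite mul1r.
by congr has_sum; apply/funext => k; rewrite mul1r.
Qed.

Lemma has_sum_ge0 (I : choiceType) (u : I -> R) S : has_sum u S -> (forall k, 0 <= u k) -> 0 <= S.
Proof.
move=> H u0; apply: le_eps => e e0; have [K h] := H e e0.
have := h K (fsubset_refl K); have : 0 <= \sum_(k <- K) u k by exact: sumr_ge0.
rewrite ler_norml => ? /andP[]; lra.
Qed.

Lemma has_sum_bound (I : choiceType) (u a : I -> R) S A : has_sum u S -> has_sum a A ->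
  (forall k, `|u k| <= a k) -> `|S| <= A.
Proof.
move=> Hu Ha H.
have h1 := has_sum_ge0 (has_sum_lin (-1) Hu Ha); have h2 := has_sum_ge0 (has_sumD Hu Ha).
rewrite ler_norml; apply/andP; split.
  have : 0 <= S + A by apply: h2 => k; have := H k; rewrite ler_norml => /andP[]; lra.
  lra.
have : 0 <= -1 * S + A by apply: h1 => k; have := H k; rewrite ler_norml => /andP[]; lra.
lra.
Qed.

Lemma sum_fset_le (I : choiceType) (u : I -> R) (A B : {fset I}) :
  (forall k, 0 <= u k) -> (A `<=` B)%fset -> \sum_(k <- A) u k <= \sum_(k <- B) u k.
Proof.
move=> u0 AB; rewrite [leRHS](big_fsetID _ (mem A)) /=.
rewrite (_ : [fset x in B | x \in A]%fset = A); first by rewrite lerDl sumr_ge0.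
apply/fsetP => k; rewrite !inE /= andbC; have [kA|//] := boolP (k \in A).
by rewrite (fsubsetP AB).
Qed.

Lemma has_sum_exists_ge0 (I : choiceType) (u : I -> R) A : (forall k, 0 <= u k) ->
  (forall K : {fset I}, \sum_(k <- K) u k <= A) -> exists2 S, has_sum u S & S <= A.
Proof.
move=> u0 H; pose E := [set x | exists K : {fset I}, x = \sum_(k <- K) u k].
have hE : has_sup E.
  by split; [exists (\sum_(k <- fset0) u k), fset0|exists A => _ [K ->]].
exists (sup E); last by apply: ge_sup; [case: hE|move=> _ [K ->]].
move=> e e0; have [_ [K0 ->] h] := sup_adherent e0 hE.
exists K0 => K K0K.
have h1 : \sum_(k <- K) u k <= sup E by apply: ub_le_sup; [case: hE|exists K].
have h2 := sum_fset_le u0 K0K.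
rewrite ler_norml; apply/andP; split; lra.
Qed.

Lemma has_sum_le_sup (I : choiceType) (u : I -> R) S (K : {fset I}) :
  (forall k, 0 <= u k) -> has_sum u S -> \sum_(k <- K) u k <= S.
Proof.
move=> u0 H; apply: le_eps => e e0; have [K0 h] := H e e0.
have := h _ (fsubsetUl K0 K); have := sum_fset_le u0 (fsubsetUr K0 K).
rewrite ler_norml => ? /andP[]; lra.
Qed.

(** Apply the nonnegative case to u + a. *)
Lemma has_sum_exists (I : choiceType) (u a : I -> R) A : has_sum a A ->
  (forall k, `|u k| <= a k) -> exists S, has_sum u S.
Proof.
move=> Ha H; have a0 k : 0 <= a k by exact: le_trans (H k).
have [||T HT _] := @has_sum_exists_ge0 I (fun k => u k + a k) (2 * A).
- by move=> k; have := H k; rewrite ler_norml => /andP[]; lra.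
- move=> K; apply: (@le_trans _ _ (\sum_(k <- K) 2 * a k)).
    by apply: ler_sum => k _; have := H k; rewrite ler_norml => /andP[]; lra.
  by rewrite -mulr_sumr ler_wpM2l//; exact: has_sum_le_sup.
exists (-1 * A + T); have := has_sum_lin (-1) Ha HT.
by congr has_sum; apply/funext => k; ring.
Qed.

Lemma sum_fsetM (I J : choiceType) (A : {fset I}) (B : {fset J}) (u : I * J -> R) :
  \sum_(p <- (A `*` B)%fset) u p = \sum_(j <- B) \sum_(i <- A) u (i, j).
Proof.
rewrite exchange_big /= big_imfset2 //=.
by move=> [??] [??] _ _ /= [-> ->].
Qed.

(** A finite set of pairs lies in a box A x B; once B is chosen, A can be enlarged
    until each of the finitely many inner sums is accurate. *)
Lemma has_sum_fubini (I J : choiceType) (u : I * J -> R) S (s : J -> R) :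
  has_sum u S -> (forall j, has_sum (fun i => u (i, j)) (s j)) -> has_sum s S.
Proof.
move=> H Hs e e0; have e2 : 0 < e / 2 by rewrite divr_gt0.
have [K0 h] := H _ e2.
exists [fset p.2 | p in K0]%fset => B K0B.
pose n : R := (size B)%:R + 1.
have n0 : 0 < n by rewrite ltr_wpDl.
have en : 0 < e / 2 / n by rewrite divr_gt0.
have /choice[Kj hKj] : forall j, exists Kj : {fset I}, forall K : {fset I}, (Kj `<=` K)%fset ->
   `|\sum_(k <- K) u (k, j) - s j| <= e / 2 / n.
  by move=> j; have [Kj hj] := Hs j _ en; exists Kj.
pose A := ([fset p.1 | p in K0] `|` \bigcup_(j <- B) Kj j)%fset.
have K0AB : (K0 `<=` A `*` B)%fset.
  apply/fsubsetP => p pK; rewrite in_fsetM; apply/andP; split.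
    by rewrite inE; apply/orP; left; apply: in_imfset.
  by apply: (fsubsetP K0B); apply: in_imfset.
have h1 := h _ K0AB; rewrite sum_fsetM in h1.
have h2 : `|\sum_(j <- B) s j - \sum_(j <- B) \sum_(i <- A) u (i, j)| <= e / 2.
  rewrite -sumrB; apply: le_trans (ler_norm_sum _ _ _) _.
  apply: (@le_trans _ _ (\sum_(j <- B) e / 2 / n)).
    rewrite big_seq [leRHS]big_seq; apply: ler_sum => j jB; rewrite distrC; apply: hKj.
    by apply: fsubset_trans (fsubsetUr _ _); exact: bigfcup_sup.
  rewrite big_const_seq count_predT iter_addr_0 -[leLHS]mulr_natr mulrAC ler_pdivrMr//.
  by rewrite ler_wpM2l ?(ltW e2)// lerDl.
have -> : \sum_(j <- B) s j - S = (\sum_(j <- B) s j - \sum_(j <- B) \sum_(i <- A) u (i, j))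
   + (\sum_(j <- B) \sum_(i <- A) u (i, j) - S) by ring.
apply: le_trans (ler_normD _ _) _; lra.
Qed.

Lemma has_sum_reindex (I J : choiceType) (f : I -> J) (g : J -> I) (u : J -> R) S :
  cancel f g -> cancel g f -> has_sum u S -> has_sum (fun i => u (f i)) S.
Proof.
move=> fK gK H e e0; have [K0 h] := H e e0.
exists [fset g j | j in K0]%fset => K K0K.
have := h [fset f i | i in K]%fset; rewrite big_imfset /=; last by move=> ? ? _ _; exact: can_inj.
apply; apply/fsubsetP => j jK; apply/imfsetP; exists (g j); rewrite ?gK//=.
by apply: (fsubsetP K0K); exact: in_imfset.
Qed.

Lemma has_sum_swap (I J : choiceType) (u : I * J -> R) S : has_sum u S -> has_sum (fun p : J * I => u (p.2, p.1)) S.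
Proof.
by apply: (@has_sum_reindex (J * I)%type (I * J)%type (fun p => (p.2, p.1)) (fun p => (p.2, p.1))); case.
Qed.

Lemma has_sum_prod (I J : choiceType) (a : I -> R) (b : J -> R) A B :
  (forall i, 0 <= a i) -> (forall j, 0 <= b j) -> has_sum a A -> has_sum b B ->
  has_sum (fun p : I * J => a p.1 * b p.2) (A * B).
Proof.
move=> a0 b0 Ha Hb.
have [||T HT _] := @has_sum_exists_ge0 _ (fun p : I * J => a p.1 * b p.2) (A * B).
- by move=> p; rewrite mulr_ge0.
- move=> K; apply: (@le_trans _ _ (\sum_(p <- ([fset p.1 | p in K] `*` [fset p.2 | p in K])%fset) a p.1 * b p.2)).
    apply: sum_fset_le; first by move=> p; rewrite mulr_ge0.
    by apply/fsubsetP => p pK; rewrite in_fsetM !in_imfset.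
  rewrite sum_fsetM /=; under eq_bigr do rewrite -mulr_suml.
  rewrite -mulr_sumr; apply: ler_pM; [exact: sumr_ge0|exact: sumr_ge0|exact: has_sum_le_sup|exact: has_sum_le_sup].
have : has_sum (fun j => A * b j) T.
  apply: has_sum_fubini HT _ => j /=.
  have := has_sumZ (b j) Ha; rewrite mulrC; congr has_sum; apply/funext => i; exact: mulrC.
by move=> /has_sum_unique /(_ (has_sumZ A Hb)) <-.
Qed.

Lemma has_sum_single (I : choiceType) (u : I -> R) k0 : (forall k, k != k0 -> u k = 0) -> has_sum u (u k0).
Proof.
move=> H e e0; exists [fset k0]%fset => K; rewrite fsub1set => kK.
rewrite (big_fsetD1 k0)//= big1_fset ?addr0 ?subrr ?normr0 ?ltW// => k.
by rewrite !inE => /andP[/H].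
Qed.

End UnconditionalSums.

Section SumsOverZ.
Variable R : realType.
Implicit Types (u : int -> R) (lam : R).

(** The integers from - N to N. *)
Definition zbox (N : nat) : {fset int} :=
  [fset k in map Posz (iota 0 N.+1) ++ map Negz (iota 0 N)]%fset.

Lemma zbox_sum u N : \sum_(k <- zbox N) u k =
  \sum_(0 <= j < N.+1) u (Posz j) + \sum_(0 <= j < N) u (Negz j).
Proof.
have : uniq (map Posz (iota 0 N.+1) ++ map Negz (iota 0 N)).
  rewrite cat_uniq !map_inj_uniq ?iota_uniq; [|by move=> ? ? []..].
  by rewrite andbT; apply/hasPn => _ /mapP[k _ ->]; apply/negP => /mapP[].
have : \sum_(j <- map Posz (iota 0 N.+1) ++ map Negz (iota 0 N)) u j =
    \sum_(0 <= j < N.+1) u (Posz j) + \sum_(0 <= j < N) u (Negz j).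
  by rewrite big_cat !big_map /index_iota !subn0.
rewrite /zbox; set s := _ ++ _ => <- us; clearbody s.
by rewrite eq_big_imfset //= big_map undup_id.
Qed.

Lemma zbox_sum0 u N : \sum_(k <- zbox N) u k =
  u 0 + \sum_(0 <= j < N) (u j.+1%:Z + u (- j.+1%:Z)).
Proof.
by rewrite zbox_sum big_nat_recl// big_split /= addrA.
Qed.

Lemma zboxP (K : {fset int}) : exists N0, forall N, (N0 <= N)%N -> (K `<=` zbox N)%fset.
Proof.
exists (\max_(k <- K) `|k|%N).+1 => N KN; apply/fsubsetP => k kK.
have kN : (`|k| < N)%N by apply: leq_ltn_trans KN; exact: leq_bigmax_seq.
rewrite in_fset; change (k \in map Posz (iota 0 N.+1) ++ map Negz (iota 0 N)).
rewrite mem_cat; apply/orP; case: k kK kN => j _ jN; [left|right].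
  by apply: map_f; rewrite mem_iota /= add0n ltnS ltnW.
by apply: map_f; rewrite mem_iota /= add0n; apply: ltn_trans jN.
Qed.

Lemma has_sum_zbox u S : has_sum u S -> (fun N => \sum_(k <- zbox N) u k) @ \oo --> S.
Proof.
move=> H; apply/cvgrPdist_le => e e0; have [K0 h] := H e e0; have [N0 hN] := zboxP K0.
by exists N0 => // N /= N0N; rewrite distrC; apply: h; exact: hN.
Qed.

Lemma cauchyw_even (t : R) : cauchyw (- t) = cauchyw t.
Proof. by rewrite /cauchyw sqrrN. Qed.

Lemma cauchyw_anti (s t : R) : 0 <= s -> s <= t -> cauchyw t <= cauchyw s.
Proof.
move=> s0 st; rewrite /cauchyw lef_pV2 ?posrE ?ltr_pwDl ?sqr_ge0//.
by rewrite lerD2l lerXn2r ?nnegrE// (le_trans s0).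
Qed.

Lemma cauchyw_atan (a b : R) : 0 <= a -> a <= b -> (b - a) * cauchyw b <= atan b - atan a.
Proof.
move=> a0 ab.
have [c /andP[c0 c1]] := @mvt R atan (@cauchyw R) a (b - a) (@is_derive1_atan R).
rewrite [a + (b - a)]addrC subrK => ->.
have ba : 0 <= b - a by rewrite subr_ge0.
rewrite ler_wpM2l//; apply: cauchyw_anti; first by rewrite addr_ge0// mulr_ge0.
by rewrite -lerBrDl ler_piMl.
Qed.

(** The terms are compared with increments of the arc tangent, which telescope.
    The bound is that of a Riemann sum, uniform for lam in ]0, 1]. *)
Lemma has_sum_cauchyw lam : 0 < lam -> exists2 S, has_sum (fun k : int => cauchyw (lam * k%:~R)) S &
  0 <= S /\ lam * S <= lam + 2 * atan_sup R.
Proof.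
move=> l0.
have B (K : {fset int}) : \sum_(k <- K) cauchyw (lam * k%:~R) <= 1 + 2 * atan_sup R / lam.
  have [N /(_ N (leqnn N)) KN] := zboxP K.
  apply: le_trans (sum_fset_le _ KN) _; first by move=> k; exact: cauchyw_ge0.
  rewrite zbox_sum0 mulr0; apply: lerD; first exact: cauchyw_le1.
  rewrite ler_pdivlMr// mulrC mulr_sumr.
  apply: (@le_trans _ _ (\sum_(0 <= j < N) 2 * (atan (lam * j.+1%:R) - atan (lam * j%:R)))).
    apply: ler_sum => j _.
    have -> : lam * (- j.+1%:Z)%:~R = - (lam * j.+1%:R) by rewrite mulrNz mulrN.
    have -> : lam * (j.+1%:Z)%:~R = lam * j.+1%:R by [].
    rewrite cauchyw_even; set c := cauchyw _.
    rewrite (_ : lam * (c + c) = 2 * (lam * c)); last by ring.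
    rewrite ler_wpM2l// /c.
    have h1 : 0 <= lam * j%:R by rewrite mulr_ge0// ltW.
    have h2 : lam * j%:R <= lam * j.+1%:R by rewrite ler_wpM2l ?(ltW l0)// ler_nat.
    by have := cauchyw_atan h1 h2; rewrite -mulrBr -natrB// subSnn mulr1.
  rewrite -mulr_sumr telescope_sumr// mulr0 atan0 subr0 ler_wpM2l//.
  exact: atan_le_sup.
have [k|S HS_ SB] := @has_sum_exists_ge0 R _ (fun k : int => cauchyw (lam * k%:~R)) _ _ B.
  exact: cauchyw_ge0.
exists S => //; split; first by apply: has_sum_ge0 HS_ _ => k; exact: cauchyw_ge0.
have := ler_wpM2l (ltW l0) SB; rewrite mulrDr mulr1 mulrCA divff ?gt_eqF//.
by rewrite mulr1.
Qed.

(** The sum is invariant under the involution and changes sign. *)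
Lemma has_sum_odd (I : choiceType) (f : I -> I) (u : I -> R) S : involutive f ->
  (forall k, u (f k) = - u k) -> has_sum u S -> S = 0.
Proof.
move=> fK uf H; have H' := has_sum_reindex fK fK H.
have := has_sum_unique H' (_ : has_sum _ (- S)) => /(_ _).
have -> : (fun i => u (f i)) = fun i => -1 * u i by apply/funext => i; rewrite uf mulN1r.
rewrite -[- S]mulN1r => /(_ (has_sumZ _ H)); lra.
Qed.

End SumsOverZ.

Section SumsOverLattice.
Variable R : realType.

Definition consz e (k0 : int) (k : 'cV[int]_e) : 'cV[int]_e.+1 := col_mx (k0%:M : 'cV_1) k.
Definition headz e (k : 'cV[int]_e.+1) : int := k (o0 e) 0.
Definition tailz e (k : 'cV[int]_e.+1) : 'cV[int]_e := \col_i k (oS i) 0.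

Lemma tailzE e (k : 'cV[int]_e.+1) i : tailz k i 0 = k (oS i) 0.
Proof. by rewrite mxE. Qed.

Lemma headzK e k0 (k : 'cV[int]_e) : headz (consz k0 k) = k0.
Proof. by rewrite /headz /consz /o0 (@col_mxEu _ 1 e 1) mxE eqxx. Qed.

Lemma tailzK e k0 (k : 'cV[int]_e) : tailz (consz k0 k) = k.
Proof. by apply/colP => i; rewrite mxE /consz /oS (@col_mxEd _ 1 e 1). Qed.

Lemma conszK e (k : 'cV[int]_e.+1) : consz (headz k) (tailz k) = k.
Proof.
apply/colP => i; case: (ordS_split i) => [->|[j ->]].
  exact: headzK.
by have /colP/(_ j) := tailzK (headz k) (tailz k); rewrite !tailzE.
Qed.

Lemma has_sum_cons e (u : 'cV[int]_e.+1 -> R) S :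
  has_sum u S -> has_sum (fun p : int * 'cV[int]_e => u (consz p.1 p.2)) S.
Proof.
apply: (@has_sum_reindex R (int * 'cV[int]_e)%type _ (fun p => consz p.1 p.2) (fun k => (headz k, tailz k))).
  by case=> k0 k; rewrite headzK tailzK.
by move=> k; rewrite conszK.
Qed.

Lemma has_sum_uncons e (u : 'cV[int]_e.+1 -> R) S :
  has_sum (fun p : int * 'cV[int]_e => u (consz p.1 p.2)) S -> has_sum u S.
Proof.
move=> H; have := @has_sum_reindex R _ _ (fun k => (headz k, tailz k)) (fun p => consz p.1 p.2) _ S _ _ H.
rewrite (_ : (fun i => _) = u); last by apply/funext => k; rewrite /= conszK.
apply; first by move=> k; rewrite conszK.
by case=> k0 k; rewrite headzK tailzK.
Qed.

Definition latt d (lam : R) (k : 'cV[int]_d) : 'cV[R]_d := lam *: intR R k.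

Lemma latt_consz e lam k0 (k : 'cV[int]_e) :
  latt lam (consz k0 k) = consv (lam * k0%:~R) (latt lam k).
Proof.
have E i : latt lam (consz k0 k) i 0 = lam * (consz k0 k i 0)%:~R.
  by rewrite [LHS]mxE [X in _ * X]mxE.
apply: colS_eqP => [|i]; rewrite E ?consv0 ?consvS.
  by have := headzK k0 k; rewrite /headz => ->.
have /colP/(_ i) := tailzK k0 k; rewrite tailzE => ->.
by rewrite [RHS]mxE [X in _ = _ * X]mxE.
Qed.

Lemma has_sum_wt d lam : 0 < lam -> exists2 S, has_sum (fun k : 'cV[int]_d => wt (latt lam k)) S & 0 <= S.
Proof.
move=> l0; elim: d => [|e [S HS_ S0]].
  exists (wt (latt lam (0 : 'cV[int]_0))); last exact: wt_ge0.
  by apply: has_sum_single => k /eqP[]; apply/colP => -[].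
have [T HT [T0 _]] := has_sum_cauchyw l0.
exists (T * S); last exact: mulr_ge0.
apply: has_sum_uncons; have := has_sum_prod (fun k => cauchyw_ge0 _) (fun k => wt_ge0 _) HT HS_.
by congr has_sum; apply/funext => p; rewrite latt_consz wt_consv.
Qed.

Lemma has_sum_dominated d lam (f : 'cV[int]_d -> R) C : 0 < lam ->
  (forall k, `|f k| <= C * wt (latt lam k)) -> exists S, has_sum f S.
Proof.
move=> l0 H; have [S HS_ _] := has_sum_wt d l0.
exact: has_sum_exists (has_sumZ C HS_) H.
Qed.

End SumsOverLattice.

(** * The Fejer kernel *)

Section Splitting.
Variable R : realType.
Notation mu := (@lebesgue_measure R).
Notation kap := (2 * @atan_sup R).

Lemma zbox_telescope (g : int -> R) N :
  \sum_(k <- zbox N) (g (k + 1) - g k) = g N.+1%:Z - g (- N%:Z).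
Proof.
rewrite zbox_sum0; elim: N => [|N IH].
  by rewrite big_geq// addr0 oppr0.
rewrite big_nat_recr//= addrA IH.
have -> : (N.+1%:Z + 1 = N.+2%:Z)%R by lia.
have -> : (- N.+1%:Z + 1 = - N%:Z)%R by lia.
ring.
Qed.

Section Nodes.
Variables (u u' F Phi E H : R -> R) (C B a delta M eta : R).
Hypotheses (du : forall t : R, is_derive t 1 u (u' t)) (dPhi : forall t : R, is_derive t 1 Phi (F t))
  (dH : forall t : R, is_derive t 1 H (E t)).
Hypotheses (C0 : 0 <= C) (Hu : forall t, `|u t| <= C * cauchyw t)
  (Hu' : forall t, `|u' t| <= C * cauchyw t).
Hypotheses (cF : continuous F) (F0 : forall t, 0 <= F t) (FB : forall t, F t <= B).
Hypotheses (d0 : 0 < delta).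
Let c (l : int) : R := a + delta * l%:~R.
Hypothesis HM : forall l, Phi (c l + delta / 2) - Phi (c l - delta / 2) = M.
Hypothesis HE : forall l t, `|t - c l| <= delta / 2 -> `|t - c l| * F t <= E t.
Hypothesis Heta : forall l, H (c l + delta / 2) - H (c l - delta / 2) <= eta.

Let r : R := `|a| + delta / 2.

Lemma cauchyw_node l t : `|t - c l| <= delta / 2 ->
  cauchyw t <= 2 * (1 + r ^+ 2) * cauchyw (delta * l%:~R).
Proof.
move=> tl; rewrite /cauchyw.
set z := delta * _.
rewrite -[leLHS]mul1r ler_pdivrMr ?ltr_pwDl ?sqr_ge0// mulrAC ler_pdivlMr ?ltr_pwDl ?sqr_ge0//.
rewrite mul1r; pose s := z - t.
have sr : `|s| <= r.
  have -> : s = - (t - c l) - a by rewrite /s /c -/z; ring.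
  by rewrite addrC /r (le_trans (ler_normB _ _))// ?normrN lerD//; rewrite normrN.
have s2 : s ^+ 2 <= r ^+ 2 by rewrite -(real_normK (num_real s)) lerXn2r ?nnegrE// (le_trans _ sr).
have -> : z = t + s by rewrite /s; ring.
have := sqr_ge0 (t - s); have := sqr_ge0 t; have := sqr_ge0 s; have := sqr_ge0 r.
move=> r2 s20 t20 h.
have : 0 <= r ^+ 2 * t ^+ 2 by rewrite mulr_ge0.
have -> : (t + s) ^+ 2 = 2 * t ^+ 2 + 2 * s ^+ 2 - (t - s) ^+ 2 by ring.
nra.
Qed.

(** F is a kernel of mass M on each cell of the grid a + delta Z, and eta bounds
    its first absolute moment there. On a cell the mean value theorem compares u
    with its value at the node; the cells are summed by telescoping a primitive. *)
Lemma splitting S K : has_sum (fun l => u (c l)) S -> has_sum (fun l : int => cauchyw (delta * l%:~R)) K ->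
  `|Rintegral mu setT (fun t => u t * F t) - M * S| <= eta * C * (2 * (1 + r ^+ 2)) * K.
Proof.
move=> HS_ HK.
have cu : continuous u := is_derive_continuous du.
have cuF : continuous (fun t => u t * F t).
  by move=> t; apply: cvgM; [exact: cu|exact: cF].
have B0 : 0 <= B by apply: le_trans (FB 0).
have buF t : `|u t * F t| <= C * B * cauchyw t.
  rewrite normrM mulrAC; apply: ler_pM => //.
  by rewrite ger0_norm.
have [V dV _] := primitive_exists cuF buF.
set I := Rintegral _ _ _.
have d2 : 0 <= delta / 2 by rewrite divr_ge0// ltW.
have cell l : `|(V (c l + delta / 2) - V (c l - delta / 2)) - M * u (c l)| <=
    eta * C * (2 * (1 + r ^+ 2)) * cauchyw (delta * l%:~R).
  set b := 2 * (1 + r ^+ 2) * cauchyw (delta * l%:~R).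
  have b0 : 0 <= b by rewrite /b mulr_ge0 ?cauchyw_ge0// mulr_ge0// addr_ge0// sqr_ge0.
  have D1 (t : R) : is_derive t 1 (fun t => V t - u (c l) * Phi t) ((u t - u (c l)) * F t).
    by rewrite mulrBl; apply: is_deriveB; exact: is_deriveZ.
  have D2 (t : R) : is_derive t 1 (fun t => (C * b) * H t) ((C * b) * E t) by exact: is_deriveZ.
  have le12 : c l - delta / 2 <= c l + delta / 2.
    by apply: (@le_trans _ _ (c l)); rewrite ?gerBl ?lerDl.
  have := derive_comparison le12 D1 D2.
  have -> : V (c l + delta / 2) - u (c l) * Phi (c l + delta / 2) -
    (V (c l - delta / 2) - u (c l) * Phi (c l - delta / 2)) =
    V (c l + delta / 2) - V (c l - delta / 2) - M * u (c l).
    by rewrite -(HM l); ring.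
  move=> DC; apply: le_trans (DC _) _.
    move=> t /andP[t1 t2].
    have tl : `|t - c l| <= delta / 2 by rewrite ler_norml; apply/andP; split; lra.
    rewrite normrM (ger0_norm (F0 t)).
    have [k /andP[k0 k1]] := mvt (c l) (t - c l) du.
    rewrite [c l + (t - c l)]addrC subrK => ->.
    rewrite normrM mulrAC mulrC; apply: ler_pM => //; [exact: mulr_ge0| |exact: HE].
    apply: le_trans (Hu' _) _; rewrite ler_wpM2l// /b; apply: cauchyw_node.
    by rewrite addrAC subrr add0r normrM (ger0_norm k0); apply: le_trans tl; rewrite ler_piMl.
  rewrite -mulrBr -[leRHS](_ : C * b * eta = _); last by rewrite /b; ring.
  by rewrite ler_wpM2l// mulr_ge0.
have partial N : `|(V (c N%:Z + delta / 2) - V (c (- N%:Z) - delta / 2)) -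
    M * (\sum_(k <- zbox N) u (c k))| <= eta * C * (2 * (1 + r ^+ 2)) * K.
  have -> : V (c N%:Z + delta / 2) - V (c (- N%:Z) - delta / 2) =
     \sum_(k <- zbox N) (V (c k + delta / 2) - V (c k - delta / 2)).
    have E1 (k : int) : c k + delta / 2 = c (k + 1) - delta / 2.
      by rewrite /c intrD; field.
    under eq_bigr do rewrite E1.
    rewrite (zbox_telescope (fun k => V (c k - delta / 2))); congr (V _ - _).
    by rewrite E1 (_ : N%:Z + 1 = N.+1%:Z)//; lia.
  rewrite mulr_sumr -sumrB; apply: le_trans (ler_norm_sum _ _ _) _.
  apply: le_trans (ler_sum _ (fun k _ => cell k)) _; rewrite -mulr_sumr.
  have e0 : 0 <= eta.
    apply: le_trans (Heta 0); have dz (t : R) : is_derive t 1 (fun _ : R => 0 : R) 0 by exact: is_derive_cst.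
    have := @derive_comparison R (fun=> 0) (fun=> 0) H E (c 0 - delta / 2) (c 0 + delta / 2).
    rewrite subrr normr0; apply => //.
      by apply: (@le_trans _ _ (c 0)); rewrite ?gerBl ?lerDl.
    move=> t /andP[t1 t2]; rewrite ?normr0; apply: (@le_trans _ _ (`|t - c 0| * F t)); last apply: HE.
      by rewrite mulr_ge0.
    by rewrite ler_norml; apply/andP; split; lra.
  rewrite ler_wpM2l//; last by apply: has_sum_le_sup HK => k; exact: cauchyw_ge0.
  by rewrite !mulr_ge0// addr_ge0// sqr_ge0.
apply: le_eps => e e0; have e3 : 0 < e / 2 by rewrite divr_gt0.
have [T HT] := primitive_cvg cuF buF dV e3.
have eM : 0 < e / 2 / (`|M| + 1) by rewrite !divr_gt0// ltr_wpDl.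
have /cvgrPdist_le/(_ _ eM)[N1 _ HN1] := has_sum_zbox HS_.
pose N := maxn N1 (Num.truncn ((`|T| + `|a|) / delta)).+1.
have HN : (`|T| + `|a|) / delta <= N%:R.
  apply: (@le_trans _ _ (Num.truncn ((`|T| + `|a|) / delta)).+1%:R).
    by apply/ltW/truncnS_gt.
  by rewrite ler_nat leq_maxr.
rewrite ler_pdivrMr// in HN.
have nT : c (- N%:Z) - delta / 2 <= - T.
  rewrite /c mulrNz mulrN [delta * _]mulrC.
  by have := ler_norm T; have := ler_norm a; rewrite -[N%:Z%:~R]/(N%:R : R); lra.
have pT : T <= c N%:Z + delta / 2.
  rewrite /c [delta * _]mulrC -[N%:Z%:~R]/(N%:R : R).
  by have := ler_norm T; have := ler_norm (- a); rewrite normrN; lra.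
have h1 := HT _ _ nT pT; have h2 := HN1 N (leq_maxl _ _).
have h3 := partial N; set X := V _ - V _ in h1 h3.
set Y := \sum_(k <- _) _ in h2 h3.
have -> : I - M * S = - (X - I) + (X - M * Y) - M * (S - Y) by rewrite /I; ring.
apply: le_trans (ler_normB _ _) _; rewrite normrM.
have h4 : `|M| * `|S - Y| <= e / 2.
  apply: (@le_trans _ _ ((`|M| + 1) * (e / 2 / (`|M| + 1)))).
    by apply: ler_pM => //; rewrite lerDl.
  by rewrite mulrCA divff ?mulr1// gt_eqF// ltr_wpDl.
have := ler_normD (- (X - I)) (X - M * Y); rewrite normrN; lra.
Qed.

End Nodes.

(** The case of a constant kernel, whose first moment on a cell is of order lam^2. *)
Lemma riemann_sum1 (u u' : R -> R) (C lam S : R) : (forall t : R, is_derive t 1 u (u' t)) ->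
  0 <= C -> (forall t, `|u t| <= C * cauchyw t) -> (forall t, `|u' t| <= C * cauchyw t) ->
  0 < lam -> lam <= 1 -> has_sum (fun l : int => u (lam * l%:~R)) S ->
  `|Rintegral mu setT u - lam * S| <= lam * C * (2 * (1 + kap)).
Proof.
move=> du C0 Hu Hu' l0 l1 HS_.
have [K HK [K0 lK]] := has_sum_cauchyw l0.
have HS' : has_sum (fun l : int => u (0 + lam * l%:~R)) S.
  by move: HS_; congr has_sum; apply/funext => l; rewrite add0r.
have Did (k t : R) : is_derive t 1 (fun t : R => k * t) k.
  by rewrite -[X in is_derive _ _ _ X]mulr1; apply: is_deriveZ; exact: is_derive_id.
have Did1 (t : R) : is_derive t 1 (fun t : R => t) (1 : R) by exact: is_derive_id.
have := @splitting u u' (fun=> 1) (fun t => t) (fun=> lam / 2) (fun t => lam / 2 * t)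
  C 1 0 lam lam (lam / 2 * lam) du Did1 (Did _) C0 Hu Hu' _ _ _ l0 _ _ _ S K HS' HK.
have -> : (fun t => u t * 1) = u by apply/funext => t; rewrite mulr1.
move=> H; apply: le_trans (H _ _ _ _ _ _) _.
- by move=> t; exact: cvg_cst.
- by move=> _; exact: ler01.
- by [].
- by move=> l; field.
- by move=> l t; rewrite mulr1.
- by move=> l; clear H; rewrite -mulrBr; apply: ler_wpM2l; lra.
clear H; rewrite normr0 add0r.
have lam2 : (lam / 2) ^+ 2 <= 1 by rewrite expr_le1//; lra.
apply: (@le_trans _ _ (lam * C * 2 * (lam * K))).
  have -> : lam / 2 * lam * C * (2 * (1 + (lam / 2) ^+ 2)) * K =
    (lam * C * (lam * K)) * (1 + (lam / 2) ^+ 2) by field.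
  have -> : lam * C * 2 * (lam * K) = lam * C * (lam * K) * 2 by ring.
  by rewrite ler_wpM2l//; [rewrite !mulr_ge0// ltW|lra].
rewrite -!mulrA ler_wpM2l ?(ltW l0)// ler_wpM2l// ler_wpM2l//; lra.
Qed.

End Splitting.

Section Fejer.
Variable R : realType.
Implicit Types x t : R.

(** The Dirichlet kernel, by recursion on the number of frequencies. *)
Fixpoint dirichlet (N : nat) x : R :=
  if N is M.+1 then dirichlet M x + 2 * cos (N%:R * x) else 1.
Fixpoint dirichlet_prim (N : nat) x : R :=
  if N is M.+1 then dirichlet_prim M x + 2 / N%:R * sin (N%:R * x) else x.
(** The sum of the Dirichlet kernels of degree at most n, that is, n + 1 times the
    Fejer kernel. *)
Fixpoint fejer (n : nat) x : R :=
  if n is m.+1 then fejer m x + dirichlet n x else 1.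
Fixpoint fejer_prim (n : nat) x : R :=
  if n is m.+1 then fejer_prim m x + dirichlet_prim n x else x.

Lemma derive_lin (k a : R) t : is_derive t 1 (fun s => k * (s - a)) k.
Proof.
apply: (@is_derive_quad _ _ _ _ _ _ 0) => h _.
by rewrite scaler1 mul0r (_ : _ - h * k = 0) ?normr0//; ring.
Qed.

Lemma derive_sink (k : R) t : is_derive t 1 (fun s => sin (k * s)) (k * cos (k * t)).
Proof.
have := proj1 (sincos_affine_derive k 0 t); rewrite add0r [t * k]mulrC.
by congr is_derive; apply/funext => s; rewrite add0r mulrC.
Qed.

Lemma dirichlet_derive N x : is_derive x 1 (dirichlet_prim N) (dirichlet N x).
Proof.
elim: N => [|N IH]; first exact: is_derive_id.
apply: is_deriveD.
have -> : 2 * cos (N.+1%:R * x) = 2 / N.+1%:R * (N.+1%:R * cos (N.+1%:R * x)).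
  by rewrite mulrA divfK ?pnatr_eq0.
by apply: is_deriveZ; exact: derive_sink.
Qed.

Lemma fejer_derive n x : is_derive x 1 (fejer_prim n) (fejer n x).
Proof.
elim: n => [|n IH]; first exact: is_derive_id.
by apply: is_deriveD; exact: dirichlet_derive.
Qed.

Lemma dirichlet_continuous N : continuous (dirichlet N).
Proof.
elim: N => [|N IH] x; first exact: cvg_cst.
apply: cvgD; first exact: IH.
apply: cvgM; first exact: cvg_cst.
apply: continuous_comp; last exact: continuous_cos.
by apply: cvgM; [exact: cvg_cst|exact: cvg_id].
Qed.

Lemma fejer_continuous n : continuous (fejer n).
Proof.
elim: n => [|n IH] x; first exact: cvg_cst.
by apply: cvgD; [exact: IH|exact: dirichlet_continuous].
Qed.

Lemma dirichlet_bound N x : `|dirichlet N x| <= 1 + 2 * N%:R.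
Proof.
elim: N => [|N IH]; first by rewrite mulr0 addr0 normr1.
rewrite -[leRHS](_ : 1 + 2 * N%:R + 2 = _); last by rewrite -[N.+1%:R]natr1; ring.
rewrite /= (le_trans (ler_normD _ _))// lerD//.
rewrite normrM (@ger0_norm _ 2)// ler_piMr// ler_norml cos_geN1 cos_le1//.
Qed.

Lemma fejer_bound n : exists B, forall x, `|fejer n x| <= B.
Proof.
elim: n => [|n [B HB]]; first by exists 1 => x; rewrite /= normr1.
exists (B + (1 + 2 * n.+1%:R)) => x; rewrite /= (le_trans (ler_normD _ _))// lerD//.
exact: (@dirichlet_bound n.+1).
Qed.

Lemma dirichlet_cos N x : (1 - cos x) * dirichlet N x = cos (N%:R * x) - cos (N.+1%:R * x).
Proof.
elim: N => [|N IH]; first by rewrite mul0r cos0 mul1r mulr1.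
have -> : dirichlet N.+1 x = dirichlet N x + 2 * cos (N.+1%:R * x) by [].
rewrite mulrDr IH.
have -> : N.+2%:R * x = N.+1%:R * x + x by rewrite -[N.+2%:R]natr1; ring.
have -> : N%:R * x = N.+1%:R * x - x by rewrite -[N.+1%:R]natr1; ring.
by rewrite cosB cosD; ring.
Qed.

(** The closed form is multiplied by 1 - cos x, so that it holds where this factor
    vanishes as well. *)
Lemma fejer_cos n x : (1 - cos x) * fejer n x = 1 - cos (n.+1%:R * x).
Proof.
elim: n => [|n IH]; first by rewrite mulr1 mul1r.
have -> : fejer n.+1 x = fejer n x + dirichlet n.+1 x by [].
rewrite mulrDr IH (@dirichlet_cos n.+1); ring.
Qed.

(** Where cos x = 1 all the cosines are equal to 1. *)
Lemma fejer_ge0 n x : 0 <= fejer n x.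
Proof.
have := cos_le1 x; rewrite le_eqVlt => /predU1P[c1|c1].
  have s0 : sin x = 0.
    by have := cos2Dsin2 x; rewrite c1 expr1n => /eqP; rewrite -subr_eq0 addrAC subrr add0r sqrf_eq0 => /eqP.
  have cn N : cos (N%:R * x) = 1.
    elim: N => [|N IH]; first by rewrite mul0r cos0.
    by rewrite -natr1 mulrDl mul1r cosD IH c1 s0 mulr0 subr0 mulr1.
  have dn N : 0 <= dirichlet N x.
    by elim: N => [|N IH] /=; rewrite ?ler01// addr_ge0// cn mulr1.
  by elim: n => [|n IH] /=; rewrite ?ler01// addr_ge0//; exact: (dn n.+1).
have c2 : 0 < 1 - cos x by rewrite subr_gt0.
by rewrite -(pmulr_rge0 _ c2) fejer_cos subr_ge0 cos_le1.
Qed.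

Lemma sin_period_nat N x : sin (x + N%:R * (2 * pi)) = sin x.
Proof.
have -> : N%:R * (2 * pi) = (pi : R) *+ 2 *+ N by rewrite !mulr_natl.
exact: (periodicn (@sinD2pi R)).
Qed.

Lemma cos_period_nat N x : cos (x + N%:R * (2 * pi)) = cos x.
Proof.
have -> : N%:R * (2 * pi) = (pi : R) *+ 2 *+ N by rewrite !mulr_natl.
exact: (periodicn (@cosD2pi R)).
Qed.

Lemma cos_period (l : int) x : cos (x + l%:~R * (2 * pi)) = cos x.
Proof.
case: l => n; first exact: cos_period_nat.
by rewrite NegzE mulrNz mulNr -[LHS](cos_period_nat n.+1) subrK.
Qed.

Lemma sin_period (l : int) x : sin (x + l%:~R * (2 * pi)) = sin x.
Proof.
case: l => n; first exact: sin_period_nat.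
by rewrite NegzE mulrNz mulNr -[LHS](sin_period_nat n.+1) subrK.
Qed.

Lemma dirichlet_prim_period N x : dirichlet_prim N (x + 2 * pi) = dirichlet_prim N x + 2 * pi.
Proof.
elim: N => //= N ->; rewrite [N.+1%:R * (x + _)]mulrDr sin_period_nat; ring.
Qed.

Lemma fejer_prim_period n x : fejer_prim n (x + 2 * pi) = fejer_prim n x + n.+1%:R * (2 * pi).
Proof.
elim: n => [|n IH]; first by rewrite mul1r.
have E y : fejer_prim n.+1 y = fejer_prim n y + dirichlet_prim n.+1 y by [].
by rewrite !E (@dirichlet_prim_period n.+1) IH -[n.+2%:R]natr1; ring.
Qed.

End Fejer.

Section FejerPoisson.
Variable R : realType.
Notation mu := (@lebesgue_measure R).
Variables (u u' : R -> R) (C lam a : R).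
Hypotheses (du : forall t : R, is_derive t 1 u (u' t)) (C0 : 0 <= C)
  (Hu : forall t, `|u t| <= C * cauchyw t) (Hu' : forall t, `|u' t| <= C * cauchyw t)
  (l0 : 0 < lam).

Let delta := 2 * pi / lam.
Let x_ (t : R) := lam * (t - a).

Let delta_gt0 : 0 < delta. Proof. by rewrite divr_gt0// mulr_gt0// pi_gt0. Qed.

Lemma derive_comp_lin (f f' : R -> R) (t : R) : (forall x : R, is_derive x 1 f (f' x)) ->
  is_derive t 1 (fun t => f (x_ t) / lam) (f' (x_ t)).
Proof.
move=> df.
have := @is_derive1_comp R f x_ t _ _ (df (x_ t)) (derive_lin lam a t) => D.
have : is_derive t 1 (fun s => lam^-1 * (f \o x_) s) (lam^-1 * (f' (x_ t) * lam)).
  exact: is_deriveZ.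
rewrite mulrCA mulVf ?gt_eqF// mulr1.
by congr is_derive; apply/funext => s /=; exact: mulrC.
Qed.

(** Away from the origin |y| is at most a multiple of 1 - cos y, which cancels the
    singularity of the Fejer kernel in its first moment. *)
Lemma node_abs (eps y : R) : 0 < eps -> eps < pi -> `|y| <= pi ->
  `|y| <= eps + pi / (1 - cos eps) * (1 - cos y).
Proof.
move=> e0 epi ypi.
have ce : cos eps < 1.
  by rewrite -(@cos0 R) ltr_cos// in_itv/= ?lexx ?pi_ge0// ltW//= ltW.
have p : 0 < pi / (1 - cos eps) by rewrite divr_gt0 ?pi_gt0// subr_gt0.
have [ye|ey] := leP `|y| eps.
  by rewrite (le_trans ye)// lerDl mulr_ge0 ?(ltW p)// subr_ge0 cos_le1.
have cy : cos y <= cos eps.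
  have -> : cos y = cos `|y| by case: (ger0P y) => // _; rewrite cosN.
  by rewrite ltW// ltr_cos// in_itv/= ?normr_ge0 ?ypi// (ltW e0) ltW.
apply: (le_trans ypi).
have : pi <= pi / (1 - cos eps) * (1 - cos y).
  rewrite mulrAC ler_pdivlMr ?subr_gt0// ler_wpM2l ?pi_ge0//; lra.
lra.
Qed.

(** On each cell the kernel has mass proportional to n + 1, while its first moment
    is at most eps (n + 1) up to a constant that depends on eps only. *)
Lemma fejer_limit S : has_sum (fun l : int => u (a + delta * l%:~R)) S ->
  (fun n => n.+1%:R^-1 * Rintegral mu setT (fun t => u t * fejer n (x_ t))) @ \oo --> delta * S.
Proof.
move=> HS_; have [K HK [K0 _]] := has_sum_cauchyw delta_gt0.
pose Q := C * (2 * (1 + (`|a| + delta / 2) ^+ 2)) * K.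
have Q0 : 0 <= Q by rewrite !mulr_ge0// addr_ge0// sqr_ge0.
have main n eps : 0 < eps -> eps < pi ->
  `|Rintegral mu setT (fun t => u t * fejer n (x_ t)) - n.+1%:R * delta * S| <=
     lam^-1 * (eps * (n.+1%:R * delta) + pi / (1 - cos eps) * delta) * Q.
  move=> e0 epi.
  have [B HB] := fejer_bound R n.
  pose E t := lam^-1 * (eps * fejer n (x_ t) + pi / (1 - cos eps) * (1 - cos (n.+1%:R * x_ t))).
  pose H0 x := eps * fejer_prim n x + pi / (1 - cos eps) * (x - n.+1%:R^-1 * sin (n.+1%:R * x)).
  pose H t := lam^-1 * (H0 (x_ t) / lam).
  have dH (t : R) : is_derive t 1 H (E t).
    apply: is_deriveZ.
    apply: (@derive_comp_lin H0 (fun x => eps * fejer n x + pi / (1 - cos eps) * (1 - cos (n.+1%:R * x)))) => x.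
    apply: is_deriveD; apply: is_deriveZ; first exact: fejer_derive.
    apply: is_deriveB.
    have -> : cos (n.+1%:R * x) = n.+1%:R^-1 * (n.+1%:R * cos (n.+1%:R * x)).
      by rewrite mulKf// pnatr_eq0.
    by apply: is_deriveZ; exact: derive_sink.
  have dPhi (t : R) : is_derive t 1 (fun t => fejer_prim n (x_ t) / lam) (fejer n (x_ t)).
    by apply: derive_comp_lin => x; exact: fejer_derive.
  have xc (l : int) : x_ (a + delta * l%:~R + delta / 2) = x_ (a + delta * l%:~R - delta / 2) + 2 * pi.
    by rewrite /x_ /delta; field; rewrite gt_eqF.
  have sp := @splitting R u u' (fun t => fejer n (x_ t)) (fun t => fejer_prim n (x_ t) / lam) E H
    C B a delta (n.+1%:R * delta) (lam^-1 * (eps * (n.+1%:R * delta) + pi / (1 - cos eps) * delta))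
    du dPhi dH C0 Hu Hu' _ _ _ delta_gt0 _ _ _ S K HS_ HK.
  have E1 eta : eta * C * (2 * (1 + (`|a| + delta / 2) ^+ 2)) * K = eta * Q.
    by rewrite /Q; ring.
  rewrite E1 in sp; apply: sp.
  - move=> t; apply: continuous_comp; last exact: fejer_continuous.
    by apply: cvgM; [exact: cvg_cst|apply: cvgB; [exact: cvg_id|exact: cvg_cst]].
  - by move=> t; exact: fejer_ge0.
  - by move=> t; apply: le_trans (HB _); exact: ler_norm.
  - by move=> l; rewrite xc fejer_prim_period /delta; field; rewrite gt_eqF.
  - move=> l t; set c := a + _ => tc.
    have yE : x_ t = lam * (t - c) + l%:~R * (2 * pi).
      by rewrite /x_ /c /delta; field; rewrite gt_eqF.
    have ypi : `|lam * (t - c)| <= pi.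
      rewrite normrM (gtr0_norm l0) -ler_pdivlMl//; apply: le_trans tc _.
      rewrite le_eqVlt; apply/orP; left; apply/eqP.
      by rewrite /delta; field; rewrite gt_eqF.
    have := node_abs e0 epi ypi; rewrite -(cos_period l (lam * (t - c))) -yE.
    rewrite normrM (gtr0_norm l0) -ler_pdivlMl// => h.
    apply: le_trans (ler_wpM2r (fejer_ge0 n (x_ t)) h) _.
    by rewrite /E -fejer_cos le_eqVlt; apply/orP; left; apply/eqP; ring.
  - move=> l; rewrite /H xc /H0 fejer_prim_period (mulrDr n.+1%:R (x_ _)) sin_period_nat.
    rewrite le_eqVlt; apply/orP; left; apply/eqP; rewrite /delta.
    set z := sin _; set f := fejer_prim _ _; set p := pi / _; set m := n.+1%:R^-1.
    by field; rewrite gt_eqF.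
pose W := lam^-1 * delta * Q.
have W0 : 0 <= W by rewrite mulr_ge0// mulr_ge0 ?invr_ge0 ?(ltW l0) ?(ltW delta_gt0).
apply/cvgrPdist_le => e e0.
pose eps := Num.min 1 (e / (2 * (W + 1))).
have W1 : 0 < 2 * (W + 1) by rewrite mulr_gt0// ltr_wpDl.
have eps0 : 0 < eps by rewrite lt_min ltr01 divr_gt0.
have epspi : eps < pi.
  by apply: (@le_lt_trans _ _ 1); [rewrite ge_min lexx|have := @pi_ge2 R; lra].
have epsW : W * eps <= e / 2.
  apply: (@le_trans _ _ ((W + 1) * (e / (2 * (W + 1))))).
    apply: ler_pM => //; [exact: ltW|by rewrite lerDl|by rewrite ge_min lexx orbT].
  by rewrite le_eqVlt; apply/orP; left; apply/eqP; field; rewrite gt_eqF// ltr_wpDl.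
pose A := pi / (1 - cos eps).
near=> n.
have n0 : 0 < n.+1%:R :> R by rewrite ltr0n.
have nA : `|W * A| <= e / 2 * n.+1%:R.
  rewrite -ler_pdivrMl ?divr_gt0// mulrC; near: n; exists (Num.truncn (`|W * A| / (e / 2))).+1 => // n /= Hn.
  apply: le_trans (ltW (truncnS_gt _)) _; rewrite ler_nat.
  exact: leq_trans Hn (leqnSn _).
have := main n eps eps0 epspi; set I := Rintegral _ _ _ => mn.
have -> : delta * S - n.+1%:R^-1 * I = - (n.+1%:R^-1 * (I - n.+1%:R * delta * S)).
  by field; rewrite gt_eqF.
rewrite normrN normrM gtr0_norm ?invr_gt0// ler_pdivrMl//.
apply: (le_trans mn).
have -> : lam^-1 * (eps * (n.+1%:R * delta) + pi / (1 - cos eps) * delta) * Q =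
   n.+1%:R * (W * eps) + W * A by rewrite /W /A; ring.
have : W * A <= e / 2 * n.+1%:R by apply: le_trans nA; exact: ler_norm.
have : n.+1%:R * (W * eps) <= n.+1%:R * (e / 2) by rewrite ler_wpM2l// ltW.
lra.
Unshelve. all: by end_near. Qed.

End FejerPoisson.

(** * Poisson summation *)

Section PoissonLine.
Variable R : realType.
Notation mu := (@lebesgue_measure R).
Variables (u u' : R -> R) (C lam a : R).
Hypotheses (du : forall t : R, is_derive t 1 u (u' t)) (C0 : 0 <= C)
  (Hu : forall t, `|u t| <= C * cauchyw t) (Hu' : forall t, `|u' t| <= C * cauchyw t)
  (l0 : 0 < lam).

Let s N := Rintegral mu setT (fun t => u t * dirichlet N (lam * (t - a))).

Lemma mul_bounded_lin (k1 k2 : R -> R) B : continuous k1 -> continuous k2 ->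
  (forall t, `|k1 t| <= B) -> (forall t, `|k2 t| <= B) ->
  Rintegral mu setT (fun t => u t * (k1 t + k2 t)) =
  Rintegral mu setT (fun t => u t * k1 t) + Rintegral mu setT (fun t => u t * k2 t).
Proof.
move=> ck1 ck2 b1 b2; have cu : continuous u := is_derive_continuous du.
have B0 : 0 <= B by apply: le_trans (b1 0).
have bd (k : R -> R) : (forall t, `|k t| <= B) -> forall t, `|u t * k t| <= C * B * cauchyw t.
  by move=> bk t; rewrite normrM mulrAC; apply: ler_pM.
rewrite -[X in X + _]mul1r -(@Rintegral_linear _ _ _ (C * B)).
- by apply: eq_Rintegral => t _; rewrite mul1r mulrDr.
- by move=> t; apply: cvgM; [exact: cu|exact: ck1].
- by move=> t; apply: cvgM; [exact: cu|exact: ck2].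
- exact: bd.
- exact: bd.
Qed.

Lemma continuous_affine (k : R -> R) : continuous k -> continuous (fun t => k (lam * (t - a))).
Proof.
move=> ck t; apply: continuous_comp; last exact: ck.
by apply: cvgM; [exact: cvg_cst|apply: cvgB; [exact: cvg_id|exact: cvg_cst]].
Qed.

Lemma fejer_mean n : arithmetic_mean s n =
  n.+1%:R^-1 * Rintegral mu setT (fun t => u t * fejer n (lam * (t - a))).
Proof.
rewrite /arithmetic_mean; congr (_ * _); rewrite /series /=.
elim: n => [|n IH]; first by rewrite big_nat1.
rewrite big_nat_recr//= IH.
have [B HB] := fejer_bound R n.
have B0 : 0 <= B by apply: le_trans (HB 0).
rewrite -(@mul_bounded_lin _ _ (B + (1 + 2 * n.+1%:R)))//.
- exact/continuous_affine/fejer_continuous.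
- exact: (continuous_affine (@dirichlet_continuous R n.+1)).
- by move=> t; apply: (le_trans (HB _)); rewrite lerDl addr_ge0// mulr_ge0.
- by move=> t; apply: (le_trans (@dirichlet_bound _ n.+1 _)); rewrite lerDr.
Qed.

(** One-dimensional Poisson summation by Cesaro summability: the means of the
    partial sums converge, by the Fejer kernel, to the sum over the dual lattice. *)
Lemma poisson1 S S' : s @ \oo --> S ->
  has_sum (fun l : int => u (a + 2 * pi / lam * l%:~R)) S' -> lam * S = 2 * pi * S'.
Proof.
move=> /cesaro cs HS_; have cf := fejer_limit du C0 Hu Hu' l0 HS_.
have E : S = 2 * pi / lam * S'.
  have <- : limn (arithmetic_mean s) = S by apply: cvg_lim cs; exact: Rhausdorff.
  rewrite (_ : arithmetic_mean s =
      fun n => n.+1%:R^-1 * Rintegral mu setT (fun t => u t * fejer n (lam * (t - a)))).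
    by apply: cvg_lim cf; exact: Rhausdorff.
  by apply/funext => n; rewrite fejer_mean.
by rewrite E; field; rewrite gt_eqF.
Qed.

End PoissonLine.

Section JointDecay.
Variables (R : realType) (e : nat).
Implicit Types (w : 'cV[R]_e.+1 -> R) (x y : 'cV[R]_e) (t c : R).

Lemma dotp_consv s t x y : dotp (consv s x) (consv t y) = s * t + dotp x y.
Proof.
rewrite /dotp (@big_split_ord _ _ _ 1 e) big_ord1 /=; congr (_ + _).
  by rewrite -/(o0 e) !consv0.
by apply: eq_bigr => i _; rewrite -/(oS i) !consvS.
Qed.

Lemma consvD s t x y : consv s x + consv t y = consv (s + t) (x + y).
Proof.
have E (u v : 'cV[R]_e.+1) i : (u + v) i 0 = u i 0 + v i 0 by rewrite mxE.
by apply: colS_eqP => [|i]; rewrite E ?consv0// !consvS mxE.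
Qed.

Lemma slice_cosd w x c t :
  slice (fun z => w z * cosd (consv 0 x) c z) t = fun y => slice w t y * cosd x c y.
Proof. by apply/funext => y; rewrite /slice /cosd dotp_consv mulr0 add0r. Qed.

Lemma slice_sind w x c t :
  slice (fun z => w z * sind (consv 0 x) c z) t = fun y => slice w t y * sind x c y.
Proof. by apply/funext => y; rewrite /slice /sind dotp_consv mulr0 add0r. Qed.

(** Multiplication of the transform in the inner variables by 1 + x_i^2 corresponds
    to the operator 1 - d_i^2. It is applied to w before slicing, so that one
    function v serves all slices. *)
Lemma weight_transfer w (s : seq 'I_e) : Sch w -> exists2 v, Sch v & forall t x,
  (\prod_(i <- s) (1 + x i 0 ^+ 2)) * Fc (slice w t) x = Fc (slice v t) x /\
  (\prod_(i <- s) (1 + x i 0 ^+ 2)) * Fs (slice w t) x = Fs (slice v t) x.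
Proof.
move=> sw; elim: s => [|i s [v sv IH]].
  by exists w => // t x; rewrite !big_nil !mul1r.
have s1 := Sch_pd (oS i) sv; have s2 := Sch_pd (oS i) s1.
exists (fun z => -1 * pd (oS i) (pd (oS i) v) z + v z).
  by apply: SchD => //; exact: SchZ.
move=> t x; have [IHc IHs] := IH t x.
have v1 := Sch_slice t sv; have v2 := Sch_slice t s1; have v3 := Sch_slice t s2.
have E : slice (fun z => -1 * pd (oS i) (pd (oS i) v) z + v z) t =
    fun y => -1 * slice (pd (oS i) (pd (oS i) v)) t y + slice v t y by [].
have P1 : pd i (slice v t) = slice (pd (oS i) v) t by apply: pd_slice; exact: Sch_pdable.
have P2 : pd i (slice (pd (oS i) v) t) = slice (pd (oS i) (pd (oS i) v)) t.
  by apply: pd_slice; exact: Sch_pdable.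
rewrite E Fc_lin// Fs_lin// !big_cons -!mulrA IHc IHs !mulrDl !mul1r.
rewrite expr2 -!mulrA coord_Fc// coord_Fs// P1.
by rewrite mulrN coord_Fs// coord_Fc// P2; split; ring.
Qed.

(** Decay jointly in the first variable and in the remaining frequencies is what
    makes the double sums of Poisson summation converge absolutely. *)
Lemma partial_fourier_decay w : Sch w -> exists2 C, 0 <= C & forall t x c,
  `|int_Rd (fun y => slice w t y * cosd x c y)| <= C * (cauchyw t * wt x).
Proof.
move=> sw; have [v sv Hv] := weight_transfer (index_enum 'I_e) sw.
have [C C0 HC] := rapid_wt (Sch_rapid sv).
pose K := C * (2 * atan_sup R) ^+ e.
have K0 : 0 <= K by rewrite mulr_ge0// exprn_ge0// kap_ge0.
exists (K + K); first by rewrite addr_ge0.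
have wtV x : wt x * \prod_i (1 + x i 0 ^+ 2) = 1.
  by rewrite /wt /cauchyw prodfV mulVf// gt_eqF// prodr_gt0// => i _; rewrite ltr_pwDl// sqr_ge0.
have bc t x : `|Fc (slice w t) x| <= K * (cauchyw t * wt x).
  rewrite -[Fc _ _]mul1r -(wtV x) -mulrA (proj1 (Hv t x)) normrM (ger0_norm (wt_ge0 _)).
  rewrite [leRHS](_ : _ = wt x * (K * cauchyw t)); last by ring.
  rewrite ler_wpM2l ?wt_ge0// /Fc -slice_cosd.
  apply: (@partial_int_bound R e _ C t); first exact: Sch_cosd.
  by move=> z; apply: le_trans (HC z); rewrite normrM ler_piMr// ler_norml cos_geN1 cos_le1.
have bs t x : `|Fs (slice w t) x| <= K * (cauchyw t * wt x).
  rewrite -[Fs _ _]mul1r -(wtV x) -mulrA (proj2 (Hv t x)) normrM (ger0_norm (wt_ge0 _)).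
  rewrite [leRHS](_ : _ = wt x * (K * cauchyw t)); last by ring.
  rewrite ler_wpM2l ?wt_ge0// /Fs -slice_sind.
  apply: (@partial_int_bound R e _ C t); first exact: Sch_sind.
  by move=> z; apply: le_trans (HC z); rewrite normrM ler_piMr// ler_norml sin_geN1 sin_le1.
move=> t x c; have swt := Sch_slice t sw.
have -> : int_Rd (fun y => slice w t y * cosd x c y) =
    cos c * Fc (slice w t) x + (- sin c) * Fs (slice w t) x.
  rewrite /Fc /Fs -intZ; last exact: Sch_cosd.
  rewrite addrC -int_lin; [|exact: Sch_sind|by apply: SchZ; exact: Sch_cosd].
  congr int_Rd; apply/funext => y; rewrite /cosd /sind cosD !addr0; ring.
rewrite (le_trans (ler_normD _ _))// mulrDl lerD//.
  by apply: le_trans (bc t x); rewrite normrM ler_piMl// ler_norml cos_geN1 cos_le1.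
by apply: le_trans (bs t x); rewrite normrM normrN ler_piMl// ler_norml sin_geN1 sin_le1.
Qed.

End JointDecay.

Section Poisson.
Variable R : realType.
Notation mu := (@lebesgue_measure R).

(** The integral of w(y) cos(x.(y - a)): the cosine transform of w with the origin
    moved to a. *)
Definition Fca d (w : 'cV[R]_d -> R) (a x : 'cV[R]_d) : R :=
  int_Rd (fun y => w y * cosd x (- dotp x a) y).
Definition Fsa d (w : 'cV[R]_d -> R) (a x : 'cV[R]_d) : R :=
  int_Rd (fun y => w y * sind x (- dotp x a) y).

Lemma FcaE d (w : 'cV[R]_d -> R) a x : Sch w ->
  Fca w a x = cosd a 0 x * Fc w x + sind a 0 x * Fs w x.
Proof.
move=> sw; rewrite /Fca /Fc /Fs -intZ; last exact: Sch_cosd.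
rewrite addrC -int_lin; [|exact: Sch_sind|by apply: SchZ; exact: Sch_cosd].
by congr int_Rd; apply/funext => y; rewrite /cosd /sind cosD cosN sinN !addr0; ring.
Qed.

Lemma FsaE d (w : 'cV[R]_d -> R) a x : Sch w ->
  Fsa w a x = cosd a 0 x * Fs w x - sind a 0 x * Fc w x.
Proof.
move=> sw; have := intZ (- sind a 0 x) (Sch_cosd x 0 sw); rewrite /Fsa /Fc /Fs mulNr => <-.
rewrite -int_lin; [|exact: Sch_sind|by apply: SchZ; exact: Sch_cosd].
by congr int_Rd; apply/funext => y; rewrite /cosd /sind sinD cosN sinN !addr0; ring.
Qed.

Lemma Sch_Fc d (w : 'cV[R]_d -> R) : Sch w -> Sch (Fc w).
Proof.
move=> sw; apply: fourier_part_Sch; exists w, (fun=> 0); split => //; first exact: Sch0.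
apply/funext => x; rewrite (_ : Fs _ _ = 0) ?addr0// /Fs -[RHS](@int0 R d).
by congr int_Rd; apply/funext => y; rewrite mul0r.
Qed.

Lemma Sch_Fs d (w : 'cV[R]_d -> R) : Sch w -> Sch (Fs w).
Proof.
move=> sw; apply: fourier_part_Sch; exists (fun=> 0), w; split => //; first exact: Sch0.
apply/funext => x; rewrite (_ : Fc _ _ = 0) ?add0r// /Fc -[RHS](@int0 R d).
by congr int_Rd; apply/funext => y; rewrite mul0r.
Qed.

Lemma Sch_Fca d (w : 'cV[R]_d -> R) a : Sch w -> Sch (Fca w a).
Proof.
move=> sw; rewrite (_ : Fca w a = fun x => cosd a 0 x * Fc w x + sind a 0 x * Fs w x).
  have [h1 h2] := SG_sincosd a 0.
  by apply: SchD; apply: SchM => //; [exact: Sch_Fc|exact: Sch_Fs].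
by apply/funext => x; rewrite FcaE.
Qed.

Lemma Sch_Fsa d (w : 'cV[R]_d -> R) a : Sch w -> Sch (Fsa w a).
Proof.
move=> sw; rewrite (_ : Fsa w a = fun x => cosd a 0 x * Fs w x + - (sind a 0 x * Fc w x)).
  have [h1 h2] := SG_sincosd a 0.
  by apply: SchD; [|apply: SchN]; apply: SchM => //; [exact: Sch_Fs|exact: Sch_Fc].
by apply/funext => x; rewrite FsaE.
Qed.

Lemma cauchyw_shift (a z : R) : cauchyw (a + z) <= 2 * (1 + a ^+ 2) * cauchyw z.
Proof.
rewrite /cauchyw -[leLHS]mul1r ler_pdivrMr ?ltr_pwDl ?sqr_ge0//.
rewrite mulrAC ler_pdivlMr ?ltr_pwDl ?sqr_ge0// mul1r.
have := sqr_ge0 (2 * a + z); have := sqr_ge0 a; have := sqr_ge0 z; have := sqr_ge0 (a + z).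
move=> h1 h2 h3 h4; have : 0 <= a ^+ 2 * (a + z) ^+ 2 by rewrite mulr_ge0.
have : (2 * a + z) ^+ 2 = 2 * (a + z) ^+ 2 + 2 * a ^+ 2 - z ^+ 2 by ring.
nra.
Qed.

Lemma wt_shift d (a : 'cV[R]_d) : exists2 K, 0 <= K & forall x, wt (a + x) <= K * wt x.
Proof.
exists (\prod_i (2 * (1 + a i 0 ^+ 2))).
  by apply: prodr_ge0 => i _; rewrite mulr_ge0// addr_ge0// sqr_ge0.
move=> x; rewrite /wt -big_split; apply: ler_prod => i _.
by rewrite cauchyw_ge0 mxE cauchyw_shift.
Qed.

Section PoissonStep.
Variable e : nat.
Variables (w : 'cV[R]_e.+1 -> R) (a : 'cV[R]_e.+1) (lam : R).
Hypotheses (sw : Sch w) (l0 : 0 < lam).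
Let a0 : R := a (o0 e) 0.
Let a' : 'cV[R]_e := \col_i a (oS i) 0.

(** Carries the phase in the variables other than the first: integrating them out
    leaves a function of one variable. *)
Definition inner_part (x : 'cV[R]_e) : 'cV[R]_e.+1 -> R :=
  fun z => w z * cosd (consv 0 x) (- dotp x a') z.

Let Sch_inner x : Sch (inner_part x). Proof. exact: Sch_cosd. Qed.

Lemma partial_int_mul (f : 'cV[R]_e.+1 -> R) (g : R -> R) : Sch f ->
  int_Rd (fun z => f z * g (z (o0 e) 0)) =
  Rintegral mu setT (fun t => partial_int f t * g t).
Proof.
move=> sf; rewrite /=; apply: eq_Rintegral => t _.
rewrite mulrC /partial_int -intZ; last exact: Sch_slice.
by congr int_Rd; apply/funext => y; rewrite -/(consv t y) consv0 mulrC.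
Qed.

Lemma aE : a = consv a0 a'.
Proof. by rewrite consvK. Qed.

Lemma Fca_zero x : Fca w a (consv 0 x) = Rintegral mu setT (partial_int (inner_part x)).
Proof. by rewrite /Fca {1}aE dotp_consv mul0r add0r. Qed.

Lemma Fca_pair (k : R) x : Fca w a (consv k x) + Fca w a (consv (- k) x) =
  Rintegral mu setT (fun t => partial_int (inner_part x) t * (2 * cos (k * (t - a0)))).
Proof.
rewrite -(@partial_int_mul (inner_part x) (fun t => 2 * cos (k * (t - a0))))//.
rewrite /Fca -intD; [|exact: Sch_cosd..].
congr int_Rd; apply/funext => z.
have E (s : R) : dotp z (consv s x) - dotp (consv s x) a = s * (z (o0 e) 0 - a0) + (dotp (\col_i z (oS i) 0) x - dotp x a').
  rewrite -{1}(consvK z) {1}aE !dotp_consv.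
    by rewrite opprD addrACA mulrBr [_ * s]mulrC.
have E0 : dotp z (consv 0 x) = dotp (\col_i z (oS i) 0) x.
  by rewrite -{1}(consvK z) dotp_consv mulr0 add0r.
rewrite /inner_part /cosd !E E0 -mulrDr -mulrA; congr (_ * _).
set p := dotp _ _ - dotp _ _; rewrite mulNr; set h := k * _.
by rewrite (cosD h) (cosD (- h)) (cosN h) (sinN h); ring.
Qed.

(** Symmetric partial sums over the first frequency are integrals against the
    Dirichlet kernel. *)
Lemma Fca_box N x : \sum_(k <- zbox N) Fca w a (consv (lam * k%:~R) x) =
  Rintegral mu setT (fun t => partial_int (inner_part x) t * dirichlet N (lam * (t - a0))).
Proof.
have [C C0 HC] := rapid_wt (Sch_rapid (Sch_inner x)).
have s1 := Sch_pd (o0 e) (Sch_inner x).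
rewrite zbox_sum0 mulr0; elim: N => [|N IH].
  by rewrite big_geq// addr0 Fca_zero; apply: eq_Rintegral => t _; rewrite mulr1.
rewrite big_nat_recr//= addrA IH.
have -> : lam * (- N.+1%:Z)%:~R = - (lam * N.+1%:R) by rewrite mulrNz mulrN.
have -> : lam * (N.+1%:Z)%:~R = lam * N.+1%:R by [].
rewrite Fca_pair.
have du (t : R) : is_derive t 1 (partial_int (inner_part x)) (partial_int (pd (o0 e) (inner_part x)) t).
  exact: partial_int_derive.
have Hu t := partial_int_bound t (Sch_inner x) HC.
rewrite -(@mul_bounded_lin R _ _ (C * (2 * atan_sup R) ^+ e) du Hu _ _ (1 + 2 * N%:R + 2)).
- by apply: eq_Rintegral => t _; congr (_ * (_ + _ * cos _)); ring.
- by apply: (@continuous_affine R lam a0 (dirichlet N)); exact: dirichlet_continuous.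
- move=> t; apply: cvgM; first exact: cvg_cst.
  apply: continuous_comp; last exact: continuous_cos.
  by apply: cvgM; [exact: cvg_cst|apply: cvgB; [exact: cvg_id|exact: cvg_cst]].
- by move=> t; apply: (le_trans (dirichlet_bound _ _)); rewrite lerDl.
- move=> t; rewrite normrM (@ger0_norm _ 2)//.
  apply: (@le_trans _ _ 2); last by rewrite lerDr addr_ge0// mulr_ge0.
  by rewrite ler_piMr// ler_norml cos_geN1 cos_le1.
Qed.

Lemma partial_int_inner x t : partial_int (inner_part x) t = Fca (slice w t) a' x.
Proof. by rewrite /partial_int /inner_part slice_cosd. Qed.

End PoissonStep.

Lemma cV0_eq (T : Type) (x y : 'cV[T]_0) : x = y.
Proof. by apply/colP => -[]. Qed.

(** Poisson summation for the lattice lam Z^d and the dual lattice shifted to a,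
    one variable at a time; the joint decay in all the variables makes the
    iterated sums exchangeable. *)
Theorem poisson d (w : 'cV[R]_d -> R) a lam S S' : Sch w -> 0 < lam ->
  has_sum (fun k : 'cV[int]_d => Fca w a (latt lam k)) S ->
  has_sum (fun l : 'cV[int]_d => w (a + latt (2 * pi / lam) l)) S' ->
  lam ^+ d * S = (2 * pi) ^+ d * S'.
Proof.
move=> + l0; elim: d w a S S' => [|e IH] w a S S' sw H1 H2.
  have k0 : 'cV[int]_0 := 0.
  rewrite (has_sum_unique H1 (has_sum_single (k0 := k0) _)); last by move=> k /eqP[]; exact: cV0_eq.
  rewrite (has_sum_unique H2 (has_sum_single (k0 := k0) _)); last by move=> k /eqP[]; exact: cV0_eq.
  rewrite !expr0 !mul1r /Fca /= /cosd /dotp !big_ord0 oppr0 addr0 cos0 mulr1.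
  by congr w; exact: cV0_eq.
set delta := 2 * pi / lam in H2 *.
have d0 : 0 < delta by rewrite divr_gt0// mulr_gt0// pi_gt0.
pose a0 : R := a (o0 e) 0; pose a' : 'cV[R]_e := \col_i a (oS i) 0.
have [C1 C10 HC1] := rapid_wt (Sch_rapid (Sch_Fca a sw)).
have [C2 C20 HC2] := rapid_wt (Sch_rapid sw).
have [C3 C30 HC3] := partial_fourier_decay sw.
have H1' := has_sum_cons H1; have H2' := has_sum_cons H2; rewrite /= in H1' H2'.
have [Kl HKl _] := has_sum_cauchyw l0; have [Kd HKd _] := has_sum_cauchyw d0.
have [Wl HWl _] := has_sum_wt e l0; have [Wd HWd _] := has_sum_wt e d0.
have [Ka Ka0 HKa] := wt_shift a'.
pose c0 := 2 * (1 + a0 ^+ 2).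
have c00 : 0 <= c0 by rewrite mulr_ge0// addr_ge0// sqr_ge0.
(* sums over the first frequency *)
have /choice[s Hs] : forall k : 'cV[int]_e, exists s, has_sum (fun k0 : int => Fca w a (latt lam (consz k0 k))) s.
  move=> k; apply: has_sum_exists (has_sumZ C1 HKl) _ => k0; apply: le_trans (HC1 _) _.
  rewrite ler_wpM2l// latt_consz wt_consv -[leRHS]mulr1 ler_wpM2l ?cauchyw_ge0//.
  rewrite /wt; apply: prodr_ile1 => i _; rewrite cauchyw_ge0; exact: cauchyw_le1.
have HsS : has_sum s S by exact: has_sum_fubini H1' Hs.
pose v (p : int * 'cV[int]_e) := Fca (slice w (a0 + delta * p.1%:~R)) a' (latt lam p.2).
have vb p : `|v p| <= (C3 * c0) * (cauchyw (delta * p.1%:~R) * wt (latt lam p.2)).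
  apply: le_trans (HC3 _ _ _) _.
  rewrite [leRHS](_ : _ = C3 * ((c0 * cauchyw (delta * p.1%:~R)) * wt (latt lam p.2))).
    2: by rewrite !mulrA.
  rewrite ler_wpM2l// ler_wpM2r ?wt_ge0//.
  exact: cauchyw_shift.
have [T HT] : exists T, has_sum v T.
  by apply: has_sum_exists (has_sumZ _ (has_sum_prod (fun k => cauchyw_ge0 _) (fun k => wt_ge0 _) HKd HWl)) vb.
have /choice[r Hr] : forall k, exists r, has_sum (fun l0 : int => v (l0, k)) r.
  move=> k; apply: (has_sum_exists (has_sumZ (C3 * c0 * wt (latt lam k)) HKd)) => j.
  by apply: le_trans (vb _) _; rewrite /= [cauchyw _ * _]mulrC mulrA.
have HrT : has_sum r T by exact: has_sum_fubini HT Hr.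
have sr k : lam * s k = 2 * pi * r k.
  set x := latt lam k.
  have si : Sch (inner_part w a x) by exact: Sch_cosd.
  have s1 := Sch_pd (o0 e) si.
  have [C C0 HC] := rapid_wt (Sch_rapid si); have [D D0 HD] := rapid_wt (Sch_rapid s1).
  have kp : 0 <= (2 * atan_sup R) ^+ e by rewrite exprn_ge0// kap_ge0.
  apply: (@poisson1 R (partial_int (inner_part w a x)) (partial_int (pd (o0 e) (inner_part w a x)))
     ((C + D) * (2 * atan_sup R) ^+ e) lam a0).
  - by move=> t; exact: partial_int_derive.
  - by rewrite mulr_ge0// addr_ge0.
  - move=> t; apply: (le_trans (partial_int_bound t si HC)).
    by rewrite ler_wpM2r ?cauchyw_ge0// ler_wpM2r// lerDl.
  - move=> t; apply: (le_trans (partial_int_bound t s1 HD)).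
    by rewrite ler_wpM2r ?cauchyw_ge0// ler_wpM2r// lerDr.
  - exact: l0.
  - rewrite (_ : (fun N => _) = fun N => \sum_(k0 <- zbox N) Fca w a (latt lam (consz k0 k))).
      exact: has_sum_zbox (Hs k).
    apply/funext => N; rewrite -Fca_box//.
    by apply: eq_bigr => j _; rewrite latt_consz.
  - by have := Hr k; congr has_sum; apply/funext => j; rewrite partial_int_inner.
have ST : lam * S = 2 * pi * T.
  apply: has_sum_unique (has_sumZ lam HsS) _.
  by have := has_sumZ (2 * pi) HrT; congr has_sum; apply/funext => k; rewrite sr.
(* sums over the other frequencies, at a fixed point of the first dual lattice *)
have /choice[q Hq] : forall j, exists q, has_sum (fun k => v (j, k)) q.
  move=> j; apply: (has_sum_exists (has_sumZ (C3 * c0 * cauchyw (delta * j%:~R)) HWl)) => k.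
  by apply: le_trans (vb _) _; rewrite /= mulrA.
have HqT : has_sum q T by exact: has_sum_fubini (has_sum_swap HT) Hq.
have /choice[z Hz] : forall j : int, exists z, has_sum (fun l : 'cV[int]_e => w (a + latt delta (consz j l))) z.
  move=> j; apply: (has_sum_exists (has_sumZ (C2 * Ka) HWd)) => l; apply: le_trans (HC2 _) _.
  rewrite -mulrA ler_wpM2l//; apply: le_trans (HKa _).
  have -> : a + latt delta (consz j l) = consv (a0 + delta * j%:~R) (a' + latt delta l).
    by rewrite latt_consz {1}(aE a) consvD.
  exact: wt_consv_le.
have HzS : has_sum z S' by exact: has_sum_fubini (has_sum_swap H2') Hz.
have qz j : lam ^+ e * q j = (2 * pi) ^+ e * z j.
  apply: (IH (slice w (a0 + delta * j%:~R)) a'); [exact: Sch_slice|exact: Hq|].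
  have := Hz j; congr has_sum; apply/funext => l; rewrite /slice; congr w.
  by rewrite latt_consz {1}(aE a) consvD.
have TS : lam ^+ e * T = (2 * pi) ^+ e * S'.
  apply: has_sum_unique (has_sumZ (lam ^+ e) HqT) _.
  by have := has_sumZ ((2 * pi) ^+ e) HzS; congr has_sum; apply/funext => j; rewrite qz.
by rewrite exprSr -mulrA ST mulrCA TS mulrA -exprS.
Qed.

End Poisson.

(** * Fourier inversion *)

Section RiemannSums.
Variable R : realType.
Notation mu := (@lebesgue_measure R).
Notation kap := (2 * @atan_sup R).

Fixpoint riemann_const (d : nat) : R :=
  if d is e.+1 then kap ^+ e * (2 * (1 + kap)) + (1 + kap) * riemann_const e else 0.

(** In the inner variables the lattice sums approximate the partial integrals; the
    sum of these over the first coordinate is a one-dimensional Riemann sum. *)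
Lemma riemann_sum d (f : 'cV[R]_d -> R) (C lam S : R) : Sch f -> 0 <= C ->
  (forall x, `|f x| <= C * wt x) -> (forall i x, `|pd i f x| <= C * wt x) ->
  0 < lam -> lam <= 1 -> has_sum (fun k : 'cV[int]_d => f (latt lam k)) S ->
  `|int_Rd f - lam ^+ d * S| <= lam * C * riemann_const d.
Proof.
move=> + + + + l0 l1; elim: d f C S => [|e IH] f C S sf C0 Hf Hpd HS_.
  have k0 : 'cV[int]_0 := 0.
  rewrite (has_sum_unique HS_ (has_sum_single (k0 := k0) _)); last by move=> k /eqP[]; exact: cV0_eq.
  by rewrite /= expr0 mul1r (cV0_eq (latt lam k0) 0) subrr normr0 !mulr0.
have [K HK [K0 lK]] := has_sum_cauchyw l0.
have [W HW W0] := has_sum_wt e l0.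
have s1 := Sch_pd (o0 e) sf.
have kp : 0 <= kap ^+ e by rewrite exprn_ge0// kap_ge0.
have slat (k0 : int) (k : 'cV[int]_e) : f (latt lam (consz k0 k)) = slice f (lam * k0%:~R) (latt lam k).
  by rewrite latt_consz.
have H1 := has_sum_swap (has_sum_cons HS_).
have /choice[s Hs] : forall k0 : int, exists s, has_sum (fun k : 'cV[int]_e => f (latt lam (consz k0 k))) s.
  move=> k0; apply: (has_sum_exists (has_sumZ C HW)) => k; apply: le_trans (Hf _) _.
  by rewrite latt_consz ler_wpM2l// wt_consv_le.
have HsS : has_sum s S by exact: has_sum_fubini H1 Hs.
have inner k0 : `|partial_int f (lam * k0%:~R) - lam ^+ e * s k0| <=
    (lam * C * riemann_const e) * cauchyw (lam * k0%:~R).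
  rewrite [leRHS](_ : _ = lam * (C * cauchyw (lam * k0%:~R)) * riemann_const e); last by ring.
  apply: (IH (slice f (lam * k0%:~R)) (C * cauchyw (lam * k0%:~R)) (s k0)).
  - exact: Sch_slice.
  - by rewrite mulr_ge0// cauchyw_ge0.
  - by move=> x; apply: le_trans (Hf _) _; rewrite wt_consv mulrA.
  - move=> i x; rewrite pd_slice; last exact: Sch_pdable.
    by apply: le_trans (Hpd _ _) _; rewrite wt_consv mulrA.
  - by have := Hs k0; congr has_sum; apply/funext => k; rewrite slat.
have Jb t := partial_int_bound t sf Hf.
have Jb' t := partial_int_bound t s1 (Hpd (o0 e)).
have [T HT] : exists T, has_sum (fun k0 : int => partial_int f (lam * k0%:~R)) T.
  by apply: (has_sum_exists (has_sumZ (C * kap ^+ e) HK)) => k0; exact: Jb.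
have h1 : `|T + - lam ^+ e * S| <= lam * C * riemann_const e * K.
  have := has_sum_lin (- lam ^+ e) HsS HT; rewrite addrC => hh.
  apply: has_sum_bound hh (has_sumZ _ HK) _ => k0.
  by rewrite addrC mulNr.
have du (t : R) : is_derive t 1 (partial_int f) (partial_int (pd (o0 e) f) t).
  exact: partial_int_derive.
have Ck : 0 <= C * kap ^+ e by rewrite mulr_ge0.
have h2 := riemann_sum1 du Ck Jb Jb' l0 l1 HT.
have rc n : 0 <= riemann_const n.
  have := kap_ge0 R => k0; elim: n => //= n IHn.
  by rewrite addr_ge0// ?mulr_ge0 ?exprn_ge0// ?addr_ge0// mulr_ge0.
rewrite -/(partial_int f); change (int_Rd f) with (Rintegral mu setT (partial_int f)).
set I := Rintegral _ _ _ in h2 *.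
have -> : I - lam ^+ e.+1 * S = (I - lam * T) + lam * (T + - lam ^+ e * S) by rewrite exprS mulrDr mulNr mulrN -mulrA addrA subrK.
apply: le_trans (ler_normD _ _) _; rewrite /= [leRHS]mulrDr lerD//.
  by apply: (le_trans h2); rewrite le_eqVlt; apply/orP; left; apply/eqP; ring.
rewrite normrM (gtr0_norm l0); apply: le_trans (ler_wpM2l (ltW l0) h1) _.
have -> : lam * (lam * C * riemann_const e * K) = lam * C * ((lam * K) * riemann_const e) by ring.
rewrite ler_wpM2l ?mulr_ge0 ?(ltW l0)// ler_wpM2r//.
by apply: (le_trans lK); rewrite lerD2r.
Qed.

Lemma latt0 d (lam : R) : latt lam (0 : 'cV[int]_d) = 0.
Proof.
rewrite /latt (_ : intR R 0 = 0) ?scaler0//.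
by apply/colP => i; rewrite !mxE.
Qed.

(** A nonzero point of the lattice of step delta has a coordinate of size at least
    delta, and the weight decays quadratically in it. *)
Lemma has_sum_wt_shrink d (f : 'cV[R]_d -> R) a : Sch f -> exists2 K, 0 <= K &
  forall (delta S : R), 1 <= delta ->
    has_sum (fun l : 'cV[int]_d => f (a + latt delta l)) S -> `|S - f a| <= K / delta ^+ 2.
Proof.
move=> sf; have [C C0 HC] := rapid_wt (Sch_rapid sf).
have [Ka Ka0 HKa] := wt_shift a; have [W HW W0] := has_sum_wt d (@ltr01 R).
exists (C * Ka * 2 * W); first by rewrite !mulr_ge0.
move=> delta S d1 H.
have d0 : 0 < delta by apply: lt_le_trans d1.
pose g (l : 'cV[int]_d) : R := if l == 0 then f a else 0.
have Hg : has_sum g (f a).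
  have -> : f a = g 0 by rewrite /g eqxx.
  by apply: has_sum_single => k /negPf kn; rewrite /g kn.
have := has_sum_lin (-1) Hg H; rewrite mulN1r addrC => hh.
have cle (z : int) : cauchyw (delta * z%:~R) <= cauchyw (1 * z%:~R).
  rewrite mul1r /cauchyw lef_pV2 ?posrE ?ltr_pwDl ?sqr_ge0// lerD2l exprMn.
  by apply: ler_peMl; [exact: sqr_ge0|rewrite expr2; nra].
have B := has_sum_bound hh (has_sumZ (C * Ka * (2 / delta ^+ 2)) HW).
have -> : C * Ka * 2 * W / delta ^+ 2 = C * Ka * (2 / delta ^+ 2) * W by ring.
apply: B => l.
rewrite /g; have [->|l_neq0] := eqVneq l 0.
  have -> : a + latt delta 0 = a.
    by rewrite latt0 addr0.
  by rewrite mulN1r addrC subrr normr0 !mulr_ge0 ?invr_ge0 ?sqr_ge0 ?wt_ge0.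
rewrite mulr0 add0r; apply: le_trans (HC _) _.
rewrite -!mulrA ler_wpM2l//; apply: le_trans (HKa _) _; rewrite ler_wpM2l//.
have [i li] : exists i, l i 0 != 0.
  have [/existsP//|/existsPn h] := boolP [exists i, l i 0 != 0].
  case/eqP: l_neq0; apply/colP => i; rewrite mxE.
  by have := h i => /negPn/eqP.
have latE (x : R) j : latt x l j 0 = x * (l j 0)%:~R by rewrite !mxE.
rewrite /wt (bigD1 i)//= [X in _ <= _ * (_ * X)](bigD1 i)//= mulrA mulrA.
apply: ler_pM; [exact: cauchyw_ge0|by apply: prodr_ge0 => j _; exact: cauchyw_ge0| |].
  rewrite !latE mul1r /cauchyw.
  have z1 : 1 <= ((l i 0)%:~R : R) ^+ 2.
    rewrite -rmorphXn /= ler1z.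
    by rewrite -gtz0_ge1 exprn_even_gt0.
  set z := ((l i 0)%:~R : R) in z1 *.
  have d2 : 0 < delta ^+ 2 by rewrite exprn_gt0.
  rewrite -[leLHS]mul1r ler_pdivrMr ?ltr_pwDl ?sqr_ge0// mulrAC ler_pdivlMr ?ltr_pwDl ?sqr_ge0//.
  rewrite mul1r mulrAC ler_pdivlMr// exprMn.
  by have : delta ^+ 2 <= delta ^+ 2 * z ^+ 2 by [rewrite ler_peMr// ltW]; lra.
apply: ler_prod => j _; rewrite cauchyw_ge0 !latE; exact: cle.
Qed.
End RiemannSums.

Section Inversion.
Variable R : realType.
Notation mu := (@lebesgue_measure R).

Lemma Sch_common d (f : 'cV[R]_d -> R) : Sch f -> exists C, [/\ 0 <= C,
  forall x, `|f x| <= C * wt x & forall i x, `|pd i f x| <= C * wt x].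
Proof.
move=> sf; have [C C0 HC] := rapid_wt (Sch_rapid sf).
have /choice[D HD] : forall i, exists D, 0 <= D /\ forall x, `|pd i f x| <= D * wt x.
  by move=> i; have [D D0 h] := rapid_wt (Sch_rapid (Sch_pd i sf)); exists D.
have sD : 0 <= \sum_i D i by apply: sumr_ge0 => i _; case: (HD i).
exists (C + \sum_i D i); split; first exact: addr_ge0.
  by move=> x; apply: le_trans (HC x) _; rewrite ler_wpM2r ?wt_ge0// lerDl.
move=> i x; have [Di h] := HD i; apply: le_trans (h x) _; rewrite ler_wpM2r ?wt_ge0//.
rewrite (bigD1 i)//= addrCA lerDl addr_ge0//; apply: sumr_ge0 => j _; by case: (HD j).
Qed.

Lemma eq_of_inverse_rate (x y M : R) : (forall n : nat, `|x - y| <= M / n.+1%:R) -> x = y.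
Proof.
move=> H; apply/eqP; rewrite -subr_eq0 -normr_le0; apply: le_eps => e e0; rewrite add0r.
have M0 : 0 <= M by have := H 0%N; rewrite divr1; exact: le_trans.
apply: le_trans (H (Num.truncn (M / e))) _.
rewrite ler_pdivrMr ?ltr0n// mulrC -ler_pdivrMr//.
exact/ltW/truncnS_gt.
Qed.

Lemma inv_natS (n : nat) : 0 < n.+1%:R^-1 :> R /\ n.+1%:R^-1 <= 1 :> R.
Proof. by rewrite invr_gt0 ltr0n invf_le1 ?ltr0n// ler1n. Qed.

Lemma has_sum_latt_exists d (f : 'cV[R]_d -> R) lam : Sch f -> 0 < lam ->
  exists S, has_sum (fun k : 'cV[int]_d => f (latt lam k)) S.
Proof.
move=> sf l0; have [C C0 HC] := rapid_wt (Sch_rapid sf).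
by apply: has_sum_dominated l0 _ => k; exact: HC.
Qed.

Lemma has_sum_latt_shift_exists d (f : 'cV[R]_d -> R) a lam : Sch f -> 0 < lam ->
  exists S, has_sum (fun k : 'cV[int]_d => f (a + latt lam k)) S.
Proof.
move=> sf l0; have [C C0 HC] := rapid_wt (Sch_rapid sf).
have [K K0 HK] := wt_shift a.
apply: (@has_sum_dominated _ _ _ _ (C * K) l0) => k; apply: le_trans (HC _) _.
by rewrite -mulrA ler_wpM2l.
Qed.

(** Fourier inversion: Riemann sums of step 1/(n+1) turn into sums of w over the
    lattice of step 2 pi (n+1), where only the origin survives in the limit. *)
Lemma inversion_cos d (w : 'cV[R]_d -> R) a : Sch w ->
  int_Rd (Fca w a) = (2 * pi) ^+ d * w a.
Proof.
move=> sw; have sg := Sch_Fca a sw.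
have [C [C0 h1 h2]] := Sch_common sg; have [K K0 HK] := has_sum_wt_shrink a sw.
have pp : 0 < 2 * pi :> R by rewrite mulr_gt0// pi_gt0.
apply: (@eq_of_inverse_rate _ _ (C * riemann_const R d + (2 * pi) ^+ d * K)) => n.
have [l0 l1] := inv_natS n; set lam := n.+1%:R^-1 in l0 l1 *.
have n0 : 0 < n.+1%:R :> R by rewrite ltr0n.
have [S HS_] := has_sum_latt_exists sg l0.
have d0 : 0 < 2 * pi / lam by rewrite divr_gt0.
have [S' HS'] := has_sum_latt_shift_exists a sw d0.
have P := poisson sw l0 HS_ HS'.
have dn : n.+1%:R <= 2 * pi / lam.
  by rewrite /lam invrK ler_peMl ?(ltW n0)//; have := @pi_ge2 R; lra.
have d1 : 1 <= 2 * pi / lam by apply: le_trans dn; rewrite ler1n.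
have b1 := riemann_sum sg C0 h1 h2 l0 l1 HS_.
have b2 := HK _ _ d1 HS'.
rewrite P in b1.
have -> : int_Rd (Fca w a) - (2 * pi) ^+ d * w a =
  (int_Rd (Fca w a) - (2 * pi) ^+ d * S') + (2 * pi) ^+ d * (S' - w a) by ring.
apply: le_trans (ler_normD _ _) _; rewrite [leRHS]mulrDl lerD//.
  by apply: (le_trans b1); rewrite -mulrA [leLHS]mulrC.
rewrite normrM gtr0_norm ?exprn_gt0// -mulrA ler_wpM2l ?exprn_ge0 ?(ltW pp)//.
apply: (le_trans b2); rewrite ler_wpM2l// lef_pV2 ?posrE ?exprn_gt0//.
by apply: (le_trans dn); rewrite expr2 ler_peMl// ltW.
Qed.

Lemma lattN d (lam : R) (k : 'cV[int]_d) : latt lam (- k) = - latt lam k.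
Proof. by apply/colP => i; rewrite !mxE mulrNz mulrN. Qed.

Lemma dotpN d (x y : 'cV[R]_d) : dotp (- x) y = - dotp x y.
Proof. by rewrite -scaleN1r dotpZ mulN1r. Qed.

Lemma dotpNr d (x y : 'cV[R]_d) : dotp x (- y) = - dotp x y.
Proof. by rewrite dotpC dotpN dotpC. Qed.

(** The oddness of the sine transform makes its lattice sums vanish. *)
Lemma Fsa_odd d (w : 'cV[R]_d -> R) a x : Sch w -> Fsa w a (- x) = - Fsa w a x.
Proof.
move=> sw; rewrite -[RHS]mulN1r /Fsa -intZ; last exact: Sch_sind.
congr int_Rd; apply/funext => y.
by rewrite /sind dotpN dotpNr -opprD sinN mulrN mulN1r.
Qed.

Lemma has_sum_Fsa0 d (w : 'cV[R]_d -> R) a lam S : Sch w ->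
  has_sum (fun k : 'cV[int]_d => Fsa w a (latt lam k)) S -> S = 0.
Proof.
move=> sw; apply: (@has_sum_odd R _ (fun k => - k)); first exact: opprK.
by move=> k; rewrite lattN Fsa_odd.
Qed.

Lemma inversion_sin d (w : 'cV[R]_d -> R) a : Sch w -> int_Rd (Fsa w a) = 0.
Proof.
move=> sw; have sg := Sch_Fsa a sw; have [C [C0 h1 h2]] := Sch_common sg.
apply: (@eq_of_inverse_rate _ _ (C * riemann_const R d)) => n.
have [l0 l1] := inv_natS n.
have [S HS_] := has_sum_latt_exists sg l0.
have := riemann_sum sg C0 h1 h2 l0 l1 HS_.
rewrite (has_sum_Fsa0 sw HS_) mulr0 => /le_trans; apply.
by rewrite -mulrA [leLHS]mulrC.
Qed.

End Inversion.

Section ComplexInversion.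
Variables (R : realType) (d : nat).
Local Notation V := 'cV[R]_d.
Local Open Scope complex_scope.
Implicit Types (f g w : V -> R[i]).

Lemma fourier_modulated w a x : CSch w -> fourier w x * expi (dotp x a) =
  (Fca (re w) a x + Fsa (im w) a x) +i* (Fca (im w) a x - Fsa (re w) a x).
Proof.
move=> Hw; have [s1 s2] := Hw; rewrite fourierE// !FcaE// !FsaE// /expi /cosd /sind !addr0.
by apply: c_eq => /=; ring.
Qed.

Lemma fourier_inversion w a : CSch w ->
  cint (fun x => fourier w x * expi (dotp x a)) = ((2 * pi) ^+ d)%:C * w a.
Proof.
move=> Hw; have [s1 s2] := Hw.
have E1 : re (fun x => fourier w x * expi (dotp x a)) = fun x => Fca (re w) a x + Fsa (im w) a x.
  by apply/funext => x; exact: (congr1 (@complex.Re R) (fourier_modulated a x Hw)).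
have E2 : im (fun x => fourier w x * expi (dotp x a)) = fun x => Fca (im w) a x + (- Fsa (re w) a x).
  by apply/funext => x; exact: (congr1 (@complex.Im R) (fourier_modulated a x Hw)).
rewrite /cint E1 E2.
rewrite intD; [|exact: Sch_Fca|exact: Sch_Fsa].
rewrite intD; [|exact: Sch_Fca|by apply: SchN; exact: Sch_Fsa].
rewrite (_ : (fun x => - Fsa (re w) a x) = fun x => -1 * Fsa (re w) a x); last first.
  by apply/funext => x; rewrite mulN1r.
rewrite intZ; last exact: Sch_Fsa.
rewrite !inversion_cos// !inversion_sin// mulr0 !addr0 /re /im.
by case: (w a) => p q; apply: c_eq => /=; ring.
Qed.

Definition has_csum (u : 'cV[int]_d -> R[i]) (l : R[i]) : Prop :=
  has_sum (fun k => complex.Re (u k)) (complex.Re l) /\ has_sum (fun k => complex.Im (u k)) (complex.Im l).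

Lemma has_csumD u v l l' : has_csum u l -> has_csum v l' -> has_csum (fun k => u k + v k) (l + l').
Proof.
move=> [a b] [a' b']; split.
  rewrite (_ : complex.Re (l + l') = complex.Re l + complex.Re l'); last by case: l {a b}; case: l' {a' b'}.
  by have := has_sumD a a'; congr has_sum; apply/funext => k; case: (u k); case: (v k).
rewrite (_ : complex.Im (l + l') = complex.Im l + complex.Im l'); last by case: l {a b}; case: l' {a' b'}.
by have := has_sumD b b'; congr has_sum; apply/funext => k; case: (u k); case: (v k).
Qed.

Lemma has_csumZ c u l : has_csum u l -> has_csum (fun k => c * u k) (c * l).
Proof.
case: c => c c' [a b]; split.
  rewrite (_ : complex.Re _ = c * complex.Re l + (- c') * complex.Im l); last first.
    by case: l {a b} => ? ? /=; rewrite mulNr.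
  by have := has_sum_lin c a (has_sumZ (- c') b); congr has_sum; apply/funext => k; case: (u k) => ? ? /=; rewrite mulNr.
rewrite (_ : complex.Im _ = c * complex.Im l + c' * complex.Re l); last first.
  by case: l {a b} => ? ?.
by have := has_sum_lin c b (has_sumZ c' a); congr has_sum; apply/funext => k; case: (u k) => ? ? /=.
Qed.

Lemma has_csum0 : has_csum (fun _ => 0) 0.
Proof. by split; exact: has_sum0. Qed.

Lemma has_csum_sum (I : Type) (r : seq I) (P : pred I) (u : I -> 'cV[int]_d -> R[i]) (l : I -> R[i]) :
  (forall i, P i -> has_csum (u i) (l i)) ->
  has_csum (fun k => \sum_(i <- r | P i) u i k) (\sum_(i <- r | P i) l i).
Proof.
move=> H; elim: r => [|i r IH].
  rewrite big_nil (_ : (fun k => _) = fun _ => 0); first exact: has_csum0.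
  by apply/funext => k; rewrite big_nil.
rewrite big_cons (_ : (fun k => _) =
  fun k => if P i then u i k + \sum_(i <- r | P i) u i k else \sum_(i <- r | P i) u i k); last first.
  by apply/funext => k; rewrite big_cons.
by case: ifP => Pi //; apply: has_csumD => //; exact: H.
Qed.

Lemma has_csum_unconditional u l : has_csum u l -> unconditional_sum u l.
Proof.
move=> [a b] e e0; have e3 : 0 < e / 3 by rewrite divr_gt0.
have [K1 h1] := a _ e3; have [K2 h2] := b _ e3.
exists (K1 `|` K2)%fset => K KK.
have {}h1 := h1 K (fsubset_trans (fsubsetUl _ _) KK).
have {}h2 := h2 K (fsubset_trans (fsubsetUr _ _) KK).
have Re_sum : complex.Re (\sum_(k <- K) u k) = \sum_(k <- K) complex.Re (u k).
  by apply: (big_morph (fun z : R[i] => complex.Re z)) => // -[? ?] [? ?].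
have Im_sum : complex.Im (\sum_(k <- K) u k) = \sum_(k <- K) complex.Im (u k).
  by apply: (big_morph (fun z : R[i] => complex.Im z)) => // -[? ?] [? ?].
apply: le_lt_trans (normc_le_ReIm _) _.
have -> : complex.Re (\sum_(k <- K) u k - l) = \sum_(k <- K) complex.Re (u k) - complex.Re l.
  by rewrite -Re_sum; case: (\sum_(k <- K) u k) => ? ?; case: l {a b h1 h2}.
have -> : complex.Im (\sum_(k <- K) u k - l) = \sum_(k <- K) complex.Im (u k) - complex.Im l.
  by rewrite -Im_sum; case: (\sum_(k <- K) u k) => ? ?; case: l {a b h1 h2 Re_sum Im_sum}.
lra.
Qed.

Lemma latt1 (k : 'cV[int]_d) : latt 1 k = intR R k.
Proof. exact: scale1r. Qed.

(** Only the origin contributes to the dual side of Poisson summation. *)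
Lemma poisson_vanishing w : CSch w ->
  (forall k : 'cV[int]_d, k != 0 -> w ((2 * pi) *: intR R k) = 0) ->
  has_csum (fun k => fourier w (intR R k)) (((2 * pi) ^+ d)%:C * w 0).
Proof.
move=> Hw H; have [s1 s2] := Hw.
have main (v : V -> R) : Sch v -> (forall k : 'cV[int]_d, k != 0 -> v ((2 * pi) *: intR R k) = 0) ->
    has_sum (fun k : 'cV[int]_d => Fca v 0 (latt 1 k)) ((2 * pi) ^+ d * v 0) /\
    has_sum (fun k : 'cV[int]_d => Fsa v 0 (latt 1 k)) 0.
  move=> sv Hv.
  have [S HS_] := has_sum_latt_exists (Sch_Fca 0 sv) ltr01.
  have [T HT] := has_sum_latt_exists (Sch_Fsa 0 sv) ltr01.
  have vE (x : V) : 0 + x = x by rewrite add0r.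
  have HS' : has_sum (fun l : 'cV[int]_d => v (0 + latt (2 * pi / 1) l)) (v 0).
    have -> : v 0 = (fun l : 'cV[int]_d => v (0 + latt (2 * pi / 1) l)) 0.
      by rewrite latt0 add0r.
    apply: has_sum_single => k k0; rewrite vE divr1; exact: Hv.
  have := poisson sv ltr01 HS_ HS'; rewrite expr1n mul1r => <-.
  by split => //; rewrite -(has_sum_Fsa0 sv HT).
have fE k : fourier w (intR R k) = (Fca (re w) 0 (latt 1 k) + Fsa (im w) 0 (latt 1 k)) +i*
    (Fca (im w) 0 (latt 1 k) - Fsa (re w) 0 (latt 1 k)).
  rewrite -fourier_modulated// latt1 (_ : dotp _ 0 = 0) ?expi0 ?mulr1//.
  by rewrite -(scale0r (0 : V)) dotpZr mul0r.
have [] := main (re w) s1; first by move=> k /H; rewrite /re => ->.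
have [] := main (im w) s2; first by move=> k /H; rewrite /im => ->.
move=> a1 a2 b1 b2; split.
  rewrite (_ : complex.Re _ = (2 * pi) ^+ d * re w 0 + 0); last first.
    by rewrite /re; case: (w 0) => p q /=; ring.
  by have := has_sumD b1 a2; congr has_sum; apply/funext => k; rewrite fE.
rewrite (_ : complex.Im _ = -1 * 0 + (2 * pi) ^+ d * im w 0); last first.
  by rewrite /im; case: (w 0) => p q /=; ring.
by have := has_sum_lin (-1) b2 a1; congr has_sum; apply/funext => k; rewrite fE /= mulN1r addrC.
Qed.

Definition conjf f : V -> R[i] := fun x => re f x -i* im f x.

Lemma CSch_conjf f : CSch f -> CSch (conjf f).
Proof. by move=> [a b]; split => //; exact: SchN. Qed.

(** Inversion says that conjugation after a transform, applied twice, is the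
    identity up to the factor (2 pi)^d. *)
Lemma fourier_surjective f : CSch f -> exists2 g, CSch g & f = fourier g.
Proof.
move=> Hf; have Hc := CSch_conjf Hf; have HF := CSch_fourier Hc.
set F := fourier (conjf f) in HF.
pose c : R := ((2 * pi) ^+ d)^-1.
have c0 : (2 * pi) ^+ d * c = 1.
  by rewrite mulfV// expf_neq0// mulf_neq0// ?pnatr_eq0// gt_eqF ?pi_gt0.
have HG := CSch_conjf HF.
exists (fun x => c%:C * conjf F x); first exact: CSchZ.
apply/funext => a.
have := fourier_inversion a Hc; rewrite -/F => inv.
have HM : CSch (fun x => F x * expi (dotp x a)).
  rewrite (_ : (fun x => _) = fun x => expi (dotp x a + 0) * F x).
    by apply: CSchM => //; exact: CSG_expi.
  by apply/funext => x; rewrite addr0 mulrC.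
have [m1 m2] := HM.
have E : (fun x => c%:C * conjf F x * expi (- dotp a x)) =
    fun x => c%:C * conjf (fun x => F x * expi (dotp x a)) x.
  apply/funext => x; rewrite -mulrA; congr (_ * _).
  rewrite /conjf /re /im dotpC /expi cosN sinN; case: (F x) => p q /=.
  by apply: c_eq => /=; ring.
rewrite /fourier E cintZ; last exact: CSch_conjf.
have -> : cint (conjf (fun x => F x * expi (dotp x a))) =
    complex.Re (cint (fun x => F x * expi (dotp x a))) -i* complex.Im (cint (fun x => F x * expi (dotp x a))).
  rewrite /cint /=; apply: c_eq => //=.
  rewrite -mulN1r -intZ//; congr int_Rd; apply/funext => x.
  by rewrite mulN1r.
rewrite inv /conjf /re /im; move: ((2 * pi) ^+ d) c0 => k c0; case: (f a) => p q; apply: c_eq => /=.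
  by transitivity (k * c * p); [rewrite c0 mul1r|ring].
by transitivity (k * c * q); [rewrite c0 mul1r|ring].
Qed.

End ComplexInversion.

Section TestFunctions.
Variables (R : realType) (d : nat).
Local Notation V := 'cV[R]_d.

Lemma continuous_trmx : continuous (fun v : 'rV[R]_d => v^T : V).
Proof.
move=> v; apply/(@cvgrPdist_le R V _ (nbhs v) (nbhs_filter v)) => e e0.
apply: filterS (nbhsx_ballx v e e0) => y.
rewrite -ball_normE /ball_ /= => /ltW vy; apply: le_trans vy.
apply: normv_le => // i; rewrite !mxE.
have := coord_le (v - y)^T i; rewrite !mxE => /le_trans; apply.
rewrite [leLHS]/Num.Def.normr [leRHS]/Num.Def.normr /= !mx_normrE.
apply: bigmax_le => [|[j k] _ /=].
  by apply: bigmax_ge_id.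
by rewrite !mxE; apply/bigmax_geP; right; exists (k, j); rewrite // !mxE.
Qed.

Lemma continuous_bounded_on_ball (g : V -> R) r : continuous g -> 0 <= r ->
  exists C, forall x, `|x| <= r -> `|g x| <= C.
Proof.
move=> cg r0; pose A : set 'rV[R]_d := [set v | forall i, `[- r, r]%classic (v ord0 i)].
have cA : compact A.
  by apply: (@rV_compact _ _ (fun=> `[- r, r]%classic)) => _; exact: segment_compact.
have A0 : A !=set0.
  by exists 0 => i; rewrite /= mxE in_itv/= oppr_le0 r0.
have ch : {within A, continuous (fun v : 'rV[R]_d => `|g v^T|)}.
  apply: continuous_subspaceT => v.
  have h : g u^T @[u --> v] --> g v^T.
    exact: (@cvg_comp _ _ _ (fun v : 'rV[R]_d => v^T : V) g _ _ _ (@continuous_trmx v) (cg v^T)).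
  exact: (cvg_norm h).
have [c _ hc] := EVT_max_rV A0 cA ch.
exists `|g c^T| => x xr; have := hc x^T; rewrite trmxK; apply.
by rewrite inE => i; rewrite /= mxE in_itv/= -ler_norml (le_trans (coord_le _ _)).
Qed.

(** A continuous derivative is bounded on the ball that contains the support. *)
Lemma test_function_CSch (f : V -> R[i]) : test_function f -> CSch f.
Proof.
move=> [sm [r0 H0]].
pose r := `|r0|.
have H x : r < `|x| -> f x = 0 by move=> h; apply: H0; apply: le_lt_trans h; exact: ler_norm.
suff main (g : V -> R) : (forall s, continuous (pds s g) /\ pdable (pds s g)) ->
    (forall x, r < `|x| -> g x = 0) -> Sch g.
  split; apply: main.
  - move=> s; have [c1 c2 c3] := sm s; rewrite -re_pderivs; split => // i x.
    by case: (c3 i x).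
  - by move=> x /H; rewrite /re => ->.
  - move=> s; have [c1 c2 c3] := sm s; rewrite -im_pderivs; split => // i x.
    by case: (c3 i x).
  - by move=> x /H; rewrite /im => ->.
move=> sg Hg.
have van s : forall x, r < `|x| -> pds s g x = 0.
  elim: s => [|i s IH] x rx; first exact: Hg.
  rewrite /= pdE.
  have -> : 'D_(basis_vec R i) (pds s g) x = 'D_(basis_vec R i) (cst 0) x.
    apply: near_eq_derive.
    have e0 : 0 < `|x| - r by rewrite subr_gt0.
    apply: filterS (nbhsx_ballx x _ e0) => y.
    rewrite -ball_normE /ball_ /= => xy; apply: IH.
    have := ler_normD (x - y) y; rewrite subrK; lra.
  exact: derive_cst.
split=> s; have [cs ps] := sg s; split => // N.
have [C HC] := continuous_bounded_on_ball cs (normr_ge0 r0).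
exists ((1 + r) ^+ N * `|C|) => x.
have [xr|rx] := leP `|x| r.
  apply: ler_pM => //; last by apply: (le_trans (HC x xr)); exact: ler_norm.
  by apply: lerXn2r; rewrite ?nnegrE ?addr_ge0 ?normr_ge0// lerD2l.
by rewrite van// normr0 mulr0 mulr_ge0// exprn_ge0// addr_ge0// normr_ge0.
Qed.

End TestFunctions.

(** * Orders of vanishing, series and trigonometric polynomials *)

Section Leibniz.
Variables (R : realType) (d : nat).
Local Notation V := 'cV[R]_d.
Implicit Types (f g : V -> R) (s t : seq 'I_d) (x : V).

(** A derivative of order n of a product has 2^n terms. *)
Lemma leibniz_bound x s f g (a b : R) : SG f -> SG g -> 0 <= a -> 0 <= b ->
  (forall t, (size t <= size s)%N -> `|pds t f x| <= a) ->
  (forall t, (size t <= size s)%N -> `|pds t g x| <= b) ->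
  `|pds s (fun y => f y * g y) x| <= 2 ^+ size s * (a * b).
Proof.
move=> + + a0 b0; elim/last_ind: s f g => [|s i IH] f g sf sg Ha Hb.
  by rewrite expr0 mul1r normrM; apply: ler_pM => //; [apply: (Ha [::])|apply: (Hb [::])].
have f1 := SG_pd i sf; have g1 := SG_pd i sg.
rewrite size_rcons in Ha Hb *.
rewrite pds_rcons pdM; [|exact: SG_pdable..].
rewrite pdsD; [|exact: SGM..].
apply: le_trans (ler_normD _ _) _; rewrite exprS mulrDl mul1r mulrDl.
have Ha' t : (size t <= size s)%N -> `|pds t f x| <= a by move=> h; apply: Ha; exact: leqW.
have Hb' t : (size t <= size s)%N -> `|pds t g x| <= b by move=> h; apply: Hb; exact: leqW.
apply: lerD; apply: IH => // t ts; rewrite -pds_rcons; [apply: Hb|apply: Ha]; by rewrite size_rcons.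
Qed.

Definition vanishes N f x := forall s, (size s < N)%N -> pds s f x = 0.

Lemma vanishes_pd N f x i : vanishes N f x -> vanishes N.-1 (pd i f) x.
Proof.
move=> H s sN; rewrite -pds_rcons; apply: H; rewrite size_rcons.
by case: N sN.
Qed.

(** Each term of the Leibniz formula contains a factor that vanishes. *)
Lemma vanishesM a b f g x : SG f -> SG g -> vanishes a f x -> vanishes b g x ->
  vanishes (a + b) (fun y => f y * g y) x.
Proof.
move=> sf sg Hf Hg s; elim/last_ind: s a b f g sf sg Hf Hg => [|s i IH] a b f g sf sg Hf Hg.
  rewrite [size _]/= [pds _ _]/= => ab; case: a Hf ab => [_ b0|a Hf _].
    by have := Hg [::] b0; rewrite /= => ->; rewrite mulr0.
  by have := Hf [::] (ltn0Sn _); rewrite /= => ->; rewrite mul0r.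
rewrite size_rcons => sab; have f1 := SG_pd i sf; have g1 := SG_pd i sg.
rewrite pds_rcons pdM; [|exact: SG_pdable..].
rewrite pdsD; [|exact: SGM..].
rewrite (IH a b.-1 f (pd i g))//; [|exact: vanishes_pd|by lia].
by rewrite (IH a.-1 b (pd i f) g)//; [rewrite addr0|exact: vanishes_pd|lia].
Qed.

Fixpoint powf f (m : nat) : V -> R := if m is n.+1 then fun x => f x * powf f n x else fun=> 1.

Lemma powfE f m x : powf f m x = f x ^+ m.
Proof. by elim: m => [|m IH] /=; rewrite ?expr0// exprS IH. Qed.

Lemma SG_powf f m : SG f -> SG (powf f m).
Proof. by move=> sf; elim: m => [|m IH] /=; [exact: SG_cst|exact: SGM]. Qed.

Lemma vanishes_powf N f m x : SG f -> vanishes N f x -> vanishes (m * N) (powf f m) x.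
Proof.
move=> sf H; elim: m => [|m IH] //.
by rewrite mulSn; apply: vanishesM => //; exact: SG_powf.
Qed.

(** A zero is a minimum, so the gradient vanishes there. *)
Lemma nonneg_zero_vanishes f x : SG f -> (forall y, 0 <= f y) -> f x = 0 -> vanishes 2 f x.
Proof.
move=> sf f0 fx [|i [|j s]] // _; rewrite /=.
have D (t : R) : is_derive t 1 (fun t : R => f (x + t *: basis_vec R i)) (pd i f (x + t *: basis_vec R i)).
  exact: (proj1 (is_derive_line f x (basis_vec R i) t _) (pdP i _ (SG_pdable sf))).
have := @derive1_at_min R (fun t : R => f (x + t *: basis_vec R i)) (-1) 1 0 => h.
have : is_derive (0 : R) 1 (fun t : R => f (x + t *: basis_vec R i)) 0.
  apply: h.
  - by apply: (@le_trans _ _ 0); rewrite ?lerN10 ?ler01.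
  - by move=> t _; exact: (@ex_derive _ _ _ _ _ _ _ (D t)).
  - by rewrite in_itv/= ltrN10 ltr01.
  - by move=> t _; rewrite scale0r addr0 fx.
move=> [_ E1]; have [_ E2] := D 0; rewrite scale0r addr0 in E2.
by rewrite -E2 E1.
Qed.

End Leibniz.

Section Series.
Variable R : realType.

Lemma has_sum_geometric (q : R) : 0 <= q -> q < 1 -> exists S, has_sum (fun n : nat => q ^+ n) S.
Proof.
move=> q0 q1.
have [||S HS_ _] := @has_sum_exists_ge0 R _ (fun n : nat => q ^+ n) (1 - q)^-1.
- by move=> n; exact: exprn_ge0.
- move=> K; pose N := (\max_(k <- K) k).+1.
  have KN : (K `<=` [fset k in iota 0 N])%fset.
    apply/fsubsetP => k kK; rewrite in_fset; change (k \in iota 0 N).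
    by rewrite mem_iota /= add0n ltnS; exact: leq_bigmax_seq.
  apply: le_trans (sum_fset_le _ KN) _; first by move=> n; exact: exprn_ge0.
  have -> : \sum_(k <- [fset k in iota 0 N]%fset) q ^+ k = \sum_(0 <= k < N) q ^+ k.
    have : uniq (iota 0 N) by exact: iota_uniq.
    rewrite /index_iota subn0; move: (iota 0 N) => s us.
    by rewrite eq_big_imfset//= big_map undup_id.
  rewrite big_mkord -[leRHS]mul1r ler_pdivlMr ?subr_gt0//.
  by have := subrX1 q N; have := exprn_ge0 N q0; lra.
by exists S.
Qed.

Lemma has_sum_partial (u : nat -> R) S : has_sum u S -> (fun n => \sum_(0 <= k < n) u k) @ \oo --> S.
Proof.
move=> H; apply/cvgrPdist_le => e e0; have [K0 h] := H e e0.
exists (\max_(k <- K0) k).+1 => // N /= KN; rewrite distrC.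
have := h [fset k in iota 0 N]%fset.
have -> : \sum_(k <- [fset k in iota 0 N]%fset) u k = \sum_(0 <= k < N) u k.
  have : uniq (iota 0 N) by exact: iota_uniq.
  rewrite /index_iota subn0; move: (iota 0 N) => s us.
  by rewrite eq_big_imfset//= big_map undup_id.
apply; apply/fsubsetP => k kK; rewrite in_fset; change (k \in iota 0 N).
rewrite mem_iota /= add0n; apply: leq_trans KN; rewrite ltnS; exact: leq_bigmax_seq.
Qed.

Variable d : nat.
Local Notation V := 'cV[R]_d.

Definition geometric_bounds (q : R) (Delta : nat -> V -> R) :=
  (forall n, SG (Delta n)) /\ forall s, exists C p, 0 <= C /\
    forall n x, `|pds s (Delta n) x| <= C * (1 + `|x|) ^+ p * q ^+ n.

(** A series whose terms have all their derivatives bounded by a fixed power of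
    1 + |x| times a geometric sequence is differentiated term by term: the second
    derivatives of the terms bound the Taylor remainders, which can be summed. *)
Lemma SG_series (q : R) (Delta : nat -> V -> R) (h : V -> R) : 0 <= q -> q < 1 ->
  geometric_bounds q Delta -> (forall x, has_sum (fun n => Delta n x) (h x)) -> SG h.
Proof.
move=> q0 q1 gD hD; have [T HT] := has_sum_geometric q0 q1.
apply: (@SG_coind _ _ (fun h => exists2 Delta, geometric_bounds q Delta &
  forall x, has_sum (fun n => Delta n x) (h x))); last by exists Delta.
move=> {h Delta hD gD} h [Delta [sD gD] hD]; split.
  have [C [p [C0 HC]]] := gD [::].
  exists p, (C * T) => x; rewrite mulrAC.
  exact: has_sum_bound (hD x) (has_sumZ _ HT) (fun n => HC n x).
move=> i.
have gD' : geometric_bounds q (fun n => pd i (Delta n)).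
  split; first by move=> n; exact: SG_pd.
  by move=> s; have [C [p [C0 H]]] := gD (rcons s i); exists C, p; split=> // n x; rewrite -pds_rcons.
have /choice[h' Hh'] : forall x, exists l, has_sum (fun n => pd i (Delta n) x) l.
  move=> x; have [C [p [C0 HC]]] := gD [:: i].
  by apply: (has_sum_exists (has_sumZ (C * (1 + `|x|) ^+ p) HT)) => n; exact: HC.
have dh x : is_derive x (basis_vec R i) h (h' x).
  have [C [p [C0 HC]]] := gD [:: i; i].
  apply: (@is_derive_quad _ _ _ _ _ _ (C * (1 + (`|x| + 1)) ^+ p * T)) => t t1.
  have H1 := has_sum_lin (-1) (hD x) (hD (x + t *: basis_vec R i)).
  have H2 := has_sum_lin (- t) (Hh' x) H1.
  have -> : h (x + t *: basis_vec R i) - h x - t * h' x =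
    - t * h' x + (-1 * h x + h (x + t *: basis_vec R i)) by ring.
  rewrite mulrAC; apply: has_sum_bound H2 (has_sumZ (C * (1 + (`|x| + 1)) ^+ p * t ^+ 2) HT) _ => n.
  have D1 (s : R) := proj1 (is_derive_line (Delta n) x (basis_vec R i) s _)
     (pdP i (x + s *: basis_vec R i) (SG_pdable (sD n))).
  have D2 (s : R) := proj1 (is_derive_line (pd i (Delta n)) x (basis_vec R i) s _)
     (pdP i (x + s *: basis_vec R i) (SG_pdable (SG_pd i (sD n)))).
  have := @taylor2 R _ _ _ 0 t (C * (1 + (`|x| + 1)) ^+ p * q ^+ n) D1 D2.
  rewrite !add0r scale0r addr0 [X in _ -> _ <= X]mulrAC => TT.
  have -> : - t * pd i (Delta n) x + (-1 * Delta n x + Delta n (x + t *: basis_vec R i)) =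
    Delta n (x + t *: basis_vec R i) - Delta n x - t * pd i (Delta n) x by ring.
  apply: TT => c /andP[c0 c1]; rewrite add0r.
  have := HC n (x + (c * t) *: basis_vec R i); rewrite /= => /le_trans; apply.
  rewrite ler_wpM2r ?exprn_ge0// ler_wpM2l//; apply: lerXn2r; rewrite ?nnegrE ?addr_ge0//.
  rewrite lerD2l (le_trans (ler_normD _ _))// lerD2l; apply: normv_le => // j.
  rewrite !mxE eqxx andbT normrM normrM (ger0_norm c0).
  have : `|(j == i)%:R| <= 1 :> R by case: (j == i); rewrite ?normr1 ?normr0.
  have : c * `|t| <= 1 by rewrite mulr_ile1.
  by move=> e1 e2; rewrite mulr_ile1// mulr_ge0.
split; first by move=> x; exact: (@ex_derive _ _ _ _ _ _ _ (dh x)).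
exists (fun n => pd i (Delta n)) => // x.
by rewrite (pd_val (dh x)).
Qed.

End Series.

Section Trigonometric.
Variables (R : realType) (d : nat).
Local Notation V := 'cV[R]_d.

(** Trigonometric polynomials, given by their syntax: estimates that are uniform
    under linear substitutions follow by induction. *)
Inductive trig : (V -> R) -> Prop :=
| trig_cst c : trig (fun=> c)
| trig_sin i c : trig (fun x => sin (x i 0 + c))
| trig_cos i c : trig (fun x => cos (x i 0 + c))
| trig_add f g of trig f & trig g : trig (fun x => f x + g x)
| trig_mul f g of trig f & trig g : trig (fun x => f x * g x).

Lemma trig_scale (c : R) f : trig f -> trig (fun x => c * f x).
Proof. by move=> tf; apply: trig_mul => //; exact: trig_cst. Qed.

Lemma trig_sum (I : Type) (r : seq I) (P : pred I) (f : I -> V -> R) :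
  (forall i, P i -> trig (f i)) -> trig (fun x => \sum_(i <- r | P i) f i x).
Proof.
move=> tf; elim: r => [|i r IH].
  by rewrite (_ : (fun x => _) = fun=> 0); [exact: trig_cst|apply/funext => x; rewrite big_nil].
rewrite (_ : (fun x => _) = if P i then fun x => f i x + \sum_(j <- r | P j) f j x
    else fun x => \sum_(j <- r | P j) f j x).
  by case: ifP => Pi //; apply: trig_add => //; exact: tf.
by apply/funext => x; rewrite big_cons; case: ifP.
Qed.

Lemma trig_prod (I : Type) (r : seq I) (P : pred I) (f : I -> V -> R) :
  (forall i, P i -> trig (f i)) -> trig (fun x => \prod_(i <- r | P i) f i x).
Proof.
move=> tf; elim: r => [|i r IH].
  by rewrite (_ : (fun x => _) = fun=> 1); [exact: trig_cst|apply/funext => x; rewrite big_nil].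
rewrite (_ : (fun x => _) = if P i then fun x => f i x * \prod_(j <- r | P j) f j x
    else fun x => \prod_(j <- r | P j) f j x).
  by case: ifP => Pi //; apply: trig_mul => //; exact: tf.
by apply/funext => x; rewrite big_cons; case: ifP.
Qed.

Lemma trig_shift f (a : V) : trig f -> trig (fun x => f (x + a)).
Proof.
elim=> {f}; [by move=> c; exact: trig_cst| | |by move=> *; exact: trig_add|by move=> *; exact: trig_mul].
  move=> i c; rewrite (_ : (fun x => _) = fun x : V => sin (x i 0 + (a i 0 + c))); first exact: trig_sin.
  by apply/funext => x; rewrite mxE addrA.
move=> i c; rewrite (_ : (fun x => _) = fun x : V => cos (x i 0 + (a i 0 + c))); first exact: trig_cos.
by apply/funext => x; rewrite mxE addrA.
Qed.

Lemma trig_bounded f : trig f -> exists2 C : R, 0 <= C & forall x, `|f x| <= C.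
Proof.
elim=> {f}.
- by move=> c; exists `|c|.
- by move=> i c; exists 1 => // x; rewrite ler_norml sin_geN1 sin_le1.
- by move=> i c; exists 1 => // x; rewrite ler_norml cos_geN1 cos_le1.
- move=> f g _ [C C0 HC] _ [D D0 HD]; exists (C + D); first exact: addr_ge0.
  by move=> x; rewrite (le_trans (ler_normD _ _))// lerD.
- move=> f g _ [C C0 HC] _ [D D0 HD]; exists (C * D); first exact: mulr_ge0.
  by move=> x; rewrite normrM; apply: ler_pM.
Qed.

(** The gradient of a trigonometric function is trigonometric, and the chain rule
    for a linear substitution is uniform in the matrix. *)
Lemma trig_chain f : trig f -> exists2 f' : 'I_d -> V -> R, forall i, trig (f' i) &
  forall n (L : 'M[R]_(d, n)) j x,
    is_derive x (basis_vec R j) (fun x => f (L *m x)) (\sum_i L i j * f' i (L *m x)).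
Proof.
have row_dotp n (L : 'M[R]_(d, n)) i (x : 'cV_n) : (L *m x) i 0 = dotp x (row i L)^T.
  by rewrite mxE /dotp; apply: eq_bigr => k _; rewrite !mxE mulrC.
elim=> {f}.
- move=> c; exists (fun _ _ => 0) => [i|n L j x]; first exact: trig_cst.
  by rewrite big1 => [|i _]; [exact: is_derive_cst|rewrite mulr0].
- move=> i c; exists (fun k x => (k == i)%:R * cos (x i 0 + c)).
    by move=> k; apply: trig_scale; exact: trig_cos.
  move=> n L j x; rewrite (bigD1 i)//= big1 => [|k /negPf ki]; last by rewrite ki mul0r mulr0.
  rewrite eqxx mul1r addr0 row_dotp.
  have := sind_derive (row i L)^T c x j; rewrite !mxE.
  by congr is_derive; apply/funext => y; rewrite row_dotp.
- move=> i c; exists (fun k x => (- (k == i)%:R) * sin (x i 0 + c)).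
    by move=> k; apply: trig_scale; exact: trig_sin.
  move=> n L j x; rewrite (bigD1 i)//= big1 => [|k /negPf ki]; last by rewrite ki oppr0 mul0r mulr0.
  rewrite eqxx mulN1r addr0 row_dotp mulrN -mulNr.
  have := cosd_derive (row i L)^T c x j; rewrite !mxE.
  by congr is_derive; apply/funext => y; rewrite row_dotp.
- move=> f g _ [f' tf' Hf] _ [g' tg' Hg]; exists (fun i x => f' i x + g' i x).
    by move=> i; exact: trig_add.
  move=> n L j x; under eq_bigr do rewrite mulrDr.
  by rewrite big_split; apply: is_deriveD.
- move=> f g tf [f' tf' Hf] tg [g' tg' Hg]; exists (fun i x => f x * g' i x + g x * f' i x).
    by move=> i; apply: trig_add; exact: trig_mul.
  move=> n L j x; have := is_deriveM (Hf n L j x) (Hg n L j x).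
  rewrite /GRing.scale/= !mulr_sumr -big_split.
  by congr is_derive; apply: eq_bigr => i _; rewrite mulrDr; congr (_ + _); exact: mulrCA.
Qed.

Lemma trig_comp_SG f n (L : 'M[R]_(d, n)) : trig f -> SG (fun x => f (L *m x)).
Proof.
move=> tf; apply: (@SG_coind _ _ (fun h => exists2 f, trig f & h = fun x => f (L *m x))); last by exists f.
move=> _ {tf f} [f tf ->]; split.
  by have [C C0 HC] := trig_bounded tf; apply: (@slow_bounded _ _ _ C) => x; exact: HC.
have [f' tf' Hf] := trig_chain tf => i; split.
  by move=> x; exact: (@ex_derive _ _ _ _ _ _ _ (Hf n L i x)).
exists (fun y => \sum_k L k i * f' k y); first by apply: trig_sum => k _; exact: trig_scale.
by apply/funext => x; rewrite (pd_val (Hf n L i x)).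
Qed.

(** A derivative of positive order of f(L x) contains an entry of L as a factor. *)
Lemma trig_comp_bound (E : R) k f : trig f -> exists2 C : R, 0 <= C &
  forall n (L : 'M[R]_(d, n)) (eps : R), (forall i j, `|L i j| <= eps) -> eps <= E ->
  forall s x, size s = k -> `|pds s (fun x => f (L *m x)) x| <= C * (if k is 0 then 1 else eps).
Proof.
elim: k f => [|k IH] f tf.
  have [C C0 HC] := trig_bounded tf; exists C => // n L eps _ _ s x /size0nil ->.
  by rewrite mulr1; exact: HC.
have [f' tf' Hf] := trig_chain tf.
have /choice[C HC] : forall i, exists C : R, 0 <= C /\ forall n (L : 'M[R]_(d, n)) (eps : R), (forall i j, `|L i j| <= eps) -> eps <= E ->
    forall s x, size s = k -> `|pds s (fun x => f' i (L *m x)) x| <= C * (if k is 0 then 1 else eps).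
  by move=> i; have [C C0 h] := IH _ (tf' i); exists C.
exists ((\sum_i C i) * (1 + `|E|)).
  by rewrite mulr_ge0 ?addr_ge0// sumr_ge0// => i _; case: (HC i).
move=> n L eps HL eE s x.
elim/last_ind: s => // s j _; rewrite size_rcons => -[sk].
have pdE' : pd j (fun x => f (L *m x)) = fun x => \sum_i L i j * f' i (L *m x).
  by apply/funext => y; apply: pd_val; exact: Hf.
rewrite pds_rcons pdE'.
have pds_sum (r : seq 'I_d) : pds s (fun x => \sum_(i <- r) L i j * f' i (L *m x)) x =
    \sum_(i <- r) L i j * pds s (fun x => f' i (L *m x)) x.
  elim: r => [|i r IHr].
    rewrite big_nil (_ : (fun x => _) = fun x => 0 * (fun=> 0) x); last first.
      by apply/funext => y; rewrite big_nil mul0r.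
    by rewrite pdsZ ?mul0r//; exact: SG_cst.
  rewrite big_cons (_ : (fun x => _) = fun x => L i j * f' i (L *m x) + \sum_(i <- r) L i j * f' i (L *m x)); last first.
    by apply/funext => y; rewrite big_cons.
  rewrite pdsD; [|by apply: SGZ; exact: trig_comp_SG|].
    by rewrite IHr pdsZ//; exact: trig_comp_SG.
  apply: (@trig_comp_SG (fun y => \sum_(i <- r) L i j * f' i y)).
  by apply: trig_sum => k' _; exact: trig_scale.
rewrite pds_sum; apply: le_trans (ler_norm_sum _ _ _) _.
rewrite -mulrA mulr_suml; apply: ler_sum => i _; have [Ci h] := HC i.
have e0 : 0 <= eps.
  have i0 : 'I_d := i; by apply: le_trans (HL i j).
rewrite normrM mulrC; have := h n L eps HL eE s x sk => h1.
apply: le_trans (ler_pM (normr_ge0 _) (normr_ge0 _) h1 (HL i j)) _.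
rewrite -mulrA ler_wpM2l// ler_wpM2r//.
case: k {IH HC h h1 sk} => [|k]; first by rewrite lerDl.
by apply: (le_trans eE); apply: (le_trans (ler_norm _)); rewrite lerDr.
Qed.

Lemma trig_comp_lipschitz f : trig f -> exists2 C : R, 0 <= C &
  forall (L : 'M[R]_d) (eps : R), (forall i j, `|L i j| <= eps) ->
  forall x, `|f (L *m x) - f 0| <= C * eps * `|x|.
Proof.
move=> tf; have [f' tf' Hf] := trig_chain tf.
have /choice[C HC] : forall i, exists C : R, 0 <= C /\ forall x, `|f' i x| <= C.
  by move=> i; have [C C0 h] := trig_bounded (tf' i); exists C.
exists (\sum_i d%:R * C i).
  by apply: sumr_ge0 => i _; case: (HC i) => Ci _; rewrite mulr_ge0.
move=> L eps HL x.
pose L1 : 'M[R]_(d, 1) := L *m x.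
have D (t : R) : is_derive t 1 (fun t : R => f (L1 *m t%:M)) (\sum_i L1 i 0 * f' i (L1 *m t%:M)).
  have E (s : R) : s%:M = 0 + s *: basis_vec R (0 : 'I_1).
    by rewrite add0r; apply/matrixP => a b; rewrite !ord1 !mxE eqxx mulr1.
  have := proj1 (is_derive_line (fun y => f (L1 *m y)) 0 (basis_vec R (0 : 'I_1)) t _) (Hf 1%N L1 0 _).
  rewrite -E; congr is_derive; apply/funext => s; by rewrite -E.
have [c _] := mvt 0 1 D.
rewrite !add0r mul_mx_scalar scale1r mul1r mul_mx_scalar scale0r => ->.
apply: le_trans (ler_norm_sum _ _ _) _.
rewrite -mulrA mulr_suml; apply: ler_sum => i _; have [Ci h] := HC i.
have hL : `|L1 i 0| <= d%:R * (eps * `|x|).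
  rewrite mxE; apply: le_trans (ler_norm_sum _ _ _) _.
  apply: (@le_trans _ _ (\sum_(j < d) eps * `|x|)).
    by apply: ler_sum => j _; rewrite normrM; apply: ler_pM => //; exact: coord_le.
  by rewrite sumr_const card_ord mulr_natl.
rewrite normrM; apply: le_trans (ler_pM (normr_ge0 _) (normr_ge0 _) hL (h _)) _.
by rewrite le_eqVlt; apply/orP; left; apply/eqP; ring.
Qed.

End Trigonometric.

(** * The infinite product of a trigonometric mask *)

Section InfiniteProduct.
Variables (R : realType) (d : nat).
Local Notation V := 'cV[R]_d.

Lemma bernoulli (y : R) p : 0 <= y -> 1 + p%:R * y <= (1 + y) ^+ p.
Proof.
move=> y0; elim: p => [|p IH]; first by rewrite mul0r addr0 expr0.
have y1 : 0 <= 1 + y by rewrite addr_ge0.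
rewrite exprS; apply: le_trans (ler_wpM2l y1 IH).
rewrite -[p.+1%:R]natr1; have : 0 <= p%:R * y * y by rewrite !mulr_ge0.
lra.
Qed.

(** The factor at scale X is dominated by a quotient that telescopes along the
    geometric sequence of scales. *)
Lemma telescoping_factor (q X E : R) p : 0 <= q -> q < 1 -> 0 <= X -> E <= p%:R * (1 - q) ->
  1 + E * (X / (1 + X)) <= ((1 + X) / (1 + q * X)) ^+ p.
Proof.
move=> q0 q1 X0 Ep.
have X1 : 0 < 1 + X by rewrite ltr_pwDl.
have qX : 0 <= q * X by rewrite mulr_ge0.
have qX1 : 0 < 1 + q * X by rewrite ltr_pwDl.
pose y := (1 - q) * (X / (1 + X)).
have XX : 0 <= X / (1 + X) by rewrite divr_ge0// ltW.
have y0 : 0 <= y by rewrite mulr_ge0// subr_ge0 ltW.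
apply: (@le_trans _ _ ((1 + y) ^+ p)).
  apply: le_trans (bernoulli p y0); rewrite lerD2l /y [leRHS]mulrA ler_wpM2r//.
apply: lerXn2r; rewrite ?nnegrE ?addr_ge0//; first by rewrite divr_ge0// ltW.
rewrite ler_pdivlMr// mulrDl mul1r /y.
have : (1 - q) * (X / (1 + X)) * (1 + q * X) <= (1 - q) * X.
  rewrite -mulrA ler_wpM2l ?subr_ge0 ?(ltW q1)// mulrAC ler_pdivrMr//.
  rewrite ler_wpM2l// lerD2l ler_piMl// ltW//.
lra.
Qed.

Variables (m0 : V -> R) (B : 'M[R]_d) (q K : R).
Hypotheses (tm : trig m0) (m00 : m0 0 = 1) (q0 : 0 < q) (q1 : q < 1) (K0 : 0 <= K).
Hypothesis HB : forall j i k, `|(B ^+ j) i k| <= K * q ^+ j.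

Let v (y : V) : R := m0 y + (-1).
Let vj j (x : V) : R := v (B ^+ j *m x).

(** This recursion exhibits the difference of consecutive partial products, in
    which the factor m0 - 1 is small. *)
Fixpoint partial_prod (n : nat) : V -> R :=
  if n is k.+1 then fun x => partial_prod k x + partial_prod k x * vj n x else fun=> 1.

Lemma partial_prodE n x : partial_prod n x = \prod_(1 <= j < n.+1) m0 (B ^+ j *m x).
Proof.
elim: n => [|n IH]; first by rewrite big_geq.
rewrite big_nat_recr//= -IH /vj /v; ring.
Qed.

Let tv : trig v. Proof. exact: trig_add (trig_cst _ _). Qed.

Lemma SG_vj j : SG (vj j).
Proof. exact: trig_comp_SG tv. Qed.

Lemma SG_partial_prod n : SG (partial_prod n).
Proof.
elim: n => [|n IH] /=; first exact: SG_cst.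
by apply: SGD => //; apply: SGM => //; exact: SG_vj.
Qed.

Lemma qX_le1 j : q ^+ j <= 1. Proof. by rewrite exprn_ile1// ltW. Qed.

(** The point B^j x tends to the origin, where m0 = 1. *)
Lemma factor_bound k : exists2 D, 0 <= D & forall j x s, (size s <= k)%N ->
  `|pds s (vj j) x| <= D * (q ^+ j * (1 + `|x|)) /\ `|pds s (vj j) x| <= D.
Proof.
have qj0 j : 0 <= q ^+ j by rewrite exprn_ge0// ltW.
elim: k => [|k [D D0 IH]].
  have [C C0 HC] := trig_comp_lipschitz tv; have [C' C0' HC'] := trig_bounded tv.
  exists (C * K + C'); first by rewrite addr_ge0// mulr_ge0.
  move=> j x s; rewrite leqn0 => /nilP ->; split; last first.
    by apply: (le_trans (HC' _)); rewrite lerDr mulr_ge0.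
  have v0 : v 0 = 0 by rewrite /v m00 subrr.
  have := HC (B ^+ j) (K * q ^+ j) (HB j) x; rewrite v0 subr0 => /le_trans; apply.
  have -> : C * (K * q ^+ j) * `|x| = (C * K) * (q ^+ j * `|x|) by ring.
  apply: ler_pM => //; rewrite ?mulr_ge0//; first by rewrite lerDl.
  by rewrite ler_wpM2l// lerDr.
have [C C0 HC] := trig_comp_bound K k.+1 tv.
exists (D + C * K + C); first by rewrite !addr_ge0// mulr_ge0.
move=> j x s; rewrite leq_eqVlt => /orP[/eqP sk|sk].
  have qK : K * q ^+ j <= K by rewrite ler_piMr// qX_le1.
  have h := HC _ (B ^+ j) (K * q ^+ j) (HB j) qK s x sk.
  split; apply: (le_trans h).
    have -> : C * (K * q ^+ j) = (C * K) * (q ^+ j * 1) by ring.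
    apply: ler_pM; rewrite ?mulr_ge0//; last by rewrite ler_wpM2l// lerDl.
    by rewrite addrAC lerDr addr_ge0.
  apply: (@le_trans _ _ (C * K)); first by rewrite ler_wpM2l.
  by rewrite addrAC lerDr addr_ge0.
have [h1 h2] := IH j x s sk; split.
  by apply: (le_trans h1); rewrite ler_wpM2r ?mulr_ge0 ?addr_ge0// -addrA lerDl addr_ge0// mulr_ge0.
by apply: (le_trans h2); rewrite -addrA lerDl addr_ge0// mulr_ge0.
Qed.

Let X j (x : V) : R := q ^+ j * (1 + `|x|).

Let X_ge0 j x : 0 <= X j x.
Proof. by rewrite mulr_ge0 ?addr_ge0// exprn_ge0// ltW. Qed.

(** The Leibniz formula bounds the derivatives of a partial product by those of
    the previous one times the factor of the telescoping lemma. *)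
Lemma partial_prod_bound k D p : 0 <= D ->
  (forall j x s, (size s <= k)%N -> `|pds s (vj j) x| <= D * X j x /\ `|pds s (vj j) x| <= D) ->
  2 ^+ k * (2 * D) <= p%:R * (1 - q) ->
  forall n x s, (size s <= k)%N ->
    `|pds s (partial_prod n) x| <= ((1 + X 1 x) / (1 + X n.+1 x)) ^+ p.
Proof.
move=> D0 HD Ep; elim=> [|n IH] x s sk.
  rewrite divff ?expr1n; last by rewrite gt_eqF// ltr_pwDl.
  rewrite /partial_prod; case/lastP: s {sk} => [|s i]; first by rewrite /= normr1.
  rewrite pds_rcons pd_cst (_ : (fun=> 0) = fun x : V => 0 * (fun=> 0) x).
    by rewrite pdsZ ?mul0r ?normr0//; exact: SG_cst.
  by apply/funext => y; rewrite mul0r.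
have M0 : 0 <= ((1 + X 1 x) / (1 + X n.+1 x)) ^+ p.
  by rewrite exprn_ge0// divr_ge0// addr_ge0.
set M := (_ ^+ p) in IH M0 *.
rewrite [partial_prod n.+1]/= pdsD; [|exact: SG_partial_prod|].
  2: by apply: SGM; [exact: SG_partial_prod|exact: SG_vj].
have Y0 := X_ge0 n.+1 x; set Y := X n.+1 x in Y0 *.
have Y1 : 0 < 1 + Y by rewrite ltr_pwDl.
have YY : 0 <= Y / (1 + Y) by rewrite divr_ge0// ltW.
(* the minimum of 1 and Y is at most 2Y/(1+Y) *)
have vb t : (size t <= size s)%N -> `|pds t (vj n.+1) x| <= 2 * D * (Y / (1 + Y)).
  move=> ts; have [h1 h2] := HD n.+1 x t (leq_trans ts sk); rewrite -/Y in h1.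
  rewrite mulrA ler_pdivlMr//.
  have h3 : `|pds t (vj n.+1) x| * Y <= D * Y by rewrite ler_wpM2r.
  lra.
have := @leibniz_bound R d x s (partial_prod n) (vj n.+1) M (2 * D * (Y / (1 + Y)))
   (SG_partial_prod n) (SG_vj _) M0.
have b0 : 0 <= 2 * D * (Y / (1 + Y)) by rewrite mulr_ge0// mulr_ge0.
move=> /(_ b0) LB.
have {}LB := LB (fun t ts => IH x t (leq_trans ts sk)) vb.
apply: le_trans (ler_normD _ _) _.
apply: (@le_trans _ _ (M * (1 + 2 ^+ k * (2 * D) * (Y / (1 + Y))))).
  rewrite mulrDr mulr1 lerD ?IH//; apply: (le_trans LB).
  have -> : M * (2 ^+ k * (2 * D) * (Y / (1 + Y))) = 2 ^+ k * (M * (2 * D * (Y / (1 + Y)))) by ring.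
  by apply: ler_wpM2r; [rewrite mulr_ge0|rewrite ler_weXn2l// ler1n].
have TF := telescoping_factor (ltW q0) q1 Y0 Ep.
apply: le_trans (ler_wpM2l M0 TF) _.
rewrite /M -exprMn le_eqVlt; apply/orP; left; apply/eqP; congr (_ ^+ _).
have -> : q * Y = X n.+2 x by rewrite /Y /X [q ^+ n.+2]exprS mulrA.
by rewrite mulrA divfK// gt_eqF.
Qed.

(** The differences of consecutive partial products form a series with geometric
    bounds. *)
Theorem infinite_product : exists2 h : V -> R, SG h &
  forall x, (fun n => partial_prod n x) @ \oo --> h x.
Proof.
pose Delta n x := partial_prod n x * vj n.+1 x.
have gD : geometric_bounds q Delta.
  split; first by move=> n; apply: SGM; [exact: SG_partial_prod|exact: SG_vj].
  move=> s; have [D D0 HD] := factor_bound (size s).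
  pose p := (Num.truncn (2 ^+ size s * (2 * D) / (1 - q))).+1.
  have Ep : 2 ^+ size s * (2 * D) <= p%:R * (1 - q).
    by rewrite -ler_pdivrMr ?subr_gt0//; exact/ltW/truncnS_gt.
  exists (2 ^+ size s * (2 ^+ p * D)), p.+1; split; first by rewrite !mulr_ge0.
  move=> n x.
  have PB t : (size t <= size s)%N -> `|pds t (partial_prod n) x| <= 2 ^+ p * (1 + `|x|) ^+ p.
    move=> ts; apply: le_trans (partial_prod_bound D0 HD Ep n x ts) _.
    rewrite -exprMn; apply: lerXn2r; rewrite ?nnegrE ?divr_ge0 ?mulr_ge0 ?addr_ge0//.
    rewrite ler_pdivrMr ?ltr_pwDl//.
    apply: (@le_trans _ _ (2 * (1 + `|x|))); last by rewrite ler_peMr ?mulr_ge0 ?addr_ge0// lerDl.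
    have : X 1 x <= 1 + `|x| by rewrite /X expr1 ler_piMl ?addr_ge0// ltW.
    by have := normr_ge0 x; lra.
  have VB t : (size t <= size s)%N -> `|pds t (vj n.+1) x| <= D * (q ^+ n * (1 + `|x|)).
    move=> ts; apply: le_trans (proj1 (HD n.+1 x t ts)) _.
    rewrite ler_wpM2l// ler_wpM2r ?addr_ge0// exprS ler_piMl ?exprn_ge0 ?ltW//.
  have := leibniz_bound (SG_partial_prod n) (SG_vj n.+1) _ _ PB VB.
  rewrite !mulr_ge0 ?exprn_ge0 ?addr_ge0 ?(ltW q0)// => /(_ isT isT)/le_trans; apply.
  by rewrite exprS le_eqVlt; apply/orP; left; apply/eqP; ring.
have [T HT] := has_sum_geometric (ltW q0) q1.
have /choice[h Hh] : forall x, exists l, has_sum (fun n => Delta n x) l.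
  move=> x; have [C [p [C0 HC]]] := (proj2 gD) [::].
  by apply: (has_sum_exists (has_sumZ (C * (1 + `|x|) ^+ p) HT)) => n; exact: HC.
exists (fun x => 1 + h x).
  by apply: SGD; [exact: SG_cst|exact: (SG_series (ltW q0) q1 gD Hh)].
move=> x; rewrite (_ : (fun n => _) = fun n => 1 + \sum_(0 <= k < n) Delta k x).
  by apply: cvgD; [exact: cvg_cst|exact: has_sum_partial (Hh x)].
apply/funext; elim=> [|n IH]; first by rewrite big_geq// addr0.
by rewrite big_nat_recr//= addrA -IH.
Qed.

End InfiniteProduct.

(** * Isotropic matrices and the elliptic symbol *)

Section IsotropicMatrix.
Variables (R : realType) (d : nat) (A : 'M[int]_d).
Hypotheses (hd : (0 < d)%N) (hA : isotropic_dilation R A).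

(** The determinant is the product of the eigenvalues. *)
Lemma det_gt1 : (1 < `|\det A|)%N.
Proof.
have [H1 [P uP /diagonalizable_forPex[D /(simmxP uP) HD]] _] := hA.
set AC := map_mx _ A in H1 HD.
have detAC : \det AC = (\det A)%:~R by rewrite /AC -det_map_mx.
have detD : \det AC = \prod_i D 0 i.
  have := congr1 determinant HD; rewrite !det_mulmx det_diag mulrC.
  by apply: mulIf; rewrite -unitfE.
have Dgt1 i : 1 < `|D 0 i|.
  apply: H1; apply/eigenvalueP; exists (row i P).
    by rewrite -row_mul HD row_mul row_diag_mx -scalemxAl -rowE.
  by apply: contraTneq uP => r0; rewrite -row_free_unit; apply/negP => /row_freeP[Q PQ];
     have := congr1 (fun M => row i M) PQ; rewrite row_mul r0 mul0mx => /rowP/(_ i);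
     rewrite !mxE eqxx => /eqP; rewrite eq_sym oner_eq0.
have : 1 < `|\det AC|.
  rewrite detD normr_prod.
  have i0 : 'I_d := Ordinal hd.
  rewrite (bigD1 i0)//=; apply: (lt_le_trans (Dgt1 i0)).
  rewrite ler_peMr//; apply: (big_ind (fun z : R[i] => 1 <= z)) => //.
    by move=> z w z1 w1; rewrite -[1]mulr1; apply: ler_pM.
  by move=> i _; exact: ltW.
by rewrite detAC -intr_norm -[1]/(1%:~R) ltr_int; case: (\det A) => n.
Qed.

Lemma intR_unit : intR R A \in unitmx.
Proof.
rewrite unitmxE /intR det_map_mx unitfE intr_eq0 -absz_gt0.
exact: ltn_trans det_gt1.
Qed.

Lemma invtr_mul : invtr R A *m (intR R A)^T = 1%:M.
Proof. by rewrite /invtr mulVmx// unitmx_tr intR_unit. Qed.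

Lemma mul_invtr : (intR R A)^T *m invtr R A = 1%:M.
Proof. by rewrite /invtr mulmxV// unitmx_tr intR_unit. Qed.

Variable Q : 'M[R]_d.
Hypothesis hQ : isotropic_factor A Q.

Lemma Q_sym : Q^T = Q. Proof. by case: hQ => -[]. Qed.

Lemma Q_ker (x : 'cV[R]_d) : Q *m x = 0 -> x = 0.
Proof.
move=> Qx; apply/eqP; apply: contraT => x0.
by case: hQ => -[_ /(_ x x0)]; rewrite -mulmxA Qx mulmx0 mxE ltxx.
Qed.

Lemma Q_unit : Q \in unitmx.
Proof.
rewrite unitmxE unitfE; apply/det0P => -[v v0 vQ]; case/eqP: v0.
have := congr1 trmx vQ; rewrite trmx_mul Q_sym trmx0 => /Q_ker h.
by rewrite -[v]trmxK h trmx0.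
Qed.

Let c : R := `|\det A|%N%:R `^ (- d%:R^-1).

Lemma contraction_ratio : 0 < c /\ c < 1.
Proof.
have d0 : (0 : R) < d%:R by rewrite ltr0n.
have qgt1 : (1 : R) < `|\det A|%N%:R by rewrite ltr1n det_gt1.
have q0 : (0 : R) < `|\det A|%N%:R by apply: lt_trans qgt1.
have c0 : 0 < c by rewrite powR_gt0.
split => //; rewrite ltNge; apply/negP => c1.
have : c ^+ d = `|\det A|%N%:R^-1.
  by rewrite -powR_mulrn ?(ltW c0)// -powRrM mulNr mulVf ?gt_eqF// powR_inv1// ltW.
move=> cd; have : 1 <= c ^+ d by exact: exprn_ege1.
by rewrite cd leNgt invf_lt1// qgt1.
Qed.

Lemma orthogonal_entry (U : 'M[R]_d) i j : orthogonal_mx U -> `|U i j| <= 1.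
Proof.
move=> /matrixP/(_ j j); rewrite !mxE eqxx mulr1n => E.
rewrite -(@expr_le1 _ 2)// real_normK ?num_real//.
rewrite -E (bigD1 i)//= !mxE -expr2 lerDl; apply: sumr_ge0 => k _.
by rewrite !mxE -expr2 sqr_ge0.
Qed.

Lemma orthogonalX (U : 'M[R]_d) n : orthogonal_mx U -> orthogonal_mx (U ^+ n).
Proof.
move=> oU; elim: n => [|n IH]; first by rewrite expr0 /orthogonal_mx trmx1 mulmx1.
rewrite exprS /orthogonal_mx (_ : U * U ^+ n = U *m U ^+ n)// trmx_mul.
by rewrite mulmxA -(mulmxA _ U^T) oU mulmx1.
Qed.

(** Powers of an orthogonal matrix have bounded entries, and conjugation by Q
    costs a constant factor. *)
Lemma invtr_power_bound : exists2 K, 0 <= K &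
  forall j i k, `|(invtr R A ^+ j) i k| <= K * c ^+ j.
Proof.
case: hQ => _ [U oU BE].
have c0 : 0 <= c by case: contraction_ratio => /ltW.
have BX j : invtr R A ^+ j = c ^+ j *: (invmx Q *m U ^+ j *m Q).
  elim: j => [|j IH]; first by rewrite !expr0 scale1r mulmx1 mulVmx ?Q_unit.
  rewrite exprS IH BE -/c (_ : _ * _ = (c *: (invmx Q *m U *m Q)) *m (c ^+ j *: (invmx Q *m U ^+ j *m Q)))//.
  rewrite -scalemxAl -scalemxAr scalerA -exprS; congr (_ *: _).
  rewrite exprS (_ : U * U ^+ j = U *m U ^+ j)// !mulmxA.
  by rewrite -(mulmxA (_ *m U) Q) mulmxV ?Q_unit// mulmx1.
pose K1 := \sum_i \sum_a `|invmx Q i a|; pose K2 := \sum_b \sum_k `|Q b k|.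
have le1 i a : `|invmx Q i a| <= K1.
  rewrite /K1 (bigD1 i)//= (bigD1 a)//= -addrA lerDl addr_ge0//.
    exact: sumr_ge0.
  by apply: sumr_ge0 => *; apply: sumr_ge0.
have le2 b k : `|Q b k| <= K2.
  rewrite /K2 (bigD1 b)//= (bigD1 k)//= -addrA lerDl addr_ge0//.
    exact: sumr_ge0.
  by apply: sumr_ge0 => *; apply: sumr_ge0.
have K10 : 0 <= K1 by apply: sumr_ge0 => *; apply: sumr_ge0.
have K20 : 0 <= K2 by apply: sumr_ge0 => *; apply: sumr_ge0.
exists (\sum_(b < d) \sum_(a < d) K1 * K2).
  by apply: sumr_ge0 => *; apply: sumr_ge0 => *; rewrite mulr_ge0.
move=> j i k; rewrite BX mxE normrM ger0_norm ?exprn_ge0// mulrC ler_wpM2r ?exprn_ge0//.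
rewrite mxE; apply: le_trans (ler_norm_sum _ _ _) _; apply: ler_sum => b _.
rewrite mxE normrM; apply: (@le_trans _ _ ((\sum_(a < d) K1) * K2)).
  apply: ler_pM => //; apply: le_trans (ler_norm_sum _ _ _) _; apply: ler_sum => a _.
  rewrite normrM -[leRHS]mulr1; apply: ler_pM => //.
  exact: orthogonal_entry (orthogonalX j oU).
by rewrite mulr_suml.
Qed.

End IsotropicMatrix.

Section EllipticSymbol.
Variables (R : realType) (d : nat) (Q : 'M[R]_d).
Hypotheses (Qsym : Q^T = Q) (Qker : forall x : 'cV[R]_d, Q *m x = 0 -> x = 0).
Local Notation V := 'cV[R]_d.
Local Notation q := (Q *m Q).
Implicit Types x : V.

Lemma sqr_half (y : R) : 2 * sin (y / 2) ^+ 2 = 1 - cos y.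
Proof.
have -> : cos y = cos (y / 2 + y / 2) by congr cos; field.
by rewrite cosD; have := cos2Dsin2 (y / 2); lra.
Qed.

Lemma ellG_cos x : ellG Q x = 2 * (\sum_i q i i * (1 - cos (x i 0))) +
  2 * (\sum_(i < d) \sum_(j < d | (i < j)%N) q i j * sin (x i 0) * sin (x j 0)).
Proof.
rewrite /ellG; congr (_ + _).
rewrite (_ : 4 = 2 * 2 :> R); last by rewrite -natrM.
rewrite -mulrA [2 * \sum_(i < d) _]mulr_sumr; congr (_ * _).
by apply: eq_bigr => i _; rewrite -sqr_half; ring.
Qed.

Lemma trig_ellG : trig (ellG Q).
Proof.
rewrite (_ : ellG Q = fun x => 2 * (\sum_i q i i * (1 + -1 * cos (x i 0 + 0))) +
  2 * (\sum_(i < d) \sum_(j < d | (i < j)%N) q i j * (sin (x i 0 + 0) * sin (x j 0 + 0)))).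
  apply: trig_add; apply: trig_scale; apply: trig_sum => i _.
    apply: trig_scale; apply: trig_add; first exact: trig_cst.
    by apply: trig_scale; exact: trig_cos.
  apply: trig_sum => j _; apply: trig_scale; apply: trig_mul; exact: trig_sin.
apply/funext => x; rewrite ellG_cos; congr (_ * _ + _ * _).
  by apply: eq_bigr => i _; rewrite addr0 mulN1r.
by apply: eq_bigr => i _; apply: eq_bigr => j _; rewrite !addr0 mulrA.
Qed.

Lemma ellG_period x (k : 'cV[int]_d) : ellG Q (x + (2 * pi) *: intR R k) = ellG Q x.
Proof.
have E i : (x + (2 * pi) *: intR R k) i 0 = x i 0 + (k i 0)%:~R * (2 * pi).
  by rewrite mxE [X in _ + X]mxE [X in _ * X]mxE mulrC.
rewrite !ellG_cos; congr (_ * _ + _ * _).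
  by apply: eq_bigr => i _; rewrite E cos_period.
by apply: eq_bigr => i _; apply: eq_bigr => j _; rewrite !E !sin_period.
Qed.

Lemma q_sym i j : q i j = q j i.
Proof. by have /matrixP/(_ j i) : q^T = q by [rewrite trmx_mul Qsym]; rewrite mxE. Qed.

Lemma q_diag_gt0 i : 0 < q i i.
Proof.
have E : q i i = \sum_k Q k i ^+ 2.
  by rewrite mxE; apply: eq_bigr => k _; rewrite -{1}Qsym mxE expr2.
rewrite E lt_neqAle sumr_ge0 ?andbT; last by move=> k _; rewrite sqr_ge0.
rewrite eq_sym; apply/negP => /eqP h.
have Qk k : Q k i = 0.
  apply/eqP; rewrite -sqrf_eq0; move/eqP: h; rewrite psumr_eq0 => [/allP/(_ k)|j _].
    by rewrite mem_index_enum => /(_ isT).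
  exact: sqr_ge0.
have : Q *m (basis_vec R i) = 0.
  apply/colP => k; rewrite mxE (bigD1 i)//= Qk mul0r add0r big1 ?mxE// => j /negPf ji.
  by rewrite mxE ji mulr0.
move=> /Qker/colP/(_ i); rewrite !mxE !eqxx => /eqP; by rewrite oner_eq0.
Qed.

(** The form is the squared length of Q s. *)
Lemma quadratic_form_ge0 (s : 'I_d -> R) :
  0 <= \sum_i q i i * s i ^+ 2 + 2 * (\sum_(i < d) \sum_(j < d | (i < j)%N) q i j * s i * s j).
Proof.
have -> : \sum_i q i i * s i ^+ 2 + 2 * (\sum_(i < d) \sum_(j < d | (i < j)%N) q i j * s i * s j) =
   \sum_i \sum_j q i j * s i * s j.
  have split3 (i : 'I_d) : \sum_j q i j * s i * s j = q i i * s i ^+ 2 +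
     (\sum_(j < d | (i < j)%N) q i j * s i * s j + \sum_(j < d | (j < i)%N) q i j * s i * s j).
    rewrite (bigD1 i)//= -mulrA -expr2; congr (_ + _).
    rewrite (bigID (fun j : 'I_d => (i < j)%N))/=; congr (_ + _); apply: eq_bigl => j.
      by rewrite -val_eqE /=; lia.
    by rewrite -val_eqE /=; lia.
  under [RHS]eq_bigr do rewrite split3.
  rewrite big_split /=; congr (_ + _); rewrite big_split /= mulrDl mul1r; congr (_ + _).
  rewrite [RHS](exchange_big_dep xpredT)//=; apply: eq_bigr => i _; apply: eq_bigr => j _.
  by rewrite q_sym; ring.
have -> : \sum_i \sum_j q i j * s i * s j = \sum_k (\sum_i Q k i * s i) ^+ 2.
  transitivity (\sum_i \sum_j \sum_k (Q k i * s i) * (Q k j * s j)).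
    apply: eq_bigr => i _; apply: eq_bigr => j _; rewrite mxE !mulr_suml.
    apply: eq_bigr => k _; rewrite (_ : Q i k = Q k i); first by ring.
    by rewrite -{1}Qsym mxE.
  under eq_bigr do rewrite exchange_big /=.
  rewrite exchange_big /=; apply: eq_bigr => k _.
  rewrite expr2 mulr_suml; apply: eq_bigr => i _; by rewrite mulr_sumr.
by apply: sumr_ge0 => k _; rewrite sqr_ge0.
Qed.

(** The difference is the quadratic form of Q^2 at the vector of the sin(x_i),
    because 4 sin^2(t/2) = 4 sin^4(t/2) + sin^2 t. *)
Lemma ellG_lower x : 4 * (\sum_i q i i * sin (x i 0 / 2) ^+ 4) <= ellG Q x.
Proof.
rewrite /ellG; set S2 := \sum_(i < d) \sum_(j < d | _) _.
have := quadratic_form_ge0 (fun i => sin (x i 0)); rewrite -/S2 => h.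
have E : 4 * (\sum_i q i i * sin (x i 0 / 2) ^+ 2) =
  4 * (\sum_i q i i * sin (x i 0 / 2) ^+ 4) + \sum_i q i i * sin (x i 0) ^+ 2.
  rewrite !mulr_sumr -big_split /=; apply: eq_bigr => i _.
  have -> : sin (x i 0) = sin (x i 0 / 2 + x i 0 / 2) by congr sin; field.
  rewrite sinD; have := cos2Dsin2 (x i 0 / 2).
  move: (sin _) (cos _) => s c cs.
  have -> : c * s = s * c by ring.
  have -> : (s * c + s * c) ^+ 2 = 4 * s ^+ 2 * c ^+ 2 by ring.
  have -> : c ^+ 2 = 1 - s ^+ 2 by lra.
  ring.
lra.
Qed.

Lemma ellG_ge0 x : 0 <= ellG Q x.
Proof.
apply: le_trans (ellG_lower x); rewrite mulr_ge0// sumr_ge0// => i _.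
by rewrite mulr_ge0 ?(ltW (q_diag_gt0 _))// exprn_even_ge0.
Qed.

Lemma ellG_eq0 x i : ellG Q x = 0 -> sin (x i 0 / 2) = 0.
Proof.
move=> G0; have := ellG_lower x; rewrite G0 => h.
have t0 j : 0 <= q j j * sin (x j 0 / 2) ^+ 4.
  by rewrite mulr_ge0 ?(ltW (q_diag_gt0 _))// exprn_even_ge0.
have : q i i * sin (x i 0 / 2) ^+ 4 <= 0.
  have : q i i * sin (x i 0 / 2) ^+ 4 <= \sum_j q j j * sin (x j 0 / 2) ^+ 4.
    by rewrite (bigD1 i)//= lerDl sumr_ge0.
  lra.
rewrite pmulr_rle0 ?q_diag_gt0// => h4; have : sin (x i 0 / 2) ^+ 4 == 0 by rewrite eq_le h4 exprn_even_ge0.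
by rewrite expf_eq0 => /eqP.
Qed.

Lemma ellG_0 : ellG Q 0 = 0.
Proof.
have E i : (0 : V) i 0 = 0 by rewrite mxE.
rewrite ellG_cos big1 ?mulr0 ?add0r; last by move=> i _; rewrite E cos0 subrr mulr0.
by rewrite big1 ?mulr0// => i _; rewrite big1// => j _; rewrite !E sin0 mulr0.
Qed.

Lemma ellG_unit_cube (s : V) : (forall i, 0 <= s i 0 < 1) -> s != 0 -> ellG Q ((2 * pi) *: s) != 0.
Proof.
move=> s01 s0; apply/eqP => G0; case/eqP: s0; apply/colP => i; rewrite mxE.
have := ellG_eq0 i G0; rewrite mxE (_ : 2 * pi * s i 0 / 2 = pi * s i 0); last by field.
have /andP[si0 si1] := s01 i.
move: si0; rewrite le_eqVlt => /predU1P[<-//|si0] sin0.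
suff : 0 < sin (pi * s i 0) by rewrite sin0 ltxx.
apply: sin_gt0_pi; rewrite mulr_gt0 ?pi_gt0//=.
by rewrite -[ltRHS]mulr1 ltr_pM2l ?pi_gt0.
Qed.

End EllipticSymbol.

(** * The elliptic mask *)

Section IntegerMatrices.
Variable R : realType.

Lemma intR_mul m n p (M : 'M[int]_(m, n)) (N : 'M[int]_(n, p)) :
  intR R (M *m N) = intR R M *m intR R N.
Proof.
apply/matrixP => i j; rewrite !mxE rmorph_sum; apply: eq_bigr => k _.
by rewrite !mxE rmorphM.
Qed.

Lemma intR_tr m n (M : 'M[int]_(m, n)) : intR R M^T = (intR R M)^T.
Proof. by apply/matrixP => i j; rewrite !mxE. Qed.

Lemma intRB m n (M N : 'M[int]_(m, n)) : intR R (M - N) = intR R M - intR R N.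
Proof. by apply/matrixP => i j; rewrite !mxE rmorphB. Qed.

Lemma intR_inj m n (M : 'M[int]_(m, n)) : intR R M = 0 -> M = 0.
Proof.
move=> /matrixP h; apply/matrixP => i j; have := h i j; rewrite !mxE => /eqP.
by rewrite intr_eq0 => /eqP.
Qed.

End IntegerMatrices.

Section Mask.
Variables (R : realType) (d : nat) (A : 'M[int]_d) (Q : 'M[R]_d).
Hypotheses (hd : (0 < d)%N) (hA : isotropic_dilation R A) (hQ : isotropic_factor A Q).
Local Notation V := 'cV[R]_d.
Local Notation B := (invtr R A).
Local Notation m0 := (elliptic_mask A Q).
Implicit Types x : V.

Let Qsym : Q^T = Q := Q_sym hQ.
Let Qker (x : V) : Q *m x = 0 -> x = 0 := @Q_ker _ _ _ _ hQ x.

(** A digit s is determined by the integer vector A^T s, whose entries are at most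
    the sum of the absolute values of the entries of A. *)
Lemma digit_set_finite : finite_set (digit_set A : set V).
Proof.
pose N := (\sum_i \sum_j `|A j i|)%N.
pose e (f : {ffun 'I_d -> 'I_N.*2.+1}) : V := B *m intR R (\col_i ((f i)%:Z - N%:Z)).
apply: (@sub_finite_set _ _ (e @` setT)); last exact/finite_image/finite_finset.
move=> s [s01 [k Ask]].
have kN i : (`|k i 0%R| <= N)%N.
  rewrite -(ler_nat R) natr_absz intr_norm.
  have -> : (k i 0)%:~R = \sum_j (A j i)%:~R * s j 0 :> R.
    have /colP/(_ i) := Ask; rewrite [RHS]mxE => <-; rewrite mxE.
    by apply: eq_bigr => j _; rewrite !mxE.
  apply: le_trans (ler_norm_sum _ _ _) _.
  apply: (@le_trans _ _ (\sum_j (`|A j i|%N)%:R)).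
    apply: ler_sum => j _; rewrite normrM natr_absz intr_norm.
    have /andP[h0 h1] := s01 j.
    by rewrite ler_piMr// ger0_norm// ltW.
  by rewrite -natr_sum ler_nat /N [leqRHS](bigD1 i)//= leq_addr.
have kb i : (absz (k i 0 + N%:Z)%R < N.*2.+1)%N by have := kN i; lia.
exists [ffun i => Ordinal (kb i)] => //.
rewrite /e -[RHS]mul1mx -(invtr_mul hd hA) -mulmxA Ask; congr (_ *m intR R _).
by apply/colP => i; rewrite mxE ffunE /=; have := kN i; lia.
Qed.

Let D : set V := digit_set A `\ 0.

Let finite_D : finite_set D.
Proof. exact/finite_setD/digit_set_finite. Qed.

Let S : seq V := finmap.enum_fset (fset_set D).

Let S_P s : (s \in S) = (s \in D).
Proof. by rewrite -(in_fset_set finite_D). Qed.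

Lemma maskE x : m0 x = \prod_(s <- S) (ellG Q (x + (2 * pi) *: s) / ellG Q ((2 * pi) *: s)).
Proof.
by rewrite /elliptic_mask fsbig_finite//; exact: finite_D.
Qed.

Let S_unit s : s \in S -> ellG Q ((2 * pi) *: s) != 0.
Proof.
rewrite S_P inE => -[[s01 _] /= s0]; apply: ellG_unit_cube => //.
by apply/eqP.
Qed.

Lemma trig_mask : trig m0.
Proof.
rewrite (_ : m0 = fun x => \prod_(s <- S) ((ellG Q ((2 * pi) *: s))^-1 * ellG Q (x + (2 * pi) *: s))).
  by apply: trig_prod => s _; apply: trig_scale; apply: trig_shift; exact: trig_ellG.
by apply/funext => x; rewrite maskE; apply: eq_bigr => s _; rewrite mulrC.
Qed.

Lemma mask_ge0 x : 0 <= m0 x.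
Proof. by rewrite maskE; apply: prodr_ge0 => s _; rewrite divr_ge0// ellG_ge0. Qed.

Lemma mask_0 : m0 0 = 1.
Proof. by rewrite maskE big_seq big1// => s sS; rewrite add0r divff// S_unit. Qed.

(** If A^T z is integral but z is not, the fractional part of -z is a nonzero
    digit, and the corresponding factor of the mask vanishes at 2 pi z. *)
Lemma mask_eq0 (z : V) (k : 'cV[int]_d) : (intR R A)^T *m z = intR R k ->
  (forall l : 'cV[int]_d, z <> intR R l) -> m0 ((2 * pi) *: z) = 0.
Proof.
move=> Az zN.
pose fl : 'cV[int]_d := \col_i Num.floor (- z i 0).
pose s : V := - z - intR R fl.
have sS : s \in S.
  rewrite S_P inE; split; last first.
    move=> /= /eqP; rewrite subr_eq0 => /eqP h; apply: (zN (- fl)).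
    by rewrite -[z]opprK h; apply/colP => i; rewrite !mxE rmorphN.
  split.
    move=> i; rewrite !mxE subr_ge0 Num.Theory.floor_le/=.
    by rewrite ltrBlDl -[X in _ + X]/(1%:~R) -intrD Num.Theory.floorD1_gt.
  exists (- k - A^T *m fl).
  rewrite /s mulmxBr mulmxN Az -intR_tr -intR_mul intRB; congr (_ - _).
  by apply/colP => i; rewrite !mxE rmorphN.
rewrite maskE (big_rem s)//= -scalerDr /s addrA subrr add0r.
have -> : (2 * pi) *: - intR R fl = 0 + (2 * pi) *: intR R (- fl) :> V.
  by rewrite add0r; congr (_ *: _); apply/colP => i; rewrite !mxE rmorphN.
by rewrite ellG_period ellG_0 !mul0r.
Qed.

(** The orbit of k tends to 0, so it leaves the integer lattice; the mask vanishes
    at the first point outside. *)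
Lemma invtr_orbit (k : 'cV[int]_d) : k != 0 -> exists j,
  m0 (B ^+ j.+1 *m ((2 * pi) *: intR R k)) = 0.
Proof.
move=> k0.
have [c0 c1] := contraction_ratio hd hA.
set c := `|\det A|%N%:R `^ (- d%:R^-1) in c0 c1.
have [K K0 HK] := invtr_power_bound hd hA hQ; rewrite -/c in HK.
pose z j : V := B ^+ j *m intR R k.
have zS j : (intR R A)^T *m z j.+1 = z j.
  rewrite /z exprS (_ : B * B ^+ j = B *m B ^+ j)// !mulmxA.
  by rewrite (mul_invtr hd hA) mul1mx.
apply: contrapT => H.
have zint j : exists l, z j = intR R l.
  elim: j => [|j [l zl]]; first by exists k; rewrite /z expr0 mul1mx.
  apply: contrapT => zN; apply: H; exists j.
  rewrite -scalemxAr; apply: (mask_eq0 (k := l)); first by rewrite zS.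
  by move=> l' zl'; apply: zN; exists l'.
have [j Hj] : exists j, K * c ^+ j * (\sum_i `|(k i 0)%:~R|) < 1.
  pose E := K * \sum_i `|(k i 0)%:~R : R|.
  have E0 : 0 <= E by rewrite mulr_ge0// sumr_ge0.
  have cc : `|c| < 1 by rewrite ger0_norm// ltW.
  have /cvgrPdist_lt/(_ (1 + E)^-1) := cvg_expr cc.
  rewrite invr_gt0 ltr_pwDl// => /(_ isT)[j _ /(_ j (leqnn j))].
  rewrite sub0r normrN ger0_norm ?exprn_ge0 ?(ltW c0)// => h; exists j.
  rewrite mulrAC -/E; apply: (@le_lt_trans _ _ (E * (1 + E)^-1)).
    by rewrite ler_wpM2l// ltW.
  by rewrite ltr_pdivrMr ?ltr_pwDl// mul1r ltrDr.
have [l zl] := zint j.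
have l0 : l = 0.
  apply/colP => i; rewrite mxE; apply/eqP; rewrite -absz_eq0 -leqn0 leqNgt; apply/negP => l1.
  have : `|(l i 0)%:~R : R| < 1.
    apply: le_lt_trans Hj; have /colP/(_ i) := zl; rewrite [RHS]mxE => <-.
    rewrite mxE; apply: le_trans (ler_norm_sum _ _ _) _; rewrite mulr_sumr.
    by apply: ler_sum => a _; rewrite normrM mxE ler_wpM2r.
  by rewrite -intr_norm -[1]/(1%:~R) ltr_int; lia.
have z0 n : z n = 0 -> intR R k = 0.
  by elim: n => [|n IH]; [rewrite /z expr0 mul1mx|move=> h; apply: IH; rewrite -zS h mulmx0].
case/eqP: k0; apply: (@intR_inj R); apply: (z0 j); rewrite zl l0.
by apply/colP => i; rewrite !mxE.
Qed.

(** The infinite product of the mask is smooth and nonnegative, so that its zeros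
    are at least double. *)
Lemma scaling_hat_props : [/\ SG (scaling_hat A Q), scaling_hat A Q 0 = 1 &
  forall k : 'cV[int]_d, k != 0 -> vanishes 2 (scaling_hat A Q) ((2 * pi) *: intR R k)].
Proof.
have [c0 c1] := contraction_ratio hd hA.
have [K K0 HK] := invtr_power_bound hd hA hQ.
have [h sh Hh] := infinite_product trig_mask mask_0 c0 c1 K0 HK.
have pE x : (fun n => partial_prod m0 B n x) = fun n => \prod_(1 <= j < n.+1) m0 (B ^+ j *m x).
  by apply/funext => n; rewrite partial_prodE.
have {}Hh x : (fun n => \prod_(1 <= j < n.+1) m0 (B ^+ j *m x)) @ \oo --> h x.
  by rewrite -pE; exact: Hh.
have -> : scaling_hat A Q = h by apply/funext => x; exact/cvg_lim.
have uniq_lim x l : (fun n => \prod_(1 <= j < n.+1) m0 (B ^+ j *m x)) @ \oo --> l -> h x = l.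
  by move=> H; apply: (cvg_unique _ (Hh x) H).
split => //.
  apply: uniq_lim; rewrite (_ : (fun n => _) = fun=> 1); first exact: cvg_cst.
  by apply/funext => n; rewrite big1// => j _; rewrite mulmx0 mask_0.
move=> k k0; apply: nonneg_zero_vanishes => //.
  move=> x; rewrite -(cvg_lim _ (Hh x))//; apply: limr_ge; first by apply/cvg_ex; exists (h x).
  by near=> n; apply: prodr_ge0 => j _; exact: mask_ge0.
have [j mj] := invtr_orbit k0; apply: uniq_lim.
apply: cvg_near_cst; exists j.+1 => // n /= jn.
rewrite (@big_cat_nat _ _ _ j.+1)//=; last by rewrite ltnW.
by rewrite [X in _ * X]big_ltn ?ltnS// mj mul0r mulr0.
Unshelve. all: by end_near. Qed.

End Mask.

(** * Strang-Fix conditions and polynomial reproduction *)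

Section MultiplierPowers.
Variables (R : realType) (d : nat).
Local Notation V := 'cV[R]_d.
Local Open Scope complex_scope.
Implicit Types (P : V -> R) (f g w : V -> R[i]) (s t : seq 'I_d).

Definition realC P : V -> R[i] := fun x => (P x)%:C.

Lemma re_realM P f : re (fun x => realC P x * f x) = fun x => P x * re f x.
Proof. by apply/funext => x; rewrite /re /=; case: (f x) => a b /=; ring. Qed.

Lemma im_realM P f : im (fun x => realC P x * f x) = fun x => P x * im f x.
Proof. by apply/funext => x; rewrite /im /=; case: (f x) => a b /=; ring. Qed.

Lemma CSG_realC P : SG P -> CSG (realC P).
Proof. by split => //; exact: SG_cst. Qed.

Lemma CSch_realM P f : SG P -> CSch f -> CSch (fun x => realC P x * f x).
Proof. by move=> /CSG_realC; exact: CSchM. Qed.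

Lemma CSch_modulate f (a : V) : CSch f -> CSch (fun x => f x * expi (- dotp a x)).
Proof.
move=> Hf; rewrite (_ : (fun x => _) = fun x => expi (dotp x (- a) + 0) * f x).
  by apply: CSchM => //; exact: CSG_expi.
by apply/funext => x; rewrite addr0 dotpNr dotpC mulrC.
Qed.

Lemma fourier_shift f (a x : V) :
  fourier f (a + x) = fourier (fun y => f y * expi (- dotp a y)) x.
Proof.
by congr cint; apply/funext => y; rewrite dotpD opprD expiD mulrA.
Qed.

(** A translate of a Fourier transform is the transform of a modulated function,
    so each convolution multiplies by P on the Fourier side. *)
Lemma convolution_powE (T : functional R d) P : SG P ->
  (forall f, CSch f -> T (fourier f) = cint (fun x => realC P x * f x)) ->
  forall m f, (0 < m)%N -> CSch f ->
    convolution_pow T m (fourier f) = cint (fun x => realC (powf P m) x * f x).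
Proof.
move=> sP HT [//|m] f _; rewrite /convolution_pow /=.
elim: m f => [|m IH] f Hf.
  by rewrite /= HT//; congr cint; apply/funext => x; rewrite /realC /= mulr1.
have HM : CSch (fun x => realC (powf P m.+1) x * f x).
  by apply: CSch_realM => //; exact: SG_powf.
rewrite iterS /convolution.
rewrite (_ : (fun x => _) = fourier (fun x => realC (powf P m.+1) x * f x)).
  rewrite HT//; congr cint; apply/funext => x.
  have -> : realC (powf P m.+2) x = realC P x * realC (powf P m.+1) x by exact: rmorphM.
  by rewrite mulrA.
apply/funext => x; rewrite (_ : (fun y => _) = fourier (fun y => f y * expi (- dotp x y))).
  rewrite IH; last exact: CSch_modulate.
  by congr cint; apply/funext => y; rewrite mulrA.
by apply/funext => y; exact: fourier_shift.
Qed.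

(** The Leibniz formula, with its coefficients at x independent of g and the terms
    of lower order in g kept apart. *)
Lemma leibniz_leading s P x : SG P -> exists L : seq (R * seq 'I_d), forall g : V -> R, SG g ->
  pds s (fun y => P y * g y) x =
  P x * pds s g x + \sum_(e <- L | (size e.2 < size s)%N) e.1 * pds e.2 g x.
Proof.
elim/last_ind: s P => [|s i IH] P sP.
  by exists [::] => g _; rewrite big_nil addr0.
have [L1 H1] := IH _ sP; have [L2 H2] := IH _ (SG_pd i sP).
exists ([seq (e.1, rcons e.2 i) | e <- L1] ++
   (pd i P x, s) :: [seq e <- L2 | (size e.2 < size s)%N]) => g sg.
have gi := SG_pd i sg; have Pi := SG_pd i sP.
rewrite !pds_rcons pdM; [|exact: SG_pdable..].
rewrite pdsD; [|exact: SGM..].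
rewrite H1// H2// big_cat big_map big_cons /= size_rcons ltnSn big_filter_cond -addrA.
congr (_ + (_ + (_ + _))).
  by apply: eq_big => e; [rewrite size_rcons|rewrite pds_rcons].
by apply: eq_bigl => e; apply/idP/andP => [h|[]//]; split=> //; exact: leqW.
Qed.

Lemma pderivs_leading s P x : SG P -> exists L : seq (R * seq 'I_d), forall g, CSG g ->
  pderivs s (fun y => realC P y * g y) x =
  realC P x * pderivs s g x + \sum_(e <- L | (size e.2 < size s)%N) e.1%:C * pderivs e.2 g x.
Proof.
move=> sP; have [L HL] := leibniz_leading s x sP; exists L => g [g1 g2].
have Re_sum : complex.Re (\sum_(e <- L | (size e.2 < size s)%N) e.1%:C * pderivs e.2 g x) =
    \sum_(e <- L | (size e.2 < size s)%N) e.1 * pds e.2 (re g) x.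
  rewrite (big_morph (fun z : R[i] => complex.Re z) (op1 := +%R) (id1 := 0))//; last by move=> [? ?] [? ?].
  by apply: eq_bigr => e _; rewrite pderivs_eq /= mul0r subr0.
have Im_sum : complex.Im (\sum_(e <- L | (size e.2 < size s)%N) e.1%:C * pderivs e.2 g x) =
    \sum_(e <- L | (size e.2 < size s)%N) e.1 * pds e.2 (im g) x.
  rewrite (big_morph (fun z : R[i] => complex.Im z) (op1 := +%R) (id1 := 0))//; last by move=> [? ?] [? ?].
  by apply: eq_bigr => e _; rewrite pderivs_eq /= mul0r addr0.
rewrite !pderivs_eq re_realM im_realM !HL// -Re_sum -Im_sum.
by case: (\sum_(e <- L | _) _) => a b; apply: c_eq => /=; ring.
Qed.

Lemma pds0 s : pds s (fun=> 0 : R) = (fun=> 0 : R) :> (V -> R).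
Proof. by elim: s => //= i s ->; rewrite pd_cst. Qed.

(** The sequence of partial derivatives that the multi-index n stands for. *)
Definition multi_seq (n : 'I_d -> nat) : seq 'I_d := flatten [seq nseq (n i) i | i <- enum 'I_d].

Lemma size_multi_seq n : size (multi_seq n) = (\sum_i n i)%N.
Proof.
rewrite size_flatten /shape -map_comp sumnE big_map big_enum /=.
by apply: eq_bigr => i _; rewrite /= size_nseq.
Qed.

Lemma xmon_multi_seq n (x : V) : xmon (multi_seq n) x = \prod_i (x i 0)%:C ^+ n i.
Proof.
rewrite /xmon big_flatten big_map big_enum /=; apply: eq_bigr => i _.
by rewrite big_nseq iter_mulr_1.
Qed.

End MultiplierPowers.

Section ShiftSpan.
Variables (R : realType) (d : nat) (P : 'cV[R]_d -> R) (N : nat).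
Hypotheses (sP : SG P) (P0 : P 0 = 1).
Hypothesis vanP : forall k : 'cV[int]_d, k != 0 -> vanishes N P ((2 * pi) *: intR R k).
Local Notation V := 'cV[R]_d.
Local Open Scope complex_scope.
Implicit Types (f g w : V -> R[i]) (s t : seq 'I_d).

Lemma pderivs_lattice0 s g (k : 'cV[int]_d) : CSG g -> (size s < N)%N -> k != 0 ->
  pderivs s (fun y => realC P y * g y) ((2 * pi) *: intR R k) = 0.
Proof.
move=> [g1 g2] sN k0; rewrite pderivs_eq re_realM im_realM.
have van (h : V -> R) : SG h -> pds s (fun y => P y * h y) ((2 * pi) *: intR R k) = 0.
  move=> sh; apply: (@vanishesM _ _ N 0%N _ _ _ sP sh (vanP k0)) => //.
  by rewrite addn0.
by rewrite !van.
Qed.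

(** Poisson summation for the derivatives of P g, which vanish on the dual lattice
    outside the origin. *)
Lemma monomial_sum s g : CSch g -> (size s < N)%N ->
  has_csum (fun k => xmon s (intR R k) * fourier (fun y => realC P y * g y) (intR R k))
    (((2 * pi) ^+ d)%:C * (minus_i R ^+ size s * pderivs s (fun y => realC P y * g y) 0)).
Proof.
move=> Hg sN; have Hw := CSch_realM sP Hg.
have := @poisson_vanishing R d (fun y => minus_i R ^+ size s * pderivs s (fun y => realC P y * g y) y).
move=> /(_ (CSchZ _ (CSch_pderivs s Hw))) H.
have {}H := H (fun k k0 => etrans (congr1 _ (pderivs_lattice0 (CSch_CSG Hg) sN k0)) (mulr0 _)).
by congr has_csum: H; apply/funext => k; rewrite xmon_fourier.
Qed.

Lemma minus_i_neq0 : minus_i R != 0.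
Proof. by rewrite /minus_i eq_complex /= oppr_eq0 oner_eq0 andbF. Qed.

(** Since P = 1 at the origin, the moment sums form a unitriangular system in the
    derivatives of g at the origin, which is solved by induction on the order. *)
Lemma derivative_sum s : (size s < N)%N -> exists c : 'cV[int]_d -> R[i], forall g, CSch g ->
  has_csum (fun k => c k * fourier (fun y => realC P y * g y) (intR R k))
    (((2 * pi) ^+ d)%:C * pderivs s g 0).
Proof.
have [n] := ubnP (size s); elim: n s => // n IH s; rewrite ltnS => sn sN.
have [L HL] := pderivs_leading s 0 sP.
have /choice[c Hc] : forall t, exists c : 'cV[int]_d -> R[i], (size t < size s)%N ->
    forall g, CSch g -> has_csum (fun k => c k * fourier (fun y => realC P y * g y) (intR R k))
      (((2 * pi) ^+ d)%:C * pderivs t g 0).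
  move=> t; have [ts|] := ltnP (size t) (size s); last by exists (fun=> 0).
  by have [|c Hc] := IH t (leq_trans ts sn); [exact: ltn_trans sN|exists c].
exists (fun k => (minus_i R ^- size s) * xmon s (intR R k) +
  -1 * \sum_(e <- L | (size e.2 < size s)%N) e.1%:C * c e.2 k) => g Hg.
have HA := has_csumZ (minus_i R ^- size s) (monomial_sum Hg sN).
have HB := @has_csum_sum R d _ L (fun e => size e.2 < size s)%N
  (fun e k => e.1%:C * (c e.2 k * fourier (fun y => realC P y * g y) (intR R k)))
  (fun e => e.1%:C * (((2 * pi) ^+ d)%:C * pderivs e.2 g 0))
  (fun e es => has_csumZ _ (Hc e.2 es g Hg)).
have := has_csumD HA (has_csumZ (-1) HB).
rewrite (_ : minus_i R ^- size s * _ + _ = ((2 * pi) ^+ d)%:C * pderivs s g 0).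
  congr has_csum; apply/funext => k; rewrite mulrDl mulrA; congr (_ + _).
  by rewrite -mulrA mulr_suml; congr (_ * _); apply: eq_bigr => e _; rewrite mulrA.
rewrite (HL g (CSch_CSG Hg)) /realC P0 mul1r.
rewrite [X in -1 * X](_ : _ = ((2 * pi) ^+ d)%:C *
   \sum_(e <- L | (size e.2 < size s)%N) e.1%:C * pderivs e.2 g 0); last first.
  by rewrite mulr_sumr; apply: eq_bigr => e _; rewrite mulrCA.
move: (\sum_(e <- L | _) _) => S.
have mn : minus_i R ^+ size s != 0 by rewrite expf_neq0// minus_i_neq0.
by move: (minus_i R ^+ size s) mn => M M0; move: (pderivs s g 0) (((2 * pi) ^+ d)%:C) => D C; field.
Qed.

(** The Fourier inversion formula for a derivative of g, at the origin. *)
Lemma cint_monomial s g : CSch g -> cint (fun x => xmon s x * fourier g x) =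
  ((2 * pi) ^+ d)%:C * (minus_i R ^+ size s * pderivs s g 0).
Proof.
move=> Hg; have HD := CSchZ (minus_i R ^+ size s) (CSch_pderivs s Hg).
rewrite -(fourier_inversion 0 HD); congr cint; apply/funext => x.
by rewrite xmon_fourier// -(scale0r (0 : V)) dotpZr mul0r expi0 mulr1.
Qed.

Lemma monomial_span s : (size s < N)%N -> exists c : 'cV[int]_d -> R[i], forall g, CSch g ->
  has_csum (fun k => c k * fourier (fun y => realC P y * g y) (intR R k))
    (cint (fun x => xmon s x * fourier g x)).
Proof.
move=> sN; have [c Hc] := derivative_sum sN; exists (fun k => minus_i R ^+ size s * c k) => g Hg.
rewrite cint_monomial// mulrCA.
by have := has_csumZ (minus_i R ^+ size s) (Hc g Hg); congr has_csum; apply/funext => k; rewrite mulrA.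
Qed.

Lemma cint_sum (I : Type) (r : seq I) (Q : pred I) (a : I -> R[i]) (h : I -> V -> R[i]) :
  (forall i, CSch (h i)) ->
  cint (fun x => \sum_(i <- r | Q i) a i * h i x) = \sum_(i <- r | Q i) a i * cint (h i).
Proof.
move=> Hh; suff [] : CSch (fun x => \sum_(i <- r | Q i) a i * h i x) /\
  cint (fun x => \sum_(i <- r | Q i) a i * h i x) = \sum_(i <- r | Q i) a i * cint (h i) by [].
elim: r => [|i r [IH1 IH2]].
  rewrite big_nil (_ : (fun x => _) = fun=> 0); last by apply/funext => x; rewrite big_nil.
  by split; [split; exact: Sch0|rewrite /cint /re /im /= int0].
rewrite big_cons (_ : (fun x => _) = if Q i then fun x => a i * h i x + \sum_(i <- r | Q i) a i * h i x
   else fun x => \sum_(i <- r | Q i) a i * h i x).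
  case: ifP => // Qi; have Hi := CSchZ (a i) (Hh i).
  by split; [exact: CSchD|rewrite cintD// cintZ// IH2].
by apply/funext => x; rewrite big_cons; case: ifP.
Qed.

Variable T : functional R d.
Hypothesis HT : forall f, CSch f -> T (fourier f) = cint (fun x => realC P x * f x).

Lemma translate_fourier k g : CSch g ->
  translate k T (fourier g) = fourier (fun y => realC P y * g y) (intR R k).
Proof.
move=> Hg; rewrite /translate.
rewrite (_ : (fun x => _) = fourier (fun y => g y * expi (- dotp (intR R k) y))).
  by rewrite HT; [congr cint; apply/funext => y; rewrite mulrA|exact: CSch_modulate].
by apply/funext => x; rewrite addrC fourier_shift.
Qed.

(** Test functions are Fourier transforms of Schwartz functions, for which the
    monomials have been expanded. *)
Theorem polynomials_in_span p : (0 < N)%N -> polynomial_deg_le N.-1 p -> in_shift_span T p.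
Proof.
move=> N0 [a pE].
have /choice[c Hc] : forall al : {ffun 'I_d -> 'I_N.-1.+1}, exists c : 'cV[int]_d -> R[i],
    (\sum_i al i <= N.-1)%N -> forall g, CSch g ->
    has_csum (fun k => c k * fourier (fun y => realC P y * g y) (intR R k))
      (cint (fun x => xmon (multi_seq (fun i => al i)) x * fourier g x)).
  move=> al; have [le|_] := leqP (\sum_i al i)%N N.-1; last by exists (fun=> 0).
  have [|c Hc] := @monomial_span (multi_seq (fun i => al i)); last by exists c.
  by rewrite size_multi_seq; apply: leq_ltn_trans le _; rewrite prednK.
exists (fun k => \sum_(al : {ffun 'I_d -> 'I_N.-1.+1} | (\sum_i al i <= N.-1)%N) a al * c al k).
move=> f /test_function_CSch/fourier_surjective[g Hg ->]; apply: has_csum_unconditional.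
have := @has_csum_sum R d _ (index_enum {ffun 'I_d -> 'I_N.-1.+1}) (fun al => \sum_i al i <= N.-1)%N _ _
  (fun al h => has_csumZ (a al) (Hc al h g Hg)).
rewrite -cint_sum => [|al]; last by apply: CSchM; [exact: CSG_xmon|exact: CSch_fourier].
congr has_csum.
  apply/funext => k; rewrite translate_fourier// mulr_suml.
  by apply: eq_bigr => al _; rewrite mulrA.
congr cint; apply/funext => x; rewrite pE mulr_suml; apply: eq_bigr => al _.
by rewrite xmon_multi_seq mulrA.
Qed.

End ShiftSpan.

Theorem mainTheorem5 (R : realType) (d : nat) (A : 'M[int]_d) (Q : 'M[R]_d)
    (m : nat) (phi : functional R d)
    (hd : (0 < d)%N) (hA : isotropic_dilation R A)
    (hQ : isotropic_factor A Q) (hm : (1 <= m)%N)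
    (hphi : elliptic_scaling A Q phi) :
  strang_fix (convolution_pow phi m) (2 * m - 1) /\
  forall p : 'cV[R]_d -> R[i], polynomial_deg_le (2 * m - 1) p ->
    in_shift_span (convolution_pow phi m) p.
Proof.
have [sF F0 vanF] := scaling_hat_props hd hA hQ.
set F := scaling_hat A Q in sF F0 vanF.
pose P := powf F m; have sP : SG P := SG_powf m sF.
have P0 : P 0 = 1 by rewrite /P powfE F0 expr1n.
have vanP (k : 'cV[int]_d) : k != 0 -> vanishes (m * 2) P ((2 * pi) *: intR R k).
  by move=> k0; apply: vanishes_powf => //; exact: vanF.
have HT f : CSch f -> convolution_pow phi m (fourier f) = cint (fun x => realC P x * f x).
  move=> Hf; apply: convolution_powE => // g Hg.
  by case: hphi => _ [_]; apply; exact/schwartz_CSch.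
rewrite (_ : (2 * m - 1)%N = (m * 2).-1); last by rewrite mulnC subn1.
have m2 : (0 < m * 2)%N by rewrite muln_gt0 hm.
split; last by move=> p; exact: (polynomials_in_span sP P0 vanP HT m2).
exists (realC P); split.
- exact/CSG_smooth/CSG_realC.
- split; last by move=> f /schwartz_CSch; exact: HT.
  have [N [C HC]] := SG_slow sP; exists N, C => x; apply: le_trans (HC x).
  by apply: le_trans (normc_le_ReIm _) _; rewrite /= normr0 addr0.
- move=> k n k0 nm; rewrite /mderiv -/(multi_seq n).
  rewrite pderivs_eq (_ : re _ = P)// (_ : im _ = fun=> 0)// pds0 (vanP k k0)//.
  by rewrite size_multi_seq (leq_ltn_trans nm)// prednK.
Qed.
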